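(* Let $\mathbb G$ be an algebraic quantum group of compact type, with integral $\varphi$, and let $(N,\theta,\hat\theta,\mu)$ be a unital braided commutative measured Yetter--Drinfeld $\mathbb G^c$-$*$-algebra with canonical automorphisms $\gamma_\theta,\hat\gamma_\theta$. Let $A=\mathcal O(\mathbb G)\#N$ be the smash product $*$-algebra, $\alpha(m)=1\#m$, $\beta(m)=m_{[-1]}\#m_{[0]}$, $B=\alpha(N)$, $C=\beta(N)$, and consider the linear maps $$t_B:B\to C,\ \alpha(m)\mapsto\beta(m);\qquad t_C:C\to B,\ \beta(m)\mapsto\alpha(\gamma_\theta(m));$$ $$\Delta_B(h\#m)=(h_{(1)}\#1)\otimes(h_{(2)}\#m)\in A\times_BA;\qquad \Delta_C(h\#m)=(h_{(1)}\#1)\otimes(h_{(2)}\#m)\in A\times_CA;$$ $$S_A:A\to A,\ h\#m\mapsto\beta(\hat\gamma_\theta(m))(S(h)\#1);$$ $$\varepsilon_B:A\to B,\ \alpha(m)(h\#1)\mapsto\alpha(m\lhd h);\qquad {}_C\varepsilon:A\to C,\ (h\#1)\beta(m)\mapsto\beta(m\lhd S(h));$$ $$\mu_B:B\to\mathbb C,\ \alpha(m)\mapsto\mu(m);\qquad \mu_C:C\to\mathbb C,\ \beta(m)\mapsto\mu(m);$$ $${}_B\psi_B:A\to B,\ \alpha(m)(h\#1)\mapsto\varphi(h)\alpha(m);\qquad {}_C\phi_C:A\to C,\ (h\#1)\beta(m)\mapsto\varphi(h)\beta(m).$$ Then the collection $$\mathcal A(N,\theta,\hat\theta,\mu)=(A,B,C,t_B,t_C,\Delta_B,\Delta_C,\mu_B,\mu_C,{}_B\psi_B,{}_C\phi_C)$$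 is a unital measured multiplier Hopf $*$-algebroid, with antipode $S_A$, right counit $\varepsilon_B$ and left counit ${}_C\varepsilon$.
   Context: Algebraic quantum group of compact type $\mathbb G$: a unital Hopf $*$-algebra $\mathcal O(\mathbb G)$ over $\mathbb C$ (coproduct $\Delta$, counit $\varepsilon$, bijective antipode $S$ with $S\circ *\circ S\circ *=\mathrm{id}$) with a nonzero positive ($\varphi(hh^* )\ge0$) faithful functional $\varphi$ with $(\mathrm{id}\otimes\varphi)\Delta(h)=\varphi(h)1=(\varphi\otimes\mathrm{id})\Delta(h)$. A functional $f$ on an algebra is faithful if $f(ab)=0=f(ba)$ for all $b$ implies $a=0$. A unital braided commutative measured Yetter--Drinfeld $\mathbb G^c$-$*$-algebra $(N,\theta,\hat\theta,\mu)$ consists of: a unital $*$-algebra $N$; a unital $*$-homomorphism $\theta:N\to\mathcal O(\mathbb G)^{op}\otimes N$, $\theta(m)=m_{[-1]}^{op}\otimes m_{[0]}$ (with involution $(h^{op})^*=S^{-2}(h^* )^{op}$ on $\mathcal O(\mathbb G)^{op}$) such that $m_{[-1](1)}\otimes m_{[-1](2)}\otimes m_{[0]}=m_{[-1]}\otimes m_{[0][-1]}\otimes m_{[0][0]}$ and $\varepsilon(m_{[-1]})m_{[0]}=m$; an action $\hat\theta$ of the dual quantum group, which is equivalent to a right Hopf $*$-algebra action $\lhd$ of $\mathcal O(\mathbb G)$ on $N$ (unital module, $(mn)\lhd h=(m\lhd h_{(1)})(n\lhd h_{(2)})$, $1\lhd h=\varepsilon(h)1$, $(m\lhd h)^*=m^*\lhd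 S(h)^*$) and enters here only through $\lhd$; such that $$\theta(m\lhd h)=(S^{-1}(h_{(3)})m_{[-1]}h_{(1)})^{op}\otimes(m_{[0]}\lhd h_{(2)}),\quad mn=(n\lhd m_{[-1]})m_{[0]}=n_{[0]}(m\lhd S(n_{[-1]}));$$ and a nonzero positive faithful functional $\mu$ on $N$ (Yetter--Drinfeld integral) with $(\mathrm{id}\otimes\mu)\theta(m)=\mu(m)1$ and $\mu(m\lhd h)=\varepsilon(h)\mu(m)$. Canonical automorphisms: $\gamma_\theta(m)=m_{[0]}\lhd S^{-1}(m_{[-1]})$, $\hat\gamma_\theta(m)=m_{[0]}\lhd S^2(m_{[-1]})$ (mutually inverse algebra automorphisms of $N$). Smash product: $A=\mathcal O(\mathbb G)\otimes N$ as a space, $(h\#m)(g\#n)=hg_{(1)}\#(m\lhd g_{(2)})n$, $(h\#m)^*=(h^* )_{(1)}\#(m^*\lhd(h^* )_{(2)})$, unit $1\#1$. One has $A=\mathrm{span}\{\alpha(m)(h\#1)\}=\mathrm{span}\{(h\#1)\beta(m)\}$. Unital measured multiplier Hopf $*$-algebroid (unital case of the definition, where the extended Takeuchi products are the classical ones): a collection $(A,B,C,t_B,t_C,\Delta_B,\Delta_C,\mu_B,\mu_C,{}_B\psi_B,{}_C\phi_C)$ such that: (M1) $A$ is a unital $*$-algebra and $B,C\subset A$ are unital $*$-subalgebras that commute elementwise. (M2) $t_B:B\to C$, $t_C:C\to B$ are anti-isomorphisms with $t_B\circ *\circ t_C\circ *=\mathrm{id}_C$. Let $A\otimes_BA$ be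 the quotient of $A\otimes A$ by the span of $ax\otimes b-a\otimes bt_B(x)$ ($x\in B$) and $A\otimes^CA$ the quotient by the span of $t_C(y)a\otimes b-a\otimes yb$ ($y\in C$). Takeuchi products: $A\times_BA=\{\sum a_i\otimes b_i\in A\otimes_BA:\sum xa_i\otimes b_i=\sum a_i\otimes t_B(x)b_i\ \forall x\in B\}$ and $A\times_CA=\{\sum a_i\otimes b_i\in A\otimes^CA:\sum a_it_C(y)\otimes b_i=\sum a_i\otimes b_iy\ \forall y\in C\}$, algebras under componentwise product. (M3) $\Delta_B:A\to A\times_BA$ and $\Delta_C:A\to A\times_CA$ are algebra homomorphisms with: (i) $\Delta(xya x'y')=(y\otimes x)\Delta(a)(y'\otimes x')$ for $\Delta\in\{\Delta_B,\Delta_C\}$, $x,x'\in B$, $y,y'\in C$, $a\in A$; (ii) $(\Delta_B\otimes\mathrm{id})\Delta_B=(\mathrm{id}\otimes\Delta_B)\Delta_B$, $(\Delta_C\otimes\mathrm{id})\Delta_C=(\mathrm{id}\otimes\Delta_C)\Delta_C$, $(\Delta_C\otimes\mathrm{id})\Delta_B=(\mathrm{id}\otimes\Delta_B)\Delta_C$, $(\Delta_B\otimes\mathrm{id})\Delta_C=(\mathrm{id}\otimes\Delta_C)\Delta_B$; (iii) $\Delta_C(a^* )$ is the image of $\Delta_B(a)$ under the well-defined map $A\otimes_BA\to A\otimes^CA$, $b\otimes c\mapsto b^*\otimes c^*$. Moreover there exist an anti-isomorphism $S_A:A\to A$ (antipode) and linear maps $\varepsilon_B:A\to B$, ${}_C\varepsilon:A\to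 C$ (right and left counit) with $\varepsilon_B(at_B(x))=x\varepsilon_B(a)$, $\varepsilon_B(ax)=\varepsilon_B(a)x$, ${}_C\varepsilon(ya)=y\,{}_C\varepsilon(a)$, ${}_C\varepsilon(t_C(y)a)={}_C\varepsilon(a)y$, and: (i) $S_A(t_B(x)t_C(y)at_B(x')t_C(y'))=x'y'S_A(a)xy$; (ii) $S_A\circ *\circ S_A\circ *=\mathrm{id}$; (iii) writing $\Delta_B(a)=\sum a'\otimes a''$ and $\Delta_C(a)=\sum\tilde a'\otimes\tilde a''$, for all $a\in A$: $\sum a''t_B(\varepsilon_B(a'))=a=\sum a'\varepsilon_B(a'')$ and $\sum{}_C\varepsilon(\tilde a')\tilde a''=a=\sum t_C({}_C\varepsilon(\tilde a''))\tilde a'$; (iv) $\sum S_A(\tilde a')\tilde a''=\varepsilon_B(a)$ and $\sum a'S_A(a'')={}_C\varepsilon(a)$. (M4) ${}_B\psi_B:A\to B$ is a $B$-bimodule map, ${}_C\phi_C:A\to C$ is a $C$-bimodule map (right and left partial integrals), and $\mu_B,\mu_C$ are nonzero positive faithful functionals on $B$, $C$, with: (i) $\sum a''t_B({}_B\psi_B(a'))={}_B\psi_B(a)$ and $\sum t_C({}_C\phi_C(\tilde a''))\tilde a'={}_C\phi_C(a)$ for all $a$; (ii) $\mu_B\circ t_C=\mu_C$, $\mu_C\circ t_B=\mu_B$, $\mu_B\circ\varepsilon_B=\mu_C\circ{}_C\varepsilon$; (iii) $\psi=\mu_B\circ{}_B\psi_B$ and $\phi=\mu_C\circ{}_C\phi_C$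 are positive faithful functionals on $A$. *)

(* Defs.v *)
From HB Require Import structures.
From mathcomp Require Import all_boot all_order all_algebra.
From mathcomp Require Import boolp classical_sets functions reals complex.

Set Implicit Arguments.
Unset Strict Implicit.
Unset Printing Implicit Defensive.

Import Order.TTheory GRing.Theory Num.Theory.
Local Open Scope ring_scope.
Local Open Scope quotient_scope.

Reserved Notation "V ⊗ W" (at level 40, left associativity).
Reserved Notation "\tsum_ ( v , w <- t ) E"
  (at level 41, E at level 41, v name, w name, t at level 50,
   format "'[' \tsum_ ( v ,  w  <-  t ) '/  '  E ']'").

Section TensorProduct.
Variable K : fieldType.
Implicit Types V W : lmodType K.

Definition balanced V W (U : zmodType) (f : V -> W -> U) : Prop :=
  [/\ forall v v' w, f (v + v') w = f v w + f v' w,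
      forall v w w', f v (w + w') = f v w + f v w' &
      forall c v w, f (c *: v) w = f v (c *: w)].

Definition formal_sum V W (U : zmodType) (f : V -> W -> U) (s : seq (V * W)) : U :=
  \sum_(p <- s) f p.1 p.2.

(* A list of pairs stands for the formal sum of the v ⊗ w; two of them are    *)
(* identified when no balanced map separates them.                            *)
Definition tensor_equiv V W (s t : seq (V * W)) : bool :=
  `[< forall (U : zmodType) (f : V -> W -> U), balanced f ->
        formal_sum f s = formal_sum f t >].

Lemma tensor_equiv_equiv V W : equiv_class_of (@tensor_equiv V W).
Proof.
split.
- by move=> s; apply/asboolP.
- by move=> s t; apply/asboolP/asboolP => h U f hf; rewrite h.
- by move=> t s u /asboolP h1 /asboolP h2; apply/asboolP => U f hf; rewrite h1 ?h2.
Qed.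

Canonical tensor_equivRel V W := EquivRelPack (@tensor_equiv_equiv V W).

Definition tensor V W := {eq_quot (@tensor_equiv V W)}.
End TensorProduct.

Notation "V ⊗ W" := (@tensor _ V W) : type_scope.

Section TensorOps.
Variables (K : fieldType) (V W : lmodType K).
Local Notation T := (tensor V W).
HB.instance Definition _ := Choice.on T.
HB.instance Definition _ := Quotient.on T.

Definition tens (v : V) (w : W) : T := \pi_T [:: (v, w)].

(* The map on the tensor product induced by a balanced map; it does not depend *)
(* on the chosen representative, see tlift_pi and tlift_tens.                  *)
Definition tlift (U : zmodType) (f : V -> W -> U) (t : T) : U :=
  formal_sum f (repr t).

Lemma tlift_pi (U : zmodType) (f : V -> W -> U) s :
  balanced f -> tlift f (\pi_T s) = formal_sum f s.
Proof. by move=> hf; rewrite /tlift; case: piP => t /eqmodP/asboolP ->. Qed.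

Lemma tensorP (x y : T) :
  (forall (U : zmodType) (f : V -> W -> U), balanced f -> tlift f x = tlift f y) ->
  x = y.
Proof.
move: x y; apply: quotW => s; apply: quotW => t h.
by apply/eqmodP/asboolP => U f hf; have := h U f hf; rewrite !tlift_pi.
Qed.

Definition tadd (x y : T) : T := \pi_T (repr x ++ repr y).
Definition topp (x : T) : T := \pi_T [seq (- p.1, p.2) | p <- repr x].
Definition tscale (c : K) (x : T) : T := \pi_T [seq (c *: p.1, p.2) | p <- repr x].

Section Balanced.
Variables (U : zmodType) (f : V -> W -> U).
Hypothesis hf : balanced f.

Lemma balanced0l w : f 0 w = 0.
Proof. by case: hf => hD _ _; apply: (addrI (f 0 w)); rewrite -hD !addr0. Qed.

Lemma balanced0r v : f v 0 = 0.
Proof. by case: hf => _ hD _; apply: (addrI (f v 0)); rewrite -hD !addr0. Qed.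

Lemma balancedNl v w : f (- v) w = - f v w.
Proof.
case: hf => hD _ _; apply: (addrI (f v w)).
by rewrite -hD !subrr balanced0l.
Qed.

Lemma balancedZ c : balanced (fun v w => f (c *: v) w).
Proof.
case: hf => h1 h2 h3; split=> *; rewrite ?scalerDr //.
by rewrite scalerA mulrC -scalerA h3.
Qed.

Lemma tlift_add x y : tlift f (tadd x y) = tlift f x + tlift f y.
Proof. by rewrite tlift_pi // /formal_sum big_cat. Qed.

Lemma tlift_opp x : tlift f (topp x) = - tlift f x.
Proof.
rewrite tlift_pi // /formal_sum big_map /= -sumrN.
by apply: eq_bigr => p _; rewrite balancedNl.
Qed.

Lemma tlift_scale c x : tlift f (tscale c x) = tlift (fun v w => f (c *: v) w) x.
Proof. by rewrite tlift_pi // /formal_sum big_map. Qed.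

Lemma tlift_nil : tlift f (\pi_T [::]) = 0.
Proof. by rewrite tlift_pi // /formal_sum big_nil. Qed.
End Balanced.

Fact taddA : associative tadd.
Proof. by move=> x y z; apply: tensorP => U f hf; rewrite !tlift_add // addrA. Qed.
Fact taddC : commutative tadd.
Proof. by move=> x y; apply: tensorP => U f hf; rewrite !tlift_add // addrC. Qed.
Fact tadd0 : left_id (\pi_T [::]) tadd.
Proof.
by move=> x; apply: tensorP => U f hf; rewrite !tlift_add // tlift_nil // add0r.
Qed.
Fact taddN : left_inverse (\pi_T [::]) topp tadd.
Proof.
move=> x; apply: tensorP => U f hf.
by rewrite !tlift_add // tlift_opp // tlift_nil // addNr.
Qed.
HB.instance Definition _ := GRing.isZmodule.Build T taddA taddC tadd0 taddN.

Fact tscaleA a b x : tscale a (tscale b x) = tscale (a * b) x.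
Proof.
apply: tensorP => U f hf; rewrite !tlift_scale //; last exact: balancedZ.
by apply: eq_bigr => p _; rewrite scalerA mulrC.
Qed.
Fact tscale1 : left_id 1 tscale.
Proof.
move=> x; apply: tensorP => U f hf; rewrite tlift_scale //.
by apply: eq_bigr => p _; rewrite scale1r.
Qed.
Fact tscaleDr : right_distributive tscale +%R.
Proof.
move=> c x y; apply: tensorP => U f hf.
by rewrite tlift_scale // !tlift_add ?tlift_scale //; apply: balancedZ.
Qed.
Fact tscaleDl x : {morph tscale^~ x : a b / a + b}.
Proof.
move=> a b; apply: tensorP => U f hf.
rewrite tlift_add // !tlift_scale // /tlift /formal_sum -big_split /=.
by apply: eq_bigr => p _; case: hf => hD _ _; rewrite scalerDl hD.
Qed.
HB.instance Definition _ :=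
  GRing.Zmodule_isLmodule.Build K T tscaleA tscale1 tscaleDr tscaleDl.

End TensorOps.

Arguments tlift {K V W U} f t.
Notation "v ⊗ w" := (@tens _ _ _ v w) : ring_scope.
Notation "\tsum_ ( v , w <- t ) E" := (tlift (fun v w => E) t) : ring_scope.

Section TensorTheory.
Variables (K : fieldType) (V W : lmodType K).
Implicit Types (x y : V ⊗ W).

Lemma tlift_tens (U : zmodType) (f : V -> W -> U) v w :
  balanced f -> tlift f (v ⊗ w) = f v w.
Proof. by move=> hf; rewrite tlift_pi // /formal_sum big_seq1. Qed.

Lemma eq_tlift (U : zmodType) (f g : V -> W -> U) x :
  (forall v w, f v w = g v w) -> tlift f x = tlift g x.
Proof. by move=> fg; apply: eq_bigr => p _. Qed.

Lemma tliftD (U : zmodType) (f : V -> W -> U) :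
  balanced f -> {morph tlift f : x y / x + y}.
Proof. by move=> hf x y; rewrite tlift_add. Qed.

Lemma tlift0 (U : zmodType) (f : V -> W -> U) : balanced f -> tlift f 0 = 0.
Proof. by move=> hf; rewrite tlift_nil. Qed.

Lemma tliftZ (U : zmodType) (f : V -> W -> U) c x :
  balanced f -> tlift f (c *: x) = tlift (fun v w => f (c *: v) w) x.
Proof. by move=> hf; rewrite tlift_scale. Qed.

Lemma tlift_addf (U : zmodType) (f g : V -> W -> U) x :
  tlift (fun v w => f v w + g v w) x = tlift f x + tlift g x.
Proof. by rewrite /tlift /formal_sum big_split. Qed.

Lemma raddf_tlift (U U' : zmodType) (g : U -> U') (f : V -> W -> U) x :
  {morph g : a b / a + b} -> g (tlift f x) = tlift (fun v w => g (f v w)) x.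
Proof.
move=> gD; have g0 : g 0 = 0 by apply: (addrI (g 0)); rewrite -gD !addr0.
by rewrite /tlift /formal_sum (big_morph g gD g0).
Qed.

Lemma tens_balanced : balanced (@tens K V W).
Proof.
split=> *; apply: tensorP => U f hf; rewrite ?tliftD // !tlift_tens //;
  by case: hf.
Qed.

Lemma tensDl v v' w : (v + v') ⊗ w = v ⊗ w + v' ⊗ w :> V ⊗ W.
Proof. by case: tens_balanced. Qed.
Lemma tensDr v w w' : v ⊗ (w + w') = v ⊗ w + v ⊗ w' :> V ⊗ W.
Proof. by case: tens_balanced. Qed.
Lemma tensZl c v w : (c *: v) ⊗ w = c *: (v ⊗ w) :> V ⊗ W.
Proof.
by apply: tensorP => U f hf; rewrite tliftZ // !tlift_tens //; apply: balancedZ.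
Qed.
Lemma tensZr c v w : v ⊗ (c *: w) = c *: (v ⊗ w) :> V ⊗ W.
Proof. by rewrite -tensZl; case: tens_balanced. Qed.

Lemma tensorE x : x = \tsum_(v, w <- x) (v ⊗ w).
Proof.
apply: tensorP => U f hf; rewrite raddf_tlift; last exact: tliftD.
by apply: eq_tlift => v w; rewrite tlift_tens.
Qed.

Lemma tensor_ind (P : V ⊗ W -> Prop) :
  P 0 -> (forall x y, P x -> P y -> P (x + y)) -> (forall v w, P (v ⊗ w)) ->
  forall x, P x.
Proof.
by move=> P0 PD Pt x; rewrite (tensorE x) /tlift /formal_sum; apply: big_ind.
Qed.

Lemma tens_ext (U : zmodType) (f g : V ⊗ W -> U) :
  {morph f : x y / x + y} -> {morph g : x y / x + y} ->
  (forall v w, f (v ⊗ w) = g (v ⊗ w)) -> f =1 g.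
Proof.
move=> fD gD fg x; rewrite (tensorE x) !raddf_tlift //.
exact: eq_tlift.
Qed.

End TensorTheory.

Section TensorRing.
Variables (K : fieldType) (A B : algType K).
Implicit Types x y z : A ⊗ B.

Definition tmul x y : A ⊗ B :=
  \tsum_(a, b <- x) \tsum_(a', b' <- y) ((a * a') ⊗ (b * b')).

Lemma tmul_balanced2 (a : A) (b : B) :
  balanced (fun a' b' => (a * a') ⊗ (b * b')).
Proof.
by split=> *; rewrite ?mulrDr ?tensDl ?tensDr // -!scalerAr tensZl tensZr.
Qed.

Lemma tmul_balanced1 y :
  balanced (fun (a : A) (b : B) => \tsum_(a', b' <- y) ((a * a') ⊗ (b * b'))).
Proof.
split=> *; rewrite -?tlift_addf; apply: eq_tlift => *.
- by rewrite mulrDl tensDl.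
- by rewrite mulrDl tensDr.
- by rewrite -!scalerAl tensZl tensZr.
Qed.

Lemma tmul_tens (a a' : A) (b b' : B) :
  tmul (a ⊗ b) (a' ⊗ b') = (a * a') ⊗ (b * b').
Proof.
rewrite /tmul tlift_tens ?tlift_tens //; first exact: tmul_balanced2.
exact: tmul_balanced1.
Qed.

Fact tmulDl : left_distributive tmul +%R.
Proof. by move=> x y z; apply: tliftD; apply: tmul_balanced1. Qed.

Fact tmulDr : right_distributive tmul +%R.
Proof.
move=> x y z; rewrite /tmul -tlift_addf; apply: eq_tlift => a b.
by rewrite tliftD //; apply: tmul_balanced2.
Qed.

Fact tmulA : associative tmul.
Proof.
move=> x y z; move: x.
apply: tens_ext => [u v|u v|a b]; rewrite ?tmulDl //.
move: y; apply: tens_ext => [u v|u v|a' b']; rewrite ?(tmulDl, tmulDr) //.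
move: z; apply: tens_ext => [u v|u v|a'' b'']; rewrite ?(tmulDl, tmulDr) //.
by rewrite !tmul_tens !mulrA.
Qed.

Fact tmul1l : left_id (1 ⊗ 1) tmul.
Proof.
apply: tens_ext => [u v|u v|a b]; rewrite ?tmulDr //.
by rewrite tmul_tens !mul1r.
Qed.

Fact tmul1r : right_id (1 ⊗ 1) tmul.
Proof.
apply: tens_ext => [u v|u v|a b]; rewrite ?tmulDl //.
by rewrite tmul_tens !mulr1.
Qed.

HB.instance Definition _ := GRing.Zmodule_isPzRing.Build (A ⊗ B)%type
  tmulA tmul1l tmul1r tmulDl tmulDr.

Lemma tensM (a a' : A) (b b' : B) :
  (a ⊗ b) * (a' ⊗ b') = (a * a') ⊗ (b * b').
Proof. exact: tmul_tens. Qed.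

Lemma tens11 : 1 ⊗ 1 = 1 :> A ⊗ B.
Proof. by []. Qed.

End TensorRing.

Section QuotientSpace.
Variables (K : fieldType) (V : lmodType K) (G : set V).

Inductive lspan : V -> Prop :=
| span0 : lspan 0
| span_cons c g v : G g -> lspan v -> lspan (c *: g + v).

Lemma spanD v w : lspan v -> lspan w -> lspan (v + w).
Proof.
elim=> [|c g u Gg _ IH] sw; first by rewrite add0r.
by rewrite -addrA; apply: span_cons => //; apply: IH.
Qed.

Lemma spanZ c v : lspan v -> lspan (c *: v).
Proof.
elim=> [|d g u Gg _ IH]; first by rewrite scaler0; apply: span0.
by rewrite scalerDr scalerA; apply: span_cons.
Qed.

Lemma spanN v : lspan v -> lspan (- v).
Proof. by move=> sv; rewrite -scaleN1r; apply: spanZ. Qed.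

Lemma mem_lspan g : G g -> lspan g.
Proof.
by move=> Gg; rewrite -[g]scale1r -[_ *: g]addr0; apply: span_cons => //; apply: span0.
Qed.

Definition quot_equiv (x y : V) : bool := `[< lspan (x - y) >].

Lemma quot_equiv_equiv : equiv_class_of quot_equiv.
Proof.
split.
- by move=> x; apply/asboolP; rewrite subrr; apply: span0.
- by move=> x y; apply/asboolP/asboolP => /spanN; rewrite opprB.
- move=> y x z /asboolP h1 /asboolP h2; apply/asboolP.
  by have := spanD h1 h2; rewrite addrA subrK.
Qed.

Canonical quot_equivRel := EquivRelPack quot_equiv_equiv.

Definition quot := {eq_quot quot_equiv}.
HB.instance Definition _ := Choice.on quot.
HB.instance Definition _ := Quotient.on quot.

Definition qpi (x : V) : quot := \pi_quot x.

Lemma qpiP x y : qpi x = qpi y <-> lspan (x - y).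
Proof. by split=> [/eqmodP/asboolP|h]; last exact/eqmodP/asboolP. Qed.

Definition qadd (u v : quot) := qpi (repr u + repr v).
Definition qopp (u : quot) := qpi (- repr u).
Definition qscale c (u : quot) := qpi (c *: repr u).

Lemma repr_qpi x : lspan (repr (qpi x) - x).
Proof. by apply/qpiP; rewrite /qpi reprK. Qed.

Lemma qaddE x y : qadd (qpi x) (qpi y) = qpi (x + y).
Proof.
apply/qpiP; rewrite opprD addrACA; apply: spanD; exact: repr_qpi.
Qed.

Lemma qoppE x : qopp (qpi x) = qpi (- x).
Proof. apply/qpiP; rewrite -opprD; apply: spanN; exact: repr_qpi. Qed.

Lemma qscaleE c x : qscale c (qpi x) = qpi (c *: x).
Proof. apply/qpiP; rewrite -scalerBr; apply: spanZ; exact: repr_qpi. Qed.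

Fact qaddA : associative qadd.
Proof.
by do 3! [apply: quotW => ?]; rewrite -!/(qpi _) !qaddE addrA.
Qed.
Fact qaddC : commutative qadd.
Proof. by do 2! [apply: quotW => ?]; rewrite -!/(qpi _) !qaddE addrC. Qed.
Fact qadd0 : left_id (qpi 0) qadd.
Proof. by apply: quotW => ?; rewrite -!/(qpi _) !qaddE add0r. Qed.
Fact qaddN : left_inverse (qpi 0) qopp qadd.
Proof. by apply: quotW => ?; rewrite -!/(qpi _) qoppE qaddE addNr. Qed.
HB.instance Definition _ := GRing.isZmodule.Build quot qaddA qaddC qadd0 qaddN.

Fact qscaleA a b u : qscale a (qscale b u) = qscale (a * b) u.
Proof. by move: u; apply: quotW => ?; rewrite -!/(qpi _) !qscaleE scalerA. Qed.
Fact qscale1 : left_id 1 qscale.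
Proof. by apply: quotW => ?; rewrite -!/(qpi _) !qscaleE scale1r. Qed.
Fact qscaleDr : right_distributive qscale +%R.
Proof.
move=> c; do 2! [apply: quotW => ?].
rewrite -!/(qpi _) -[LHS]/(qscale c (qadd _ _)) -[RHS]/(qadd _ _).
by rewrite qaddE !qscaleE qaddE scalerDr.
Qed.
Fact qscaleDl u : {morph qscale^~ u : a b / a + b}.
Proof.
move: u; apply: quotW => ? a b; rewrite -!/(qpi _) -[RHS]/(qadd _ _).
by rewrite !qscaleE qaddE scalerDl.
Qed.
HB.instance Definition _ :=
  GRing.Zmodule_isLmodule.Build K quot qscaleA qscale1 qscaleDr qscaleDl.

Fact qpi_is_linear : linear qpi.
Proof.
move=> c x y; rewrite -[RHS]/(qadd (qscale c _) _).
by rewrite qscaleE qaddE.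
Qed.
HB.instance Definition _ := GRing.isLinear.Build K V quot *:%R qpi qpi_is_linear.

(* The map on the quotient induced by an additive map that vanishes on G      *)
(* (see qlift_qpi). *)
Definition qlift (U : zmodType) (f : V -> U) (u : quot) : U := f (repr u).

Lemma qlift_qpi (U : lmodType K) (f : V -> U) x :
  linear f -> (forall g, G g -> f g = 0) -> qlift f (qpi x) = f x.
Proof.
move=> fL fG; have f0 : f 0 = 0.
  by have := fL (-1) 0 0; rewrite scaler0 addr0 scaleN1r addNr.
have fspan v : lspan v -> f v = 0.
  by elim=> [//|c g w Gg _ IH]; rewrite fL fG // IH scaler0 addr0.
apply/eqP; rewrite -subr_eq0 addrC -scaleN1r -fL scaleN1r addrC.
by apply/eqP/fspan/repr_qpi.
Qed.

End QuotientSpace.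

Arguments qpi {K V G} x.
Arguments qlift {K V G U} f u.

(* \tsum_(v, w <- t) E is E summed over any decomposition of t as a finite sum *)
(* of v ⊗ w; with t = coprod h this is Sweedler's notation.                    *)

Definition faithful_on (K : fieldType) (A : algType K) (B : set A) (f : A -> K) :=
  forall a, B a -> (forall b, B b -> f (a * b) = 0 /\ f (b * a) = 0) -> a = 0.

HB.mixin Record isStarAlgebra (K : numClosedFieldType) A of GRing.Algebra K A := {
  star : A -> A;
  starD : {morph star : x y / x + y};
  starZ : forall c x, star (c *: x) = c^* *: star x;
  starM : forall x y, star (x * y) = star y * star x;
  starK : involutive star
}.

#[short(type="starAlgType")]
HB.structure Definition StarAlgebra (K : numClosedFieldType) :=
  {A of isStarAlgebra K A & GRing.Algebra K A}.

(* In a numClosedFieldType such as R[i], 0 <= z says that z is real and        *)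
(* nonnegative.                                                               *)
Definition positive_on (K : numClosedFieldType) (A : starAlgType K) (B : set A)
  (f : A -> K) := forall a, B a -> 0 <= f (a * star a).

HB.mixin Record isHopfStarAlgebra (K : numClosedFieldType) H of StarAlgebra K H := {
  coprod : H -> (H ⊗ H)%type;
  counit : H -> K;
  antipode : H -> H;
  antipodeV : H -> H;
  coprod_linear : linear coprod;
  counit_linear : scalar counit;
  antipode_linear : linear antipode;
  coprod1 : coprod 1 = 1;
  coprodM : {morph coprod : h g / h * g};
  coprod_star : forall h,
    coprod (star h) = \tsum_(h1, h2 <- coprod h) (star h1 ⊗ star h2);
  coprodA : forall h,
    \tsum_(h1, h2 <- coprod h) \tsum_(h11, h12 <- coprod h1) (h11 ⊗ h12 ⊗ h2) =
    \tsum_(h1, h2 <- coprod h) \tsum_(h21, h22 <- coprod h2) (h1 ⊗ h21 ⊗ h22);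
  counit1 : counit 1 = 1;
  counitM : {morph counit : h g / h * g};
  counitl : forall h, \tsum_(h1, h2 <- coprod h) (counit h1 *: h2) = h;
  counitr : forall h, \tsum_(h1, h2 <- coprod h) (counit h2 *: h1) = h;
  antipodel : forall h, \tsum_(h1, h2 <- coprod h) (antipode h1 * h2) = (counit h)%:A;
  antipoder : forall h, \tsum_(h1, h2 <- coprod h) (h1 * antipode h2) = (counit h)%:A;
  antipodeK : cancel antipode antipodeV;
  antipodeVK : cancel antipodeV antipode;
  antipode_star : forall h, antipode (star (antipode (star h))) = h
}.

#[short(type="hopfStarAlgType")]
HB.structure Definition HopfStarAlgebra (K : numClosedFieldType) :=
  {H of isHopfStarAlgebra K H & StarAlgebra K H}.

HB.instance Definition _ (K : numClosedFieldType) (H : hopfStarAlgType K) :=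
  GRing.isLinear.Build K H (H ⊗ H)%type *:%R coprod coprod_linear.
HB.instance Definition _ (K : numClosedFieldType) (H : hopfStarAlgType K) :=
  GRing.isLinear.Build K H K *%R counit counit_linear.
HB.instance Definition _ (K : numClosedFieldType) (H : hopfStarAlgType K) :=
  GRing.isLinear.Build K H H *:%R antipode antipode_linear.

HB.mixin Record HopfStar_isCompactQG (K : numClosedFieldType) H
    of HopfStarAlgebra K H := {
  haar : H -> K;
  haar_linear : scalar haar;
  haar_neq0 : exists h, haar h <> 0;
  haar_ge0 : positive_on setT haar;
  haar_faithful : faithful_on setT haar;
  haarr : forall h, \tsum_(h1, h2 <- coprod h) (haar h2 *: h1) = (haar h)%:A;
  haarl : forall h, \tsum_(h1, h2 <- coprod h) (haar h1 *: h2) = (haar h)%:A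
}.

#[short(type="compactQGType")]
HB.structure Definition CompactQG (K : numClosedFieldType) :=
  {H of HopfStar_isCompactQG K H & HopfStarAlgebra K H}.

(* theta takes values in the vector space underlying O^op ⊗ N; thetaM,        *)
(* theta1 and theta_star say that it is a unital *-homomorphism to O^op ⊗ N,   *)
(* where the involution of O^op maps h^op to (S^-2 (star h))^op.              *)
(* act m h is the right action of O on N that encodes the action of the dual   *)
(* quantum group.                                                             *)
HB.mixin Record isBraidedYD (K : numClosedFieldType) (O : compactQGType K) N
    of StarAlgebra K N := {
  theta : N -> (O ⊗ N)%type;
  act : N -> O -> N;
  yd_int : N -> K;

  theta_linear : linear theta;
  theta1 : theta 1 = 1 ⊗ 1;
  thetaM : forall m n, theta (m * n) =
    \tsum_(h, m0 <- theta m) \tsum_(g, n0 <- theta n) ((g * h) ⊗ (m0 * n0));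
  theta_star : forall m, theta (star m) =
    \tsum_(h, m0 <- theta m) (antipodeV (antipodeV (star h)) ⊗ star m0);
  theta_coact : forall m,
    \tsum_(h, m0 <- theta m) \tsum_(h1, h2 <- coprod h) (h1 ⊗ h2 ⊗ m0) =
    \tsum_(h, m0 <- theta m) \tsum_(g, m00 <- theta m0) (h ⊗ g ⊗ m00);
  theta_counit : forall m, \tsum_(h, m0 <- theta m) (counit h *: m0) = m;

  act_linearl : forall h, linear (act^~ h);
  act_linearr : forall m, linear (act m);
  act1 : forall m, act m 1 = m;
  actA : forall m h g, act m (h * g) = act (act m h) g;
  actM : forall m n h,
    act (m * n) h = \tsum_(h1, h2 <- coprod h) (act m h1 * act n h2);
  act_counit : forall h, act 1 h = (counit h)%:A;
  act_star : forall m h, star (act m h) = act (star m) (star (antipode h));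

  theta_act : forall m h, theta (act m h) =
    \tsum_(h12, h3 <- coprod h) \tsum_(h1, h2 <- coprod h12)
      \tsum_(g, m0 <- theta m) ((antipodeV h3 * g * h1) ⊗ act m0 h2);
  braided_comml : forall m n, m * n = \tsum_(h, m0 <- theta m) (act n h * m0);
  braided_commr : forall m n,
    m * n = \tsum_(g, n0 <- theta n) (n0 * act m (antipode g));

  yd_int_linear : scalar yd_int;
  yd_int_neq0 : exists m, yd_int m <> 0;
  yd_int_ge0 : positive_on setT yd_int;
  yd_int_faithful : faithful_on setT yd_int;
  yd_int_theta : forall m, \tsum_(h, m0 <- theta m) (yd_int m0 *: h) = (yd_int m)%:A;
  yd_int_act : forall m h, yd_int (act m h) = counit h * yd_int m
}.

#[short(type="braidedYDType")]
HB.structure Definition BraidedYD (K : numClosedFieldType) (O : compactQGType K) :=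
  {N of isBraidedYD K O N & StarAlgebra K N}.

HB.instance Definition _ (K : numClosedFieldType) (H : compactQGType K) :=
  GRing.isLinear.Build K H K *%R haar haar_linear.
HB.instance Definition _ (K : numClosedFieldType) (O : compactQGType K)
    (N : braidedYDType O) :=
  GRing.isLinear.Build K N (O ⊗ N)%type *:%R theta theta_linear.
HB.instance Definition _ (K : numClosedFieldType) (O : compactQGType K)
    (N : braidedYDType O) :=
  GRing.isLinear.Build K N K *%R yd_int yd_int_linear.

Section Canonical.
Variables (K : numClosedFieldType) (O : compactQGType K) (N : braidedYDType O).

Definition gamma (m : N) : N := \tsum_(h, m0 <- theta m) act m0 (antipodeV h).
Definition gamma_hat (m : N) : N :=
  \tsum_(h, m0 <- theta m) act m0 (antipode (antipode h)).
End Canonical.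

Section HopfTheory.
Variables (K : numClosedFieldType) (H : hopfStarAlgType K).
Implicit Types h g : H.

Lemma coprod_sumA (U : zmodType) (F : H -> H -> H -> U) h :
  (forall c, balanced (fun a b => F a b c)) -> (forall a, balanced (F a)) ->
  \tsum_(h1, h2 <- coprod h) \tsum_(h11, h12 <- coprod h1) F h11 h12 h2 =
  \tsum_(h1, h2 <- coprod h) \tsum_(h21, h22 <- coprod h2) F h1 h21 h22.
Proof.
move=> F1 F2; pose G (X : (H ⊗ H)%type) (c : H) := tlift (fun a b => F a b c) X.
have GB : balanced G.
  split=> [X Y c|X c c'|k X c]; rewrite /G ?tliftD ?tliftZ -?tlift_addf //;
    apply: eq_tlift => a b; have [_ FD FZ] := F2 a => //.
  by rewrite -FZ; have [_ _ ->] := F1 c.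
have := congr1 (tlift G) (coprodA h).
rewrite !raddf_tlift; try exact: tliftD.
under eq_tlift => h1 h2.
  rewrite raddf_tlift; last exact: tliftD.
  under eq_tlift => a b do rewrite tlift_tens // /G tlift_tens //.
  over.
move=> ->; apply: eq_tlift => h1 h2.
rewrite raddf_tlift; last exact: tliftD.
by apply: eq_tlift => a b; rewrite tlift_tens // /G tlift_tens.
Qed.

Lemma coprod_sumM (U : zmodType) (f : H -> H -> U) h g : balanced f ->
  \tsum_(a, b <- coprod (h * g)) f a b =
  \tsum_(h1, h2 <- coprod h) \tsum_(g1, g2 <- coprod g) f (h1 * g1) (h2 * g2).
Proof.
move=> fB; rewrite coprodM /= -[_ * _]/(tmul _ _) /tmul.
rewrite raddf_tlift; last exact: tliftD.
apply: eq_tlift => h1 h2; rewrite raddf_tlift; last exact: tliftD.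
by apply: eq_tlift => g1 g2; rewrite tlift_tens.
Qed.

Lemma coprod_sum_star (U : zmodType) (f : H -> H -> U) h : balanced f ->
  \tsum_(a, b <- coprod (star h)) f a b =
  \tsum_(h1, h2 <- coprod h) f (star h1) (star h2).
Proof.
move=> fB; rewrite coprod_star raddf_tlift; last exact: tliftD.
by apply: eq_tlift => h1 h2; rewrite tlift_tens.
Qed.

Lemma coprod_sum1 (U : zmodType) (f : H -> H -> U) : balanced f ->
  \tsum_(a, b <- coprod 1) f a b = f 1 1.
Proof. by move=> fB; rewrite coprod1 tlift_tens. Qed.

Lemma counit_star h : counit (star h) = (counit h)^*.
Proof.
pose e (g : H) := (counit (star g))^*.
have eD : {morph e : a b / a + b} by move=> a b; rewrite /e starD !raddfD.
have eZ c g : e (c *: g) = c * e g.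
  by rewrite /e starZ linearZ /= rmorphM /= conjCK.
have el g : \tsum_(g1, g2 <- coprod g) (e g1 *: g2) = g.
  rewrite -[RHS]starK -[in RHS](counitl (star g)).
  rewrite coprod_sum_star; last first.
    split=> *; rewrite ?linearD ?scalerDl ?scalerDr //.
    by rewrite linearZ /= scalerA mulrC -scalerA.
  rewrite raddf_tlift; last exact: starD.
  by apply: eq_tlift => a b; rewrite starZ starK.
have -> : counit (star h) = (e h)^* by rewrite /e conjCK.
congr (_^*); rewrite -[in LHS](counitr h) -[in RHS](el h).
rewrite !raddf_tlift //; last exact: raddfD.
by apply: eq_tlift => a b; rewrite eZ linearZ /= mulrC.
Qed.

Lemma antipodeV_star h : star (antipode (star h)) = antipodeV h.
Proof. by apply: (can_inj antipodeK); rewrite antipode_star antipodeVK. Qed.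

Lemma antipodeVD : {morph (@antipodeV K H) : a b / a + b}.
Proof. by move=> a b; rewrite -!antipodeV_star starD linearD starD. Qed.

Lemma antipodeVZ c (h : H) : antipodeV (c *: h) = c *: antipodeV h.
Proof. by rewrite -!antipodeV_star starZ linearZ /= starZ conjCK. Qed.

Lemma starS_balanced : balanced (fun h1 h2 : H => antipodeV h2 * h1).
Proof.
split=> *; rewrite ?antipodeVD ?mulrDl ?mulrDr //.
by rewrite antipodeVZ -scalerAl scalerAr.
Qed.

Lemma star1 (A : starAlgType K) : star 1 = 1 :> A.
Proof. by rewrite -[LHS]mul1r -[X in X * _]starK -starM mul1r starK. Qed.

Lemma antipodeVl h : \tsum_(h1, h2 <- coprod h) (antipodeV h2 * h1) = (counit h)%:A.
Proof.
rewrite -[in LHS](starK h) coprod_sum_star; last exact: starS_balanced.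
rewrite -[counit h]conjCK -counit_star -[X in _ *: X](star1 H) -starZ -antipoder.
rewrite raddf_tlift; last exact: starD.
by apply: eq_tlift => a b; rewrite starM -antipodeV_star starK.
Qed.

End HopfTheory.

(* The smash product O # N: the tensor product O ⊗ N with another product. *)
Definition smash (K : numClosedFieldType) (O : compactQGType K)
  (N : braidedYDType O) : Type := (O ⊗ N)%type.

Section Smash.
Variables (K : numClosedFieldType) (O : compactQGType K) (N : braidedYDType O).
Local Notation A := (smash N).
HB.instance Definition _ := GRing.Lmodule.copy A (O ⊗ N)%type.

Definition smash_tens (h : O) (m : N) : A := h ⊗ m.
Local Notation "h ## m" := (smash_tens h m) (at level 38).

Definition smash_mul (x y : A) : A :=
  \tsum_(h, m <- x) \tsum_(g, n <- y)
    \tsum_(g1, g2 <- coprod g) ((h * g1) ## (act m g2 * n)).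

Definition smash_star (x : A) : A :=
  \tsum_(h, m <- x) \tsum_(k1, k2 <- coprod (star h)) (k1 ## act (star m) k2).

Lemma actDl (m n : N) (h : O) : act (m + n) h = act m h + act n h.
Proof. by have := act_linearl h 1 m n; rewrite !scale1r. Qed.
Lemma act0l (h : O) : act (0 : N) h = 0.
Proof. by apply: (addrI (act 0 h)); rewrite -actDl !addr0. Qed.
Lemma actZl c (m : N) (h : O) : act (c *: m) h = c *: act m h.
Proof. by have := act_linearl h c m 0; rewrite !addr0 act0l addr0. Qed.
Lemma actDr (m : N) (h g : O) : act m (h + g) = act m h + act m g.
Proof. by have := act_linearr m 1 h g; rewrite !scale1r. Qed.
Lemma act0r (m : N) : act m (0 : O) = 0.
Proof. by apply: (addrI (act m 0)); rewrite -actDr !addr0. Qed.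
Lemma actZr c (m : N) (h : O) : act m (c *: h) = c *: act m h.
Proof. by have := act_linearr m c h 0; rewrite !addr0 act0r addr0. Qed.

Lemma smash_tens_balanced : balanced smash_tens.
Proof. exact: tens_balanced. Qed.

Let stE := (@tensDl K O N, @tensDr K O N, @tensZl K O N, @tensZr K O N).

Lemma smash_ind (P : A -> Prop) : P 0 -> (forall x y, P x -> P y -> P (x + y)) ->
  (forall h m, P (h ## m)) -> forall x, P x.
Proof. exact: tensor_ind. Qed.

Lemma smash_ext (U : zmodType) (f g : A -> U) :
  {morph f : x y / x + y} -> {morph g : x y / x + y} ->
  (forall h m, f (h ## m) = g (h ## m)) -> f =1 g.
Proof. exact: tens_ext. Qed.

Let bal_g (h : O) (m n : N) :
  balanced (fun g1 g2 : O => (h * g1) ## (act m g2 * n)).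
Proof.
split=> *; rewrite /smash_tens.
- by rewrite mulrDr stE.
- by rewrite actDr mulrDl stE.
- by rewrite actZr -scalerAr -scalerAl !stE.
Qed.

Let bal_gn (h : O) (m : N) :
  balanced (fun (g : O) (n : N) =>
    \tsum_(g1, g2 <- coprod g) ((h * g1) ## (act m g2 * n))).
Proof.
split=> [g g' n|g n n'|c g n].
- by rewrite linearD tliftD.
- by rewrite -tlift_addf; apply: eq_tlift => *; rewrite /smash_tens mulrDr stE.
- rewrite linearZ tliftZ //=; apply: eq_tlift => *.
  by rewrite /smash_tens -!scalerAr !stE.
Qed.

Let bal_hm (y : A) :
  balanced (fun (h : O) (m : N) => \tsum_(g, n <- y)
    \tsum_(g1, g2 <- coprod g) ((h * g1) ## (act m g2 * n))).
Proof.
split=> [h h' m|h m m'|c h m]; rewrite -?tlift_addf; apply: eq_tlift => g n;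
  rewrite -?tlift_addf; apply: eq_tlift => g1 g2; rewrite /smash_tens.
- by rewrite mulrDl stE.
- by rewrite actDl mulrDl stE.
- by rewrite actZl -!scalerAl !stE.
Qed.

Lemma smash_mulE (h g : O) (m n : N) :
  smash_mul (h ## m) (g ## n) =
  \tsum_(g1, g2 <- coprod g) ((h * g1) ## (act m g2 * n)).
Proof. by rewrite /smash_mul !tlift_tens. Qed.

Fact smash_mulDl : left_distributive smash_mul +%R.
Proof. by move=> x y z; apply: tliftD. Qed.

Fact smash_mulDr : right_distributive smash_mul +%R.
Proof.
move=> x y z; rewrite /smash_mul -tlift_addf; apply: eq_tlift => h m.
by rewrite tliftD.
Qed.

Fact smash_mulA : associative smash_mul.
Proof.
move=> x y z; move: x.
apply: smash_ext => [u v|u v|h m]; rewrite ?smash_mulDl //.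
move: y; apply: smash_ext => [u v|u v|g n]; rewrite ?(smash_mulDl, smash_mulDr) //.
move: z; apply: smash_ext => [u v|u v|k p]; rewrite ?(smash_mulDl, smash_mulDr) //.
rewrite !smash_mulE.
rewrite raddf_tlift; last by move=> u v; exact: smash_mulDr.
rewrite (raddf_tlift (g := smash_mul^~ _)); last first.
  by move=> u v; exact: smash_mulDl.
transitivity (\tsum_(g1, g2 <- coprod g) \tsum_(k1, k2 <- coprod k)
   \tsum_(k11, k12 <- coprod k1)
    ((h * g1 * k11) ## (act m (g2 * k12) * (act n k2 * p)))).
  transitivity (\tsum_(k1, k2 <- coprod k) \tsum_(g1, g2 <- coprod g)
   \tsum_(k11, k12 <- coprod k1)
    ((h * g1 * k11) ## (act m (g2 * k12) * (act n k2 * p)))).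
    apply: eq_tlift => k1 k2; rewrite smash_mulE coprod_sumM //.
    by apply: eq_tlift => g1 g2; apply: eq_tlift => k11 k12; rewrite !mulrA.
  by rewrite /tlift /formal_sum exchange_big.
apply: eq_tlift => g1 g2; rewrite smash_mulE.
rewrite (coprod_sumA (F := fun k1 k2 k3 =>
  (h * g1 * k1) ## (act m (g2 * k2) * (act n k3 * p)))); first last.
- move=> a; split=> *; rewrite /smash_tens.
  + by rewrite mulrDr actDr mulrDl !stE.
  + by rewrite actDr mulrDl mulrDr !stE.
  + by rewrite -scalerAr !actZr -!scalerAl -!scalerAr !stE.
- move=> c; split=> *; rewrite /smash_tens.
  + by rewrite mulrDr !stE.
  + by rewrite mulrDr actDr mulrDl !stE.
  + by rewrite -!scalerAr actZr -!scalerAl !stE.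
apply: eq_tlift => k1 k2; rewrite actM.
rewrite -[RHS]/((fun X => (h * g1 * k1) ## (X * p)) _) raddf_tlift; last first.
  by move=> u v; rewrite /smash_tens mulrDl stE.
by apply: eq_tlift => k21 k22; rewrite actA !mulrA.
Qed.

Fact smash_mul1l : left_id (1 ## 1) smash_mul.
Proof.
apply: smash_ext => [u v|u v|g n]; rewrite ?smash_mulDr // smash_mulE.
rewrite -[in RHS](counitr g) -[RHS]/((fun X => X ## n) _) raddf_tlift; last first.
  by move=> u v; rewrite /smash_tens stE.
apply: eq_tlift => g1 g2.
by rewrite act_counit mul1r -scalerAl mul1r /smash_tens !stE.
Qed.

Fact smash_mul1r : right_id (1 ## 1) smash_mul.
Proof.
apply: smash_ext => [u v|u v|g n]; rewrite ?smash_mulDl // smash_mulE.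
by rewrite coprod1 tlift_tens // !mulr1 act1.
Qed.

HB.instance Definition _ := GRing.Zmodule_isPzRing.Build A
  smash_mulA smash_mul1l smash_mul1r smash_mulDl smash_mulDr.

Fact smash_neq0 : 1 != 0 :> A.
Proof.
apply/eqP => e; have [m mN0] := @yd_int_neq0 K O N; apply: mN0.
pose f (h : O) (n : N) : K := counit h * yd_int n.
have fB : balanced f.
  split=> *; rewrite /f ?linearD ?mulrDl ?mulrDr //.
  by rewrite !linearZ /= mulrCA mulrA.
have : 1 ## m = 0 :> A by rewrite -[LHS]mul1r e mul0r.
move/(congr1 (tlift f)).
by rewrite tlift_tens // tlift0 // /f counit1 mul1r.
Qed.
HB.instance Definition _ := GRing.PzSemiRing_isNonZero.Build A smash_neq0.

Lemma smashM (h g : O) (m n : N) :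
  (h ## m) * (g ## n) = \tsum_(g1, g2 <- coprod g) ((h * g1) ## (act m g2 * n)).
Proof. exact: smash_mulE. Qed.

Lemma smashZl c (h : O) (m : N) : (c *: h) ## m = c *: (h ## m).
Proof. exact: tensZl. Qed.
Lemma smashZr c (h : O) (m : N) : h ## (c *: m) = c *: (h ## m).
Proof. exact: tensZr. Qed.
Lemma smashDl (h h' : O) (m : N) : (h + h') ## m = h ## m + h' ## m.
Proof. exact: tensDl. Qed.
Lemma smashDr (h : O) (m m' : N) : h ## (m + m') = h ## m + h ## m'.
Proof. exact: tensDr. Qed.

Fact smash_scaleAl c (x y : A) : c *: (x * y) = (c *: x) * y.
Proof.
move: x; apply: smash_ext => [u v|u v|h m]; rewrite ?(scalerDr, mulrDl) //.
move: y; apply: smash_ext => [u v|u v|g n]; rewrite ?(scalerDr, mulrDr) //.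
rewrite -smashZl !smashM raddf_tlift; last exact: scalerDr.
by apply: eq_tlift => g1 g2; rewrite -smashZl scalerAl.
Qed.
HB.instance Definition _ := GRing.Lmodule_isLalgebra.Build K A smash_scaleAl.

Fact smash_scaleAr c (x y : A) : c *: (x * y) = x * (c *: y).
Proof.
move: x; apply: smash_ext => [u v|u v|h m]; rewrite ?(scalerDr, mulrDl) //.
move: y; apply: smash_ext => [u v|u v|g n]; rewrite ?(scalerDr, mulrDr) //.
rewrite -smashZr !smashM raddf_tlift; last exact: scalerDr.
by apply: eq_tlift => g1 g2; rewrite -smashZr scalerAr.
Qed.
HB.instance Definition _ := GRing.Lalgebra_isAlgebra.Build K A smash_scaleAr.

Definition smash_alpha (m : N) : A := 1 ## m.
Definition smash_iota (h : O) : A := h ## 1.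
Local Notation alpha := smash_alpha.
Local Notation iota := smash_iota.

Lemma iota_alpha h m : iota h * alpha m = h ## m.
Proof.
rewrite smashM coprod_sum1; last exact: bal_g.
by rewrite mulr1 act1 mul1r.
Qed.

Lemma alpha_iota m h :
  alpha m * iota h = \tsum_(h1, h2 <- coprod h) (h1 ## act m h2).
Proof. by rewrite smashM; apply: eq_tlift => *; rewrite mul1r mulr1. Qed.

Lemma alphaM m n : alpha (m * n) = alpha m * alpha n.
Proof.
rewrite smashM coprod_sum1; last exact: bal_g.
by rewrite mul1r act1.
Qed.

Lemma iotaM h g : iota (h * g) = iota h * iota g.
Proof.
rewrite smashM -[in LHS](counitr g) (raddf_tlift (g := fun X => iota (h * X))).
  apply: eq_tlift => g1 g2; rewrite act_counit mulr1 -scalerAr.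
  by rewrite /iota smashZl smashZr.
by move=> u v; rewrite /iota mulrDr smashDl.
Qed.

Lemma alphaD m n : alpha (m + n) = alpha m + alpha n.
Proof. exact: smashDr. Qed.
Lemma alphaZ c m : alpha (c *: m) = c *: alpha m.
Proof. exact: smashZr. Qed.
Lemma iotaD h g : iota (h + g) = iota h + iota g.
Proof. exact: smashDl. Qed.
Lemma iotaZ c h : iota (c *: h) = c *: iota h.
Proof. exact: smashZl. Qed.

Let bal_star (m : N) : balanced (fun (k1 k2 : O) => k1 ## act m k2).
Proof.
split=> *; rewrite ?actDr ?smashDl ?smashDr //.
by rewrite actZr smashZl smashZr.
Qed.

Let bal_hm_star : balanced (fun (h : O) (m : N) =>
  \tsum_(k1, k2 <- coprod (star h)) (k1 ## act (star m) k2)).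
Proof.
split=> [h h' m|h m m'|c h m].
- by rewrite starD linearD tliftD.
- by rewrite -tlift_addf; apply: eq_tlift => *; rewrite starD actDl smashDr.
- rewrite starZ linearZ tliftZ //=; apply: eq_tlift => *.
  by rewrite starZ actZl smashZl smashZr.
Qed.

Lemma smash_starE h m : smash_star (h ## m) = alpha (star m) * iota (star h).
Proof. by rewrite alpha_iota /smash_star tlift_tens. Qed.

Fact smash_starD : {morph smash_star : x y / x + y}.
Proof. by move=> x y; apply: tliftD. Qed.

Fact smash_starZ c x : smash_star (c *: x) = c^* *: smash_star x.
Proof.
move: x; apply: smash_ext => [u v|u v|h m];
  rewrite ?scalerDr ?smash_starD ?scalerDr //.
by rewrite -smashZr !smash_starE starZ alphaZ -scalerAl.
Qed.

Lemma alpha_iota_star (m : N) (g : O) :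
  iota g * alpha m =
  \tsum_(g1, g2 <- coprod g) (alpha (act m (antipodeV g2)) * iota g1).
Proof.
transitivity (\tsum_(g1, g2 <- coprod g) \tsum_(g21, g22 <- coprod g2)
   (g1 ## act m (antipodeV g22 * g21))).
  rewrite iota_alpha -[in LHS](counitr g).
  rewrite (raddf_tlift (g := fun X => X ## m)); last first.
    by move=> u v; rewrite smashDl.
  apply: eq_tlift => g1 g2.
  rewrite smashZl -smashZr -{1}[m]act1 -actZr -antipodeVl.
  rewrite (raddf_tlift (g := fun X => g1 ## act m X)) //.
  by move=> u v; rewrite actDr smashDr.
rewrite -(coprod_sumA (F := fun g1 g2 g3 => g1 ## act m (antipodeV g3 * g2))).
- by apply: eq_tlift => g1 g2; rewrite alpha_iota; apply: eq_tlift => *; rewrite actA.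
- move=> c; split=> *; rewrite ?mulrDr ?actDr ?smashDl ?smashDr //.
  by rewrite -scalerAr actZr smashZl smashZr.
- move=> a; split=> *; rewrite ?antipodeVD ?mulrDl ?mulrDr ?actDr ?smashDr //.
  by rewrite antipodeVZ -scalerAl -scalerAr.
Qed.

Fact smash_starM x y : smash_star (x * y) = smash_star y * smash_star x.
Proof.
move: x; apply: smash_ext => [u v|u v|h m];
  rewrite ?(mulrDl, smash_starD, mulrDr) //.
move: y; apply: smash_ext => [u v|u v|g n];
  rewrite ?(mulrDl, smash_starD, mulrDr) //.
rewrite !smash_starE smashM raddf_tlift; last exact: smash_starD.
rewrite mulrA -[alpha _ * iota _ * _]mulrA alpha_iota_star coprod_sum_star; last first.
  split=> *; rewrite ?antipodeVD ?actDr ?alphaD ?iotaD ?mulrDl ?mulrDr //.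
  by rewrite antipodeVZ actZr alphaZ iotaZ -scalerAl -scalerAr.
rewrite -[RHS]/((fun X => alpha (star n) * X * iota (star h)) _) raddf_tlift; last first.
  by move=> u v; rewrite mulrDr mulrDl.
apply: eq_tlift => g1 g2; rewrite smash_starE !starM act_star alphaM iotaM !mulrA.
by rewrite -antipodeV_star starK.
Qed.

Fact smash_starK : involutive smash_star.
Proof.
apply: smash_ext => [u v|u v|h m]; rewrite ?smash_starD //.
rewrite smash_starE smash_starM !smash_starE !starK !star1.
have alpha1 : alpha 1 = 1 by [].
have iota1 : iota 1 = 1 by [].
by rewrite alpha1 iota1 mul1r mulr1 iota_alpha.
Qed.

HB.instance Definition _ := isStarAlgebra.Build K A
  smash_starD smash_starZ smash_starM smash_starK.

End Smash.

Notation "h '\#' m" := (smash_tens h m) (at level 38, no associativity) : ring_scope.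

Section SmashMaps.
Variables (K : numClosedFieldType) (O : compactQGType K) (N : braidedYDType O).

Definition smash_beta (m : N) : smash N := \tsum_(h, m0 <- theta m) (h \# m0).

End SmashMaps.

Section Algebroid.
Variables (K : numClosedFieldType) (A : starAlgType K).
Local Notation AA := (A ⊗ A)%type.

Definition linear_on (V : lmodType K) (B : set A) (f : A -> V) :=
  forall c x y, B x -> B y -> f (c *: x + y) = c *: f x + f y.

Record star_subalgebra (B : set A) : Prop := {
  subalg1 : B 1;
  subalg_linear : forall c x y, B x -> B y -> B (c *: x + y);
  subalgM : forall x y, B x -> B y -> B (x * y);
  subalg_star : forall x, B x -> B (star x)
}.

Record anti_isomorphism (B C : set A) (t : A -> A) : Prop := {
  anti_linear : linear_on B t;
  anti_bij : set_bij B C t;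
  antiM : forall x y, B x -> B y -> t (x * y) = t y * t x
}.

Record positive_faithful_functional (B : set A) (f : A -> K) : Prop := {
  functional_linear : linear_on B (f : A -> K^o);
  functional_ge0 : positive_on B f;
  functional_faithful : faithful_on B f
}.

(* A ⊗_B A and A ⊗^C A are the quotients of A ⊗ A by these relations. *)
Definition relB (B : set A) (tB : A -> A) : set AA :=
  [set X | exists a b x, B x /\ X = (a * x) ⊗ b - a ⊗ (b * tB x)].
Definition relC (C : set A) (tC : A -> A) : set AA :=
  [set X | exists a b y, C y /\ X = (tC y * a) ⊗ b - a ⊗ (y * b)].

(* The relations G between the first two legs and G' between the last two. *)
Definition rel3 (G G' : set AA) : set (A ⊗ A ⊗ A)%type :=
  [set X | (exists Z c, G Z /\ X = Z ⊗ c) \/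
           (exists a Z, G' Z /\ X = \tsum_(b, c <- Z) (a ⊗ b ⊗ c))].

(* The classes of u ⊗ c and a ⊗ u in the threefold balanced tensor product. *)
Definition tensl (G G' : set AA) (u : quot G) (c : A) : quot (rel3 G G') :=
  qlift (fun Z => qpi (Z ⊗ c)) u.
Definition tensr (G G' : set AA) (a : A) (u : quot G') : quot (rel3 G G') :=
  qlift (fun Z => qpi (\tsum_(b, c <- Z) (a ⊗ b ⊗ c))) u.

Lemma tenslE (G G' : set AA) (Z : AA) c :
  tensl G' (qpi Z : quot G) c = qpi (Z ⊗ c).
Proof.
apply: qlift_qpi => [k X Y|X GX]; first by rewrite tensDl tensZl linearP.
apply/qpiP; rewrite subr0; apply: mem_lspan; left; by exists X, c.
Qed.

Lemma tensr_balanced (a : A) : balanced (fun b c : A => a ⊗ b ⊗ c).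
Proof. by split=> *; rewrite ?(tensDl, tensDr, tensZl, tensZr). Qed.

Lemma tensrE (G G' : set AA) a (Z : AA) :
  tensr G a (qpi Z : quot G') = qpi (\tsum_(b, c <- Z) (a ⊗ b ⊗ c)).
Proof.
have hB := tensr_balanced a.
apply: qlift_qpi => [k X Y|X GX].
  rewrite tliftD // tliftZ // -linearP /=; congr (qpi (_ + _)).
  rewrite raddf_tlift; last exact: scalerDr.
  by apply: eq_tlift => b c; rewrite tensZr tensZl.
by apply/qpiP; rewrite subr0; apply: mem_lspan; right; exists a, X.
Qed.

(* s = [:: (a1, b1); ...; (an, bn)] with a1 ⊗ b1 + ... + an ⊗ bn in the class u *)
Definition represents (G : set AA) (s : seq (A * A)) (u : quot G) : Prop :=
  u = qpi (\sum_(p <- s) p.1 ⊗ p.2).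

(* (D ⊗ id) D' = (id ⊗ D') D *)
Definition coassociative (G G' : set AA) (D : A -> quot G) (D' : A -> quot G') :=
  forall a s s', represents s (D a) -> represents s' (D' a) ->
    \sum_(p <- s') tensl G' (D p.1) p.2 = \sum_(p <- s) tensr G p.1 (D' p.2).

(* Maps whose domain is B or C are given as functions on A; only their values  *)
(* on B, respectively C, matter.                                              *)
Record algebroid_data := AlgebroidData {
  algB : set A;
  algC : set A;
  tB : A -> A;
  tC : A -> A;
  DeltaB : A -> quot (relB algB tB);
  DeltaC : A -> quot (relC algC tC);
  muB : A -> K;
  muC : A -> K;
  psiB : A -> A;
  phiC : A -> A
}.

Variable D : algebroid_data.
Local Notation B := (algB D).
Local Notation C := (algC D).
Local Notation qB := (@qpi _ _ (relB B (tB D))).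
Local Notation qC := (@qpi _ _ (relC C (tC D))).

(* The products in the Takeuchi products are the componentwise ones: they are *)
(* computed on arbitrary representatives.                                     *)
Record is_bialgebroid : Prop := {
  algB_star_subalgebra : star_subalgebra B;
  algC_star_subalgebra : star_subalgebra C;
  algBC_comm : forall x y, B x -> C y -> x * y = y * x;

  tB_anti : anti_isomorphism B C (tB D);
  tC_anti : anti_isomorphism C B (tC D);
  tBC_star : forall y, C y -> tB D (star (tC D (star y))) = y;

  DeltaB_linear : linear (DeltaB D);
  DeltaC_linear : linear (DeltaC D);
  DeltaB_takeuchi : forall a s x, represents s (DeltaB D a) -> B x ->
    qB (\sum_(p <- s) (x * p.1) ⊗ p.2) = qB (\sum_(p <- s) p.1 ⊗ (tB D x * p.2));
  DeltaC_takeuchi : forall a s y, represents s (DeltaC D a) -> C y ->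
    qC (\sum_(p <- s) (p.1 * tC D y) ⊗ p.2) = qC (\sum_(p <- s) p.1 ⊗ (p.2 * y));
  DeltaB1 : DeltaB D 1 = qB (1 ⊗ 1);
  DeltaC1 : DeltaC D 1 = qC (1 ⊗ 1);
  DeltaBM : forall a b s s', represents s (DeltaB D a) -> represents s' (DeltaB D b) ->
    DeltaB D (a * b) =
    qB (\sum_(p <- s) \sum_(p' <- s') (p.1 * p'.1) ⊗ (p.2 * p'.2));
  DeltaCM : forall a b s s', represents s (DeltaC D a) -> represents s' (DeltaC D b) ->
    DeltaC D (a * b) =
    qC (\sum_(p <- s) \sum_(p' <- s') (p.1 * p'.1) ⊗ (p.2 * p'.2));

  DeltaB_bimod : forall x x' y y' a s, B x -> B x' -> C y -> C y' ->
    represents s (DeltaB D a) ->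
    DeltaB D (x * y * a * x' * y') =
    qB (\sum_(p <- s) (y * p.1 * y') ⊗ (x * p.2 * x'));
  DeltaC_bimod : forall x x' y y' a s, B x -> B x' -> C y -> C y' ->
    represents s (DeltaC D a) ->
    DeltaC D (x * y * a * x' * y') =
    qC (\sum_(p <- s) (y * p.1 * y') ⊗ (x * p.2 * x'));

  DeltaBB_coassoc : coassociative (DeltaB D) (DeltaB D);
  DeltaCC_coassoc : coassociative (DeltaC D) (DeltaC D);
  DeltaCB_coassoc : coassociative (DeltaC D) (DeltaB D);
  DeltaBC_coassoc : coassociative (DeltaB D) (DeltaC D);

  DeltaC_star : forall a s, represents s (DeltaB D a) ->
    DeltaC D (star a) = qC (\sum_(p <- s) star p.1 ⊗ star p.2)
}.

Record is_antipode_counits (S epsB epsC : A -> A) : Prop := {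
  S_anti : anti_isomorphism setT setT S;
  epsB_linear : linear epsB;
  epsC_linear : linear epsC;
  epsB_in : forall a, B (epsB a);
  epsC_in : forall a, C (epsC a);
  epsB_tB : forall a x, B x -> epsB (a * tB D x) = x * epsB a;
  epsB_r : forall a x, B x -> epsB (a * x) = epsB a * x;
  epsC_l : forall a y, C y -> epsC (y * a) = y * epsC a;
  epsC_tC : forall a y, C y -> epsC (tC D y * a) = epsC a * y;

  S_bimod : forall x x' y y' a, B x -> B x' -> C y -> C y' ->
    S (tB D x * tC D y * a * tB D x' * tC D y') = x' * y' * S a * x * y;
  S_star : forall a, S (star (S (star a))) = a;

  epsB_counitl : forall a s, represents s (DeltaB D a) ->
    \sum_(p <- s) p.2 * tB D (epsB p.1) = a;
  epsB_counitr : forall a s, represents s (DeltaB D a) ->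
    \sum_(p <- s) p.1 * epsB p.2 = a;
  epsC_counitl : forall a s, represents s (DeltaC D a) ->
    \sum_(p <- s) epsC p.1 * p.2 = a;
  epsC_counitr : forall a s, represents s (DeltaC D a) ->
    \sum_(p <- s) tC D (epsC p.2) * p.1 = a;

  S_antipodel : forall a s, represents s (DeltaC D a) ->
    \sum_(p <- s) S p.1 * p.2 = epsB a;
  S_antipoder : forall a s, represents s (DeltaB D a) ->
    \sum_(p <- s) p.1 * S p.2 = epsC a
}.

Record is_measured (epsB epsC : A -> A) : Prop := {
  psiB_linear : linear (psiB D);
  phiC_linear : linear (phiC D);
  psiB_in : forall a, B (psiB D a);
  phiC_in : forall a, C (phiC D a);
  psiB_bimod : forall x x' a, B x -> B x' -> psiB D (x * a * x') = x * psiB D a * x';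
  phiC_bimod : forall y y' a, C y -> C y' -> phiC D (y * a * y') = y * phiC D a * y';

  muB_functional : positive_faithful_functional B (muB D);
  muC_functional : positive_faithful_functional C (muC D);
  muB_neq0 : exists2 x, B x & muB D x <> 0;
  muC_neq0 : exists2 y, C y & muC D y <> 0;

  psiB_invariant : forall a s, represents s (DeltaB D a) ->
    \sum_(p <- s) p.2 * tB D (psiB D p.1) = psiB D a;
  phiC_invariant : forall a s, represents s (DeltaC D a) ->
    \sum_(p <- s) tC D (phiC D p.2) * p.1 = phiC D a;

  muB_tC : forall y, C y -> muB D (tC D y) = muC D y;
  muC_tB : forall x, B x -> muC D (tB D x) = muB D x;
  mu_eps : forall a, muB D (epsB a) = muC D (epsC a);

  psi_functional : positive_faithful_functional setT (muB D \o psiB D);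
  phi_functional : positive_faithful_functional setT (muC D \o phiC D)
}.

(* D is a unital measured multiplier Hopf *-algebroid with antipode S, right   *)
(* counit epsB and left counit epsC.                                          *)
Definition measured_hopf_star_algebroid_with (S epsB epsC : A -> A) : Prop :=
  [/\ is_bialgebroid, is_antipode_counits S epsB epsC & is_measured epsB epsC].

Definition measured_hopf_star_algebroid : Prop :=
  exists S epsB epsC, measured_hopf_star_algebroid_with S epsB epsC.

End Algebroid.

Section SmashAlgebroid.
Variables (K : numClosedFieldType) (O : compactQGType K) (N : braidedYDType O).
Local Notation A := (smash N).
Local Notation alpha := (@smash_alpha K O N).
Local Notation beta := (@smash_beta K O N).

(* Every map below is determined on its domain by its values here, as the      *)
(* alpha m * (h \# 1), and likewise the (h \# 1) * beta m, span A.             *)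
Record smash_algebroid_spec (D : algebroid_data A) (S epsB epsC : A -> A) : Prop := {
  smash_algB : algB D = range alpha;
  smash_algC : algC D = range beta;
  smash_tB : forall m, tB D (alpha m) = beta m;
  smash_tC : forall m, tC D (beta m) = alpha (gamma m);
  smash_DeltaB_linear : linear (DeltaB D);
  smash_DeltaB : forall h m, DeltaB D (h \# m) =
    qpi (\tsum_(h1, h2 <- coprod h) ((h1 \# (1 : N)) ⊗ (h2 \# m)));
  smash_DeltaC_linear : linear (DeltaC D);
  smash_DeltaC : forall h m, DeltaC D (h \# m) =
    qpi (\tsum_(h1, h2 <- coprod h) ((h1 \# (1 : N)) ⊗ (h2 \# m)));
  smash_S_linear : linear S;
  smash_S : forall h m, S (h \# m) = beta (gamma_hat m) * (antipode h \# 1);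
  smash_epsB_linear : linear epsB;
  smash_epsB : forall h m, epsB (alpha m * (h \# 1)) = alpha (act m h);
  smash_epsC_linear : linear epsC;
  smash_epsC : forall h m, epsC ((h \# 1) * beta m) = beta (act m (antipode h));
  smash_muB : forall m, muB D (alpha m) = yd_int m;
  smash_muC : forall m, muC D (beta m) = yd_int m;
  smash_psiB_linear : linear (psiB D);
  smash_psiB : forall h m, psiB D (alpha m * (h \# 1)) = haar h *: alpha m;
  smash_phiC_linear : linear (phiC D);
  smash_phiC : forall h m, phiC D ((h \# 1) * beta m) = haar h *: beta m
}.

End SmashAlgebroid.

(* Main.v *)
Require Import Defs.
From mathcomp Require Import all_boot all_order all_algebra.
From mathcomp Require Import boolp classical_sets reals complex.
From mathcomp Require Import functions ring.

(* With iota h = h # 1, everything follows from the commutation rules between iota,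
   alpha and beta in A: alpha m iota h = iota h1 alpha (m <| h2), and its counterpart
   beta (m <| h) = iota (S^-1 h2) beta m iota h1; beta is an anti-homomorphism that
   commutes with alpha.  Injectivity of beta and the identity
   star (beta m) = beta (star (gamma m)) then show that gamma is multiplicative, with
   inverse gamma_hat m = star (gamma (star m)).  A map on A (x) A that respects the
   balancing relations may be evaluated on the representative
   iota h1 (x) iota h2 alpha m of Delta (h # m), so each axiom becomes a short Sweedler
   computation; the axioms on the left counit are transported from those on the right
   one by the antipode, as epsC S = S epsB.
   As mu (m n) = mu (n gamma m), gamma is the modular automorphism of mu; hence mu_C is
   positive and mu is faithful from either side.  Writing a = sum_i alpha m_i iota h_i,
   psi (a star a) = sum_ij haar (h_i star h_j) mu (m_i star m_j) is the sum of the
   entries of a Schur product of positive matrices.  Faithfulness of psi also needs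
   haar to be faithful from one side.  The h with haar (h g) = 0 for all g form a right
   ideal and left coideal I.  If eps h <> 0 for some h in I, then I contains
   h2 S^-1(h1) = eps h, so haar = 0; thus eps vanishes on I, and h = eps(h2) h1 = 0 for
   every h in I.  *)

Set Implicit Arguments.
Unset Strict Implicit.
Unset Printing Implicit Defensive.

Import Order.TTheory GRing.Theory Num.Theory.
Local Open Scope ring_scope.
Local Open Scope classical_set_scope.

(** * Linear maps and tensor sums *)

Section Linear.
Variable K : fieldType.
Implicit Types U V W M : lmodType K.

(* Convertible to MathComp's [linear], but with a rigid head for lin_tac. *)
Definition lin V M (f : V -> M) : Prop :=
  forall c x y, f (c *: x + y) = c *: f x + f y.

Definition bilin V W M (f : V -> W -> M) : Prop :=
  (forall w, lin (fun v => f v w)) /\ (forall v, lin (f v)).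

Definition trilin U V W M (f : U -> V -> W -> M) : Prop :=
  [/\ forall v w, lin (fun u => f u v w), forall u w, lin (fun v => f u v w) &
      forall u v, lin (f u v)].

Lemma linD V M (f : V -> M) : lin f -> {morph f : x y / x + y}.
Proof. by move=> fL x y; have := fL 1 x y; rewrite !scale1r. Qed.

Lemma lin0 V M (f : V -> M) : lin f -> f 0 = 0.
Proof. by move=> fL; have := fL (-1) 0 0; rewrite scaler0 addr0 scaleN1r addNr. Qed.

Lemma linZ V M (f : V -> M) c x : lin f -> f (c *: x) = c *: f x.
Proof. by move=> fL; have := fL c x 0; rewrite (lin0 fL) !addr0. Qed.

Lemma lin_sum V M (f : V -> M) (I : Type) (r : seq I) (F : I -> V) :
  lin f -> f (\sum_(i <- r) F i) = \sum_(i <- r) f (F i).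
Proof. by move=> fL; rewrite (big_morph f (linD fL) (lin0 fL)). Qed.

Lemma lin_id V : lin (fun x : V => x).
Proof. by []. Qed.

Lemma lin_comp V M M' (g : M -> M') (f : V -> M) :
  lin g -> lin f -> lin (fun x => g (f x)).
Proof. by move=> gL fL c x y; rewrite fL gL. Qed.

Lemma bilin_balanced V W M (f : V -> W -> M) : bilin f -> balanced f.
Proof.
move=> [fL fR]; split=> [v v' w|v w w'|c v w].
- by have /linD := fL w; apply.
- exact: linD.
- by rewrite (linZ _ _ (fR v)) (linZ (f := fun v => f v w)).
Qed.

Lemma lin_tlift V W M M' (F : M -> V -> W -> M') (t : (V ⊗ W)%type) :
  (forall v w, lin (fun x => F x v w)) -> lin (fun x => tlift (F x) t).
Proof.
move=> FL c x y; rewrite raddf_tlift; last exact: scalerDr.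
by rewrite -tlift_addf; apply: eq_tlift => v w; apply: FL.
Qed.

Lemma tlift_lin V W M (f : V -> W -> M) : bilin f -> lin (tlift f).
Proof.
move=> fB c x y; have fb := bilin_balanced fB.
rewrite tliftD // tliftZ // (raddf_tlift (g := *:%R c)); last exact: scalerDr.
by congr (_ + _); apply: eq_tlift => v w; apply: (linZ (f := fun v => f v w)); case: fB.
Qed.

Lemma lin_tsum V W M M' (t : M -> (V ⊗ W)%type) (f : V -> W -> M') :
  lin t -> bilin f -> lin (fun x => tlift f (t x)).
Proof. by move=> tL fB; apply: lin_comp tL; apply: tlift_lin. Qed.

Lemma lin_scalel M M' (f : M -> K) (x : M') :
  lin (f : M -> K^o) -> lin (fun y => f y *: x).
Proof. by move=> fL c y z; rewrite fL scalerDl -scalerA. Qed.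

Lemma lin_scaler c M : lin (fun x : M => c *: x).
Proof. by move=> d x y; rewrite scalerDr !scalerA mulrC. Qed.

Lemma lin_mull (A : algType K) (a : A) : lin (fun x => x * a).
Proof. by move=> c x y; rewrite mulrDl scalerAl. Qed.

Lemma lin_mulr (A : algType K) (a : A) : lin (fun x => a * x).
Proof. by move=> c x y; rewrite mulrDr scalerAr. Qed.

Lemma lin_tensl V W (w : W) : lin (fun v : V => v ⊗ w).
Proof. by move=> c x y; rewrite tensDl tensZl. Qed.

Lemma lin_tensr V W (v : V) : lin (fun w : W => v ⊗ w).
Proof. by move=> c x y; rewrite tensDr tensZr. Qed.

Lemma lin_tmull (A B : algType K) (z : (A ⊗ B)%type) : lin (fun x : (A ⊗ B)%type => x * z).
Proof.
apply: tlift_lin; split=> *; apply: lin_tlift => *.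
  exact: lin_comp (lin_tensl _) (lin_mull _).
exact: lin_comp (lin_tensr _) (lin_mull _).
Qed.

Lemma lin_tmulr (A B : algType K) (z : (A ⊗ B)%type) : lin (fun x : (A ⊗ B)%type => z * x).
Proof.
apply: lin_tlift => a b; apply: tlift_lin; split=> *.
  exact: lin_comp (lin_tensl _) (lin_mulr _).
exact: lin_comp (lin_tensr _) (lin_mulr _).
Qed.

Lemma lin_qpi V (G : set V) : lin (@qpi K V G).
Proof. exact: qpi_is_linear. Qed.

End Linear.

Create HintDb lin_db.
#[global] Hint Extern 0 (lin _) => first
  [ eassumption | eapply lin_scaler | eapply lin_mull | eapply lin_mulr
  | eapply lin_tensl | eapply lin_tensr | eapply lin_tmull | eapply lin_tmulr
  | eapply lin_qpi ] : lin_db.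

Ltac lin_base := solve [auto 1 with lin_db nocore].
(** A sum over a tensor is linear in [x] when [x] occurs either in the summand or in the tensor and
    the other is fixed; other terms are peeled from outside, one known linear map at a time. *)
Ltac lin_tac := cbv beta;
  match goal with
  | |- lin (fun x => x) => exact: lin_id
  | |- lin (fun x => tlift (fun v w => @?F x v w) ?t) =>
      refine (lin_tlift (F := F) _ _); intros; lin_tac
  | |- lin (fun x => tlift (fun v w => @?F v w) (@?t x)) =>
      refine (lin_tsum (f := F) (t := t) _ _);
      [lin_tac | split; intros; lin_tac]
  | |- lin (fun x => @?f x *: ?m) =>
      refine (lin_scalel m (f := f) _); lin_tac
  | |- @lin _ ?V ?M (fun x => ?g (@?f x) ?h) =>
      refine (lin_comp (V := V) (M' := M) (g := fun y => g y h) (f := f) _ _);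
      [lin_base | lin_tac]
  | |- @lin _ ?V ?M (fun x => ?g (@?f x)) =>
      refine (lin_comp (V := V) (M' := M) (g := g) (f := f) _ _);
      [lin_base | lin_tac]
  | |- lin _ => lin_base
  end.
Ltac bilin_tac := split; intros; lin_tac.
Ltac trilin_tac := split; intros; lin_tac.

Section TensorSums.
Variables (K : fieldType) (V W : lmodType K).
Implicit Types t : (V ⊗ W)%type.

Lemma exchange_tlift (V' W' : lmodType K) (U : zmodType) (F : V -> W -> V' -> W' -> U) t
    (t' : (V' ⊗ W')%type) :
  \tsum_(v, w <- t) \tsum_(v', w' <- t') F v w v' w' =
  \tsum_(v', w' <- t') \tsum_(v, w <- t) F v w v' w'.
Proof. by rewrite /tlift /formal_sum exchange_big. Qed.

Lemma tsum_tens (M : lmodType K) (f : V -> W -> M) v w :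
  bilin f -> tlift f (v ⊗ w) = f v w.
Proof. by move=> fB; apply: tlift_tens; apply: bilin_balanced. Qed.

Lemma tsum_tsum (V' W' M : lmodType K) (f : V -> W -> M)
    (g : V' -> W' -> (V ⊗ W)%type) (t : (V' ⊗ W')%type) : bilin f ->
  tlift f (\tsum_(v, w <- t) g v w) = \tsum_(v, w <- t) tlift f (g v w).
Proof. by move=> fB; rewrite raddf_tlift //; apply/linD/tlift_lin. Qed.

Lemma mulr_tsumr (R : pzRingType) (x : R) (f : V -> W -> R) t :
  x * tlift f t = \tsum_(v, w <- t) (x * f v w).
Proof. by rewrite raddf_tlift // => ? ?; rewrite mulrDr. Qed.

Lemma mulr_tsuml (R : pzRingType) (x : R) (f : V -> W -> R) t :
  tlift f t * x = \tsum_(v, w <- t) (f v w * x).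
Proof. by rewrite (raddf_tlift (g := *%R^~ x)) // => ? ?; rewrite mulrDl. Qed.

Lemma lin_tsumE (M M' : lmodType K) (g : M -> M') (f : V -> W -> M) t :
  lin g -> g (tlift f t) = \tsum_(v, w <- t) g (f v w).
Proof. by move=> gL; rewrite raddf_tlift //; apply: linD. Qed.

End TensorSums.

(** * Hopf algebras *)

Section Hopf.
Variables (K : numClosedFieldType) (H : hopfStarAlgType K).
Implicit Types (h g : H) (M : lmodType K).

Lemma lin_coprod : lin (@coprod K H). Proof. exact: coprod_linear. Qed.
Lemma lin_antipode : lin (@antipode K H). Proof. exact: antipode_linear. Qed.
Lemma lin_counit : lin (counit : H -> K^o). Proof. exact: counit_linear. Qed.
Lemma lin_antipodeV : lin (@antipodeV K H).
Proof. by move=> c x y; rewrite antipodeVD antipodeVZ. Qed.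
End Hopf.

#[global] Hint Extern 0 (lin _) => first
  [ eapply lin_coprod | eapply lin_antipode | eapply lin_counit
  | eapply lin_antipodeV ] : lin_db.

Section HopfIdentities.
Variables (K : numClosedFieldType) (H : hopfStarAlgType K).
Implicit Types (h g : H) (M : lmodType K).

Lemma coprod_trisumA M (F : H -> H -> H -> M) h : trilin F ->
  \tsum_(h1, h2 <- coprod h) \tsum_(h11, h12 <- coprod h1) F h11 h12 h2 =
  \tsum_(h1, h2 <- coprod h) \tsum_(h21, h22 <- coprod h2) F h1 h21 h22.
Proof. by move=> [*]; apply: coprod_sumA => *; apply: bilin_balanced; split. Qed.

Lemma coprod_counitl M (f : H -> M) h : lin f ->
  \tsum_(h1, h2 <- coprod h) (counit h1 *: f h2) = f h.
Proof.
move=> fL; rewrite -[in RHS](counitl h) lin_tsumE //.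
by apply: eq_tlift => a b; rewrite linZ.
Qed.

Lemma coprod_counitr M (f : H -> M) h : lin f ->
  \tsum_(h1, h2 <- coprod h) (counit h2 *: f h1) = f h.
Proof.
move=> fL; rewrite -[in RHS](counitr h) lin_tsumE //.
by apply: eq_tlift => a b; rewrite linZ.
Qed.

(* Uniqueness of convolution inverses, for the convolution of maps from H with *)
(* values in a left H-module.                                                 *)
Lemma antipode_unique M (r : H -> M -> M) (k : H -> M) c :
  bilin r -> (forall g h x, r (g * h) x = r g (r h x)) -> r 1 =1 id -> lin k ->
  (forall h, \tsum_(h1, h2 <- coprod h) r h1 (k h2) = counit h *: c) ->
  forall h, k h = r (antipode h) c.
Proof.
move=> [rl rr] rM r1 kL kc h; symmetry.
rewrite -(coprod_counitr (f := fun g => r (antipode g) c)); last first.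
  exact: lin_comp (rl c) (@lin_antipode _ _).
transitivity (\tsum_(h1, h2 <- coprod h) \tsum_(h21, h22 <- coprod h2)
   r (antipode h1 * h21) (k h22)).
  apply: eq_tlift => a b; rewrite -(linZ _ _ (rr _)) -kc lin_tsumE //.
  by apply: eq_tlift => *; rewrite rM.
rewrite -(coprod_trisumA (F := fun a b c => r (antipode a * b) (k c))); last first.
  split=> *.
  - apply: (lin_comp (rl _)); lin_tac.
  - apply: (lin_comp (rl _)); lin_tac.
  - exact: lin_comp (rr _) kL.
rewrite -[RHS](coprod_counitl _ kL); apply: eq_tlift => a b.
rewrite -(lin_tsumE (g := fun x => r x (k b))) // antipodel.
by rewrite (linZ (f := fun x => r x (k b))) // r1.
Qed.

Lemma antipode1 : antipode 1 = 1 :> H.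
Proof.
have := antipodel (1 : H); rewrite coprod1 tsum_tens; last by bilin_tac.
by rewrite mulr1 counit1 scale1r.
Qed.

(** Uniqueness of convolution inverses is used twice: in [h] with [g] fixed it gives [aux], and
    [aux] is then its hypothesis for the map sending [g] to [antipode (h * g)]. *)
Lemma antipodeM : {morph (@antipode K H) : h g / h * g >-> g * h}.
Proof.
have aux h g : \tsum_(g1, g2 <- coprod g) (g1 * antipode (h * g2)) = counit g *: antipode h.
  have := @antipode_unique H *%R
    (fun h => \tsum_(g1, g2 <- coprod g) (g1 * antipode (h * g2))) (counit g)%:A.
  move=> ->; rewrite ?mulr_algr //; first by bilin_tac.
  - by move=> *; rewrite mulrA.
  - by move=> x; rewrite mul1r.
  - lin_tac.
  move=> x; rewrite scalerA -counitM.
  under eq_tlift => a b do rewrite mulr_tsumr.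
  rewrite -antipoder coprod_sumM; last by apply: bilin_balanced; bilin_tac.
  by apply: eq_tlift => *; apply: eq_tlift => *; rewrite !mulrA.
move=> h g; apply: (@antipode_unique H *%R (fun g => antipode (h * g))) => //.
- by bilin_tac.
- by move=> *; rewrite mulrA.
- by move=> x; rewrite mul1r.
- by lin_tac.
Qed.

Lemma antipodeV1 : antipodeV 1 = 1 :> H.
Proof. by rewrite -[in LHS]antipode1 antipodeK. Qed.

Lemma antipodeVM : {morph (@antipodeV K H) : h g / h * g >-> g * h}.
Proof. by move=> h g; apply: (can_inj antipodeK); rewrite antipodeM !antipodeVK. Qed.

Lemma antipodeVr h : \tsum_(h1, h2 <- coprod h) (h2 * antipodeV h1) = (counit h)%:A.
Proof.
apply: (can_inj antipodeK); rewrite lin_tsumE; last exact: lin_antipode.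
under eq_tlift => a b do rewrite antipodeM antipodeVK.
by rewrite antipoder linZ ?antipode1 //; apply: lin_antipode.
Qed.

Lemma counit_antipode h : counit (antipode h) = counit h.
Proof.
have := congr1 counit (antipodel h); rewrite linearZ /= counit1 mulr1 => <-.
rewrite (lin_tsumE (g := counit : H -> K^o)); last exact: lin_counit.
rewrite -[LHS](coprod_counitr (f := fun h => counit (antipode h) : K^o)); last by lin_tac.
by apply: eq_tlift => a b; rewrite counitM mulrC.
Qed.

(** With [H] acting on [H ⊗ H] by left multiplication through [coprod], the right side satisfies the
    equation of [antipode_unique] with [c = 1]. *)
Lemma coprod_antipode h :
  coprod (antipode h) = \tsum_(h1, h2 <- coprod h) (antipode h2 ⊗ antipode h1).
Proof.
symmetry; rewrite -[RHS]mulr1.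
apply: (@antipode_unique _ (fun h x => coprod h * x)
   (fun h => \tsum_(h1, h2 <- coprod h) (antipode h2 ⊗ antipode h1))).
- by bilin_tac.
- by move=> *; rewrite coprodM mulrA.
- by move=> x; rewrite coprod1 -tens11 mul1r.
- by lin_tac.
move=> {}h.
transitivity (\tsum_(h1, h2 <- coprod h) \tsum_(h11, h12 <- coprod h1)
   \tsum_(h21, h22 <- coprod h2) ((h11 * antipode h22) ⊗ (h12 * antipode h21))).
  apply: eq_tlift => a b.
  rewrite [in LHS](tensorE (coprod a)) mulr_tsuml; apply: eq_tlift => a1 a2.
  by rewrite mulr_tsumr; apply: eq_tlift => b1 b2; rewrite tensM.
rewrite (coprod_trisumA (F := fun a b c => \tsum_(c1, c2 <- coprod c)
  ((a * antipode c2) ⊗ (b * antipode c1)))); last by trilin_tac.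
(* In [h1 S(h4) ⊗ h2 S(h3)] the inner pair collapses first, then the outer one. *)
transitivity (\tsum_(h1, h2 <- coprod h) ((h1 * antipode h2) ⊗ (1 : H))).
  apply: eq_tlift => a b.
  rewrite -(coprod_trisumA (F := fun b c d => (a * antipode d) ⊗ (b * antipode c)));
    last by trilin_tac.
  rewrite -[RHS](coprod_counitl (f := fun b => (a * antipode b) ⊗ 1)); last by lin_tac.
  apply: eq_tlift => b1 b2; rewrite -(lin_tsumE (g := tens _)); last by lin_tac.
  by rewrite antipoder tensZr.
rewrite -(lin_tsumE (g := fun x => x ⊗ (1 : H))); last by lin_tac.
by rewrite antipoder tensZl.
Qed.

End HopfIdentities.

(** * Yetter-Drinfeld algebras *)

Section YetterDrinfeldLinear.
Variables (K : numClosedFieldType) (O : compactQGType K) (N : braidedYDType O).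

Lemma lin_theta : lin (@theta K O N). Proof. exact: theta_linear. Qed.
Lemma lin_actl (h : O) : lin (fun m : N => act m h). Proof. exact: act_linearl. Qed.
Lemma lin_actr (m : N) : lin (fun h : O => act m h). Proof. exact: act_linearr. Qed.
Lemma lin_haar : lin (haar : O -> K^o). Proof. exact: haar_linear. Qed.
Lemma lin_yd_int : lin (yd_int : N -> K^o). Proof. exact: yd_int_linear. Qed.
End YetterDrinfeldLinear.

#[global] Hint Extern 0 (lin _) => first
  [ eapply lin_theta | eapply lin_actl | eapply lin_actr | eapply lin_haar
  | eapply lin_yd_int ] : lin_db.

Section CanonicalLinear.
Variables (K : numClosedFieldType) (O : compactQGType K) (N : braidedYDType O).

Lemma lin_gamma : lin (@gamma K O N).
Proof. by apply: (lin_tsum (t := @theta K O N)); [lin_tac | bilin_tac]. Qed.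
Lemma lin_gamma_hat : lin (@gamma_hat K O N).
Proof. by apply: (lin_tsum (t := @theta K O N)); [lin_tac | bilin_tac]. Qed.
End CanonicalLinear.

#[global] Hint Extern 0 (lin _) => first
  [ eapply lin_gamma | eapply lin_gamma_hat ] : lin_db.

Section YetterDrinfeld.
Variables (K : numClosedFieldType) (O : compactQGType K) (N : braidedYDType O).
Implicit Types (h g : O) (m n : N) (M : lmodType K).

Lemma theta_coact_sum M (F : O -> O -> N -> M) m : trilin F ->
  \tsum_(h, m0 <- theta m) \tsum_(h1, h2 <- coprod h) F h1 h2 m0 =
  \tsum_(h, m0 <- theta m) \tsum_(g, m00 <- theta m0) F h g m00.
Proof.
move=> [F1 F2 F3].
pose G (X : (O ⊗ O)%type) (c : N) := \tsum_(a, b <- X) F a b c.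
have Fab c : bilin (fun a b => F a b c) by split.
have GB : bilin G.
  split=> [c|X]; first exact: tlift_lin.
  by apply: lin_tlift.
have := congr1 (tlift G) (theta_coact m).
rewrite !tsum_tsum //.
under eq_tlift => h1 h2.
  rewrite tsum_tsum //; under eq_tlift => a b do rewrite tsum_tens // /G tsum_tens //.
  over.
move=> ->; apply: eq_tlift => h1 h2.
by rewrite tsum_tsum //; apply: eq_tlift => a b; rewrite tsum_tens // /G tsum_tens.
Qed.

Lemma theta_act_sum M (F : O -> N -> M) m h : bilin F ->
  tlift F (theta (act m h)) =
  \tsum_(h12, h3 <- coprod h) \tsum_(h1, h2 <- coprod h12) \tsum_(g, m0 <- theta m)
    F (antipodeV h3 * g * h1) (act m0 h2).
Proof.
move=> FB; rewrite theta_act; do 3 ![rewrite tsum_tsum //; apply: eq_tlift => ? ?].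
by rewrite tsum_tens.
Qed.

(** Applying [S^-1] to the first leg [S^-1(h3) g h1] of [theta (act m h)] puts [S^-1(h1)] next to
    [h2], where [h2 S^-1(h1)] collapses. *)
Lemma gamma_act m h : gamma (act m h) = act (gamma m) (antipodeV (antipodeV h)).
Proof.
rewrite /gamma theta_act_sum; last by bilin_tac.
rewrite (lin_tsumE (g := fun x => act x _)); last by lin_tac.
transitivity (\tsum_(h12, h3 <- coprod h) \tsum_(g, m0 <- theta m)
    (counit h12 *: act m0 (antipodeV g * antipodeV (antipodeV h3)))).
  apply: eq_tlift => h12 h3; rewrite exchange_tlift; apply: eq_tlift => g m0.
  rewrite -(linZ (f := fun x => act m0 x)); last by lin_tac.
  rewrite -[in RHS](mul1r (antipodeV g)) -!mulrA -mulr_algl mulrA -antipodeVr.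
  rewrite mulr_tsuml (lin_tsumE (g := fun x => act m0 x)); last by lin_tac.
  by apply: eq_tlift => h1 h2; rewrite -actA !antipodeVM !mul1r !mulrA.
rewrite exchange_tlift; apply: eq_tlift => g m0.
rewrite coprod_counitl ?actA //.
lin_tac.
Qed.

(** By coassociativity of the coaction the two antipodes combine into [S(h1 S(h2))], which
    collapses. *)
Lemma gamma_hat_antipode m :
  \tsum_(h, m0 <- theta m) act (gamma_hat m0) (antipode h) = m.
Proof.
transitivity (\tsum_(h, m0 <- theta m) \tsum_(g, m00 <- theta m0)
   act m00 (antipode (h * antipode g))).
  apply: eq_tlift => h m0; rewrite (lin_tsumE (g := fun x => act x _)); last by lin_tac.
  by apply: eq_tlift => g m00; rewrite antipodeM actA.
rewrite -(theta_coact_sum (F := fun a b c => act c (antipode (a * antipode b)))); last by trilin_tac.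
rewrite -[RHS]theta_counit; apply: eq_tlift => h m0.
rewrite -(lin_tsumE (g := fun x => act m0 (antipode x))); last by lin_tac.
rewrite antipoder (linZ (f := fun x => act m0 (antipode x))); last by lin_tac.
by rewrite antipode1 act1.
Qed.

(** The star on the opposite algebra contributes [S^-2] and [gamma] another [S^-1]; the star of the
    action removes one, and conjugating the remaining [S^-2] by the star gives [S^2]. *)
Lemma gamma_hatE m : gamma_hat m = star (gamma (star m)).
Proof.
rewrite /gamma theta_star tsum_tsum; last by bilin_tac.
rewrite raddf_tlift; last exact: starD.
apply: eq_tlift => h m0; rewrite tsum_tens; last by bilin_tac.
by rewrite act_star starK antipodeVK -!antipodeV_star !starK.
Qed.

(** Both sides equal the integral of [(m (n <| S^-1(h2))) <| h1]: invariance of [yd_int] gives one,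
    expanding the action on the product gives the other. *)
Lemma yd_int_actl m n h :
  yd_int (act m h * n) = yd_int (m * act n (antipodeV h)).
Proof.
transitivity (\tsum_(h1, h2 <- coprod h)
   (yd_int (act (m * act n (antipodeV h2)) h1) : K^o)).
  transitivity (\tsum_(h1, h2 <- coprod h) \tsum_(h11, h12 <- coprod h1)
     (yd_int (act m h11 * act n (antipodeV h2 * h12)) : K^o)); last first.
    apply: eq_tlift => a b; rewrite actM (lin_tsumE (g := yd_int : N -> K^o)); last by lin_tac.
    by apply: eq_tlift => *; rewrite actA.
  rewrite (coprod_trisumA (M := K^o) (F := fun a b c =>
    yd_int (act m a * act n (antipodeV c * b)))); last by trilin_tac.
  rewrite -[LHS](coprod_counitr (f := fun h => yd_int (act m h * n) : K^o)); last by lin_tac.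
  apply: eq_tlift => a b.
  rewrite -(lin_tsumE (M' := K^o) (g := fun x => yd_int (act m a * act n x))); last by lin_tac.
  rewrite antipodeVl (linZ (M := K^o) (f := fun x => yd_int (act m a * act n x))); last by lin_tac.
  by rewrite act1.
rewrite -[RHS](coprod_counitl (f := fun h => yd_int (m * act n (antipodeV h)) : K^o));
  last by lin_tac.
by apply: eq_tlift => a b; rewrite yd_int_act.
Qed.

(** Braided commutativity writes [m n] as a sum of [(n <| h) m0]; moving the action across puts
    [m0 <| S^-1(h)], whose sum is [gamma m], to the right of [n]. *)
Lemma yd_int_gammar m n : yd_int (m * n) = yd_int (n * gamma m).
Proof.
rewrite braided_comml (lin_tsumE (g := yd_int : N -> K^o)); last by lin_tac.
rewrite /gamma mulr_tsumr (lin_tsumE (g := yd_int : N -> K^o)); last by lin_tac.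
by apply: eq_tlift => h m0; rewrite yd_int_actl.
Qed.

Lemma yd_int_gamma m : yd_int (gamma m) = yd_int m.
Proof. by rewrite -[gamma m]mul1r -yd_int_gammar mulr1. Qed.

End YetterDrinfeld.

(** * Positive forms and one-sided faithfulness *)

Section PositiveForms.
Variable K : numClosedFieldType.

Record positive_form (V : lmodType K) (F : V -> V -> K) : Prop := {
  formDl : forall u v w, F (u + v) w = F u w + F v w;
  formDr : forall u v w, F u (v + w) = F u v + F u w;
  formZl : forall c u v, F (c *: u) v = c * F u v;
  formZr : forall c u v, F u (c *: v) = c^* * F u v;
  form_ge0 : forall u, 0 <= F u u
}.

Section Form.
Variables (V : lmodType K) (F : V -> V -> K).
Hypothesis FP : positive_form F.
Implicit Types u v w : V.

(** Positivity makes each [F w w] real; polarization with [c = 1] and [c = 'i] then separates the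
    two values. *)
Lemma formC u v : F v u = (F u v)^*.
Proof.
have form_real w : (F w w)^* = F w w by apply/CrealP/ger0_real/(form_ge0 FP).
have cross c : c * (F u v)^* + c^* * (F v u)^* = c^* * F u v + c * F v u.
  have e : c^* * F u v + c * F v u =
      F (u + c *: v) (u + c *: v) - F u u - c * c^* * F v v.
    by rewrite !(formDl FP, formDr FP, formZl FP, formZr FP); ring.
  have r : (c^* * F u v + c * F v u)^* = c^* * F u v + c * F v u.
    by rewrite e !rmorphB !rmorphM /= !form_real conjCK [c^* * c]mulrC.
  by rewrite -r rmorphD !rmorphM /= conjCK.
have e1 := cross 1; have := cross 'i.
rewrite conjCi !mulNr -!mulrBr -mulrN -mulrDr => /(mulfI (neq0Ci K)) e2.
move: e1; rewrite conjC1 !mul1r => e1.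
apply: (@mulfI _ 2%:R); first by rewrite pnatr_eq0.
have -> : 2%:R * F v u = (F u v + F v u) + (- F u v + F v u) by ring.
by rewrite -e1 -e2; ring.
Qed.

Lemma form_null u v : F v v = 0 -> F u v = 0.
Proof.
move=> v0; apply/eqP; apply: contraT => uv0.
have n_gt0 : 0 < F u v * (F u v)^* by rewrite -normCK exprn_gt0 // normr_gt0.
(* Chosen so that the form takes the value -1 at [u - t F(u,v) v], against positivity. *)
pose t := (F u u + 1) / (2%:R * (F u v * (F u v)^*)).
have t_real : t^* = t.
  apply/CrealP/ger0_real/divr_ge0.
    exact: addr_ge0 (form_ge0 FP u) ler01.
  exact: mulr_ge0 (ler0n _ _) (ltW n_gt0).
have := form_ge0 FP (u + (- (t * F u v)) *: v).
rewrite !(formDl FP, formDr FP, formZl FP, formZr FP) v0 (formC u v).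
rewrite rmorphN rmorphM /= t_real !mulr0 addr0.
have -> : F u u + - (t * (F u v)^*) * F u v + - (t * F u v) * (F u v)^* =
    F u u - t * (2%:R * (F u v * (F u v)^*)) by ring.
rewrite /t divfK; last by apply: mulf_neq0 (lt0r_neq0 n_gt0); rewrite pnatr_eq0.
by rewrite opprD addrA subrr sub0r oppr_ge0 ler10.
Qed.
End Form.

Section TensorForm.
Variables (V W : lmodType K) (F : V -> V -> K) (G : W -> W -> K).
Hypotheses (FP : positive_form F) (GP : positive_form G).
Local Notation VW := (V ⊗ W)%type.

(** In the second argument the summand is conjugate-linear in each leg, hence balanced though not
    bilinear; the sum is therefore independent of the decomposition. *)
Definition tensor_form (x y : VW) : K :=
  \tsum_(v, w <- x) \tsum_(v', w' <- y) (F v v' * G w w').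

Let form_balancedr v w : balanced (fun v' w' => F v v' * G w w').
Proof.
split=> *; first by rewrite (formDr FP) mulrDl.
  by rewrite (formDr GP) mulrDr.
by rewrite (formZr FP) (formZr GP) mulrCA mulrA.
Qed.

Let form_balancedl y : balanced (fun v w => \tsum_(v', w' <- y) (F v v' * G w w')).
Proof.
split=> *; rewrite -?tlift_addf; apply: eq_tlift => *.
- by rewrite (formDl FP) mulrDl.
- by rewrite (formDl GP) mulrDr.
- by rewrite (formZl FP) (formZl GP) mulrCA mulrA.
Qed.

Lemma tensor_formDl x y z : tensor_form (x + y) z = tensor_form x z + tensor_form y z.
Proof. exact: tliftD. Qed.

Lemma tensor_formDr x y z : tensor_form z (x + y) = tensor_form z x + tensor_form z y.
Proof. by rewrite -tlift_addf; apply: eq_tlift => v w; rewrite tliftD. Qed.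

Lemma tensor_form_tens v w v' w' : tensor_form (v ⊗ w) (v' ⊗ w') = F v v' * G w w'.
Proof. by rewrite /tensor_form !tlift_tens. Qed.

(* Gram-Schmidt in the first leg; a null first vector is orthogonal to everything by
   form_null, and then the division by 0 in c yields 0. *)
Lemma tensor_form_ge0 x : 0 <= tensor_form x x.
Proof.
have form0l y : tensor_form 0 y = 0 by apply: tlift0.
suff ge0 n (s : seq (V * W)) : (size s <= n)%N ->
    0 <= tensor_form (\sum_(p <- s) p.1 ⊗ p.2) (\sum_(p <- s) p.1 ⊗ p.2).
  by rewrite (tensorE x); apply: ge0 (leqnn _).
elim: n s => [|n IHn] [|[v w] s] //=; try by rewrite big_nil form0l.
rewrite ltnS => size_s.
pose c (p : V * W) := F p.1 v / F v v.
pose s' := [seq (p.1 - c p *: v, p.2) | p <- s].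
pose w' := w + \sum_(p <- s) c p *: p.2.
have -> : \sum_(p <- (v, w) :: s) p.1 ⊗ p.2 = v ⊗ w' + \sum_(p <- s') p.1 ⊗ p.2.
  rewrite big_cons big_map tensDr -addrA; congr (_ + _).
  rewrite (lin_sum _ _ (lin_tensr _)) -big_split; apply: eq_bigr => p _ /=.
  by rewrite tensDl -scaleNr tensZl tensZr scaleNr addrC subrK.
have orth p : p \in s' -> F p.1 v = 0.
  case/mapP=> q _ -> /=; rewrite -scaleNr (formDl FP) (formZl FP) mulNr /c.
  have [v0|v0] := eqVneq (F v v) 0; last by rewrite divfK // subrr.
  by rewrite (form_null FP q.1 v0) v0 mulr0 subr0.
have orthr p : p \in s' -> F v p.1 = 0.
  by move=> ps; rewrite (formC FP) orth // conjC0.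
rewrite tensor_formDl !tensor_formDr tensor_form_tens.
have -> : tensor_form (v ⊗ w') (\sum_(p <- s') p.1 ⊗ p.2) = 0.
  rewrite (big_morph (tensor_form _) (fun _ _ => tensor_formDr _ _ _) (id1 := 0)); last first.
    by apply: (addrI (tensor_form (v ⊗ w') 0)); rewrite -tensor_formDr !addr0.
  rewrite big1_seq // => p /= ps; by rewrite tensor_form_tens orthr // mul0r.
have -> : tensor_form (\sum_(p <- s') p.1 ⊗ p.2) (v ⊗ w') = 0.
  rewrite (big_morph (tensor_form^~ _) (fun _ _ => tensor_formDl _ _ _) (form0l _)).
  rewrite big1_seq // => p /= ps; by rewrite tensor_form_tens orth // mul0r.
rewrite addr0 add0r addr_ge0 //; last by apply: IHn; rewrite size_map.
exact: mulr_ge0 (form_ge0 FP v) (form_ge0 GP w').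
Qed.
End TensorForm.

(** If [f q.1 <> 0] for some term [q], the vanishing slice by [f] solves for [q.2] in terms of the
    other second legs, so [q] can be eliminated; the decomposition shortens until all first legs lie
    in the common kernel of [Phi]. *)
Lemma tensor_kernel (V W : lmodType K) (Phi : set (V -> K^o)) (x : (V ⊗ W)%type) :
  (forall f, Phi f -> lin f) ->
  (forall f, Phi f -> \tsum_(v, w <- x) (f v *: w) = 0) ->
  exists2 s : seq (V * W), x = \sum_(p <- s) p.1 ⊗ p.2 &
    forall f p, Phi f -> p \in s -> f p.1 = 0.
Proof.
move=> PhiL Phi0.
suff step n (s : seq (V * W)) : (size s <= n)%N -> x = \sum_(p <- s) p.1 ⊗ p.2 ->
    exists2 s : seq (V * W), x = \sum_(p <- s) p.1 ⊗ p.2 &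
      forall f p, Phi f -> p \in s -> f p.1 = 0.
  exact: step (leqnn _) (tensorE x).
elim: n s => [|n IHn] s size_s xs.
  by exists s => // f p _; case: s size_s {xs}.
have [all0|] := pselect (forall f p, Phi f -> p \in s -> f p.1 = 0); first by exists s.
move=> /existsNP[f] /existsNP[q] /not_implyP[Pf] /not_implyP[qs /eqP fq].
have fL := PhiL f Pf.
(* Substituting for [q.2] changes the other first legs by the multiple of [q.1] that puts them in
   the kernel of [f]. *)
pose s' := [seq (p.1 - ((f q.1)^-1 * f p.1) *: q.1, p.2) | p <- rem q s].
have ss' : perm_eq s (q :: rem q s) by exact: perm_to_rem.
have qE : f q.1 *: q.2 = - \sum_(p <- rem q s) f p.1 *: p.2.
  apply/eqP; rewrite -addr_eq0; apply/eqP; rewrite -[RHS](Phi0 f Pf) xs.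
  have fB : bilin (fun (v : V) (w : W) => f v *: w) by bilin_tac.
  rewrite (lin_sum _ _ (tlift_lin fB)) (perm_big _ ss') big_cons /= tsum_tens //.
  by congr (_ + _); apply: eq_bigr => p _; rewrite tsum_tens.
apply: (IHn s'); first by rewrite size_map size_rem // -ltnS prednK //; case: (s) qs.
rewrite xs (perm_big _ ss') big_cons big_map /=.
have -> : q.2 = \sum_(p <- rem q s) (- ((f q.1)^-1 * f p.1)) *: p.2.
  rewrite -[LHS]scale1r -(mulVf fq) -scalerA qE scalerN scaler_sumr -sumrN.
  by apply: eq_bigr => p _; rewrite scalerA scaleNr.
rewrite (lin_sum _ _ (lin_tensr _)) -big_split; apply: eq_bigr => p _ /=.
by rewrite tensDl tensZr scaleNr -scaleNr -tensZl scaleNr addrC.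
Qed.

End PositiveForms.

(** * One-sided faithfulness of the Haar functional *)

Section OneSidedFaithful.
Variables (K : numClosedFieldType) (O : compactQGType K).
Implicit Types h g : O.

(** Writing [h1 ⊗ h2 g] as [h1 g2 S^-1(g1) ⊗ h2 g3], right invariance contracts [haar (h2 g3) h1 g2]
    to the scalar [haar (h g2)], which is 0. *)
Lemma haar_ideal_coideal h g : (forall k, haar (h * k) = 0) ->
  \tsum_(h1, h2 <- coprod h) (haar (h2 * g) *: h1) = 0.
Proof.
move=> h0.
transitivity (\tsum_(g1, g2 <- coprod g) \tsum_(g21, g22 <- coprod g2)
  \tsum_(h1, h2 <- coprod h) (haar (h2 * g22) *: (h1 * g21 * antipodeV g1))).
  rewrite -(coprod_trisumA (F := fun a b c =>
    \tsum_(h1, h2 <- coprod h) (haar (h2 * c) *: (h1 * b * antipodeV a)))); last by trilin_tac.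
  transitivity (\tsum_(g1, g2 <- coprod g) (counit g1 *:
    \tsum_(h1, h2 <- coprod h) (haar (h2 * g2) *: h1))).
    rewrite (coprod_counitl (f := fun g => \tsum_(h1, h2 <- coprod h) (haar (h2 * g) *: h1)));
      [by [] | by lin_tac].
  apply: eq_tlift => g1 g2.
  rewrite exchange_tlift (lin_tsumE _ _ (@lin_scaler _ _ _)); apply: eq_tlift => h1 h2.
  rewrite -(lin_tsumE _ _ (@lin_scaler _ _ _)) scalerA mulrC -scalerA; congr (_ *: _).
  under eq_tlift => a b do rewrite -mulrA.
  by rewrite -mulr_tsumr antipodeVr -scalerAr mulr1.
transitivity (\tsum_(g1, g2 <- coprod g) (0 : O)); last by rewrite /tlift /formal_sum !big1.
apply: eq_tlift => g1 g2.
transitivity ((haar (h * g2))%:A * antipodeV g1); last by rewrite h0 scale0r mul0r.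
rewrite -haarr mulr_tsuml coprod_sumM; last by apply: bilin_balanced; bilin_tac.
rewrite exchange_tlift; apply: eq_tlift => h1 h2; apply: eq_tlift => a b.
by rewrite scalerAl.
Qed.

Lemma haar_faithfull h : (forall g, haar (h * g) = 0) -> h = 0.
Proof.
(* The coproduct is flipped because [tensor_kernel] controls first legs: here these come from
   [h2]. *)
have split_kernel h0 : (forall g, haar (h0 * g) = 0) ->
    exists2 s : seq (O * O),
      \tsum_(h1, h2 <- coprod h0) (h2 ⊗ h1) = \sum_(p <- s) p.1 ⊗ p.2 &
      forall g p, p \in s -> haar (p.1 * g) = 0.
  move=> h00; pose Phi : set (O -> K^o) := [set f | exists g, f = fun h => haar (h * g)].
  have [|f [g ->]|s hs s0] := @tensor_kernel _ _ _ Phi (\tsum_(h1, h2 <- coprod h0) (h2 ⊗ h1)).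
  - by move=> _ [g ->]; lin_tac.
  - rewrite tsum_tsum; last by bilin_tac.
    transitivity (\tsum_(h1, h2 <- coprod h0) (haar (h2 * g) *: h1)).
      by apply: eq_tlift => h1 h2; rewrite tsum_tens //; bilin_tac.
    exact: haar_ideal_coideal.
  - by exists s => // g p; apply: (s0 (fun h => haar (h * g))); exists g.
have counit0 h0 : (forall g, haar (h0 * g) = 0) -> counit h0 = 0.
  move=> h00; have [s sE s0] := split_kernel h0 h00.
  have [g g0] := @haar_neq0 K O; apply/eqP; apply: contraT => /negP ch0; case: g0.
  have fB : bilin (fun v w => haar (v * (antipodeV w * g)) : K^o) by bilin_tac.
  (* [counit h0] is the sum of [h2 S^-1(h1)]; each [h2] may be taken in the kernel, which is a right
     ideal, so [haar] kills its product with [g]. *)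
  have : counit h0 * haar g = 0.
    have <- : haar ((counit h0)%:A * g) = counit h0 * haar g.
      by rewrite mulr_algl (linZ _ _ (@lin_haar _ O)).
    rewrite -antipodeVr mulr_tsuml (lin_tsumE _ _ (@lin_haar _ O)).
    transitivity (tlift (fun v w => haar (v * (antipodeV w * g)) : K^o)
      (\tsum_(h1, h2 <- coprod h0) (h2 ⊗ h1))).
      by rewrite tsum_tsum //; apply: eq_tlift => *; rewrite tsum_tens // mulrA.
    rewrite sE (lin_sum _ _ (tlift_lin fB)) big1_seq // => p /= ps.
    by rewrite tsum_tens // s0.
  by move/eqP; rewrite mulf_eq0 => /orP[/ch0|/eqP].
move=> h0; have [s sE s0] := split_kernel h h0.
have fB : bilin (fun v w : O => (counit v : K^o) *: w) by bilin_tac.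
transitivity (tlift (fun v w : O => (counit v : K^o) *: w)
  (\tsum_(h1, h2 <- coprod h) (h2 ⊗ h1))).
  rewrite -[LHS]counitr tsum_tsum //.
  by apply: eq_tlift => *; rewrite tsum_tens.
rewrite sE (lin_sum _ _ (tlift_lin fB)) big1_seq // => p /= ps.
by rewrite tsum_tens // counit0 ?scale0r // => g; apply: s0.
Qed.
End OneSidedFaithful.

(** * Commutation relations in the smash product *)

(* All that is used of O # N.  The relations below are derived for an abstract A     *)
(* because on smash N unification unfolds a product into a sum over a tensor.         *)
Record crossed_product (K : numClosedFieldType) (O : compactQGType K) (N : braidedYDType O)
    (A : starAlgType K) (iota : O -> A) (alpha : N -> A) (proj : A -> N) : Prop := {
  iota_lin : lin iota;
  alpha_lin : lin alpha;
  proj_lin : lin proj;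
  iota1 : iota 1 = 1;
  alpha1 : alpha 1 = 1;
  iotaM : forall h g, iota (h * g) = iota h * iota g;
  alphaM : forall m n, alpha (m * n) = alpha m * alpha n;
  iota_star : forall h, star (iota h) = iota (star h);
  alpha_star : forall m, star (alpha m) = alpha (star m);
  alpha_iota_comm : forall m h,
    alpha m * iota h = \tsum_(h1, h2 <- coprod h) (iota h1 * alpha (act m h2));
  crossed_span : forall x, exists t : (O ⊗ N)%type,
    x = \tsum_(h, m <- t) (iota h * alpha m);
  proj_iota_alpha : forall h m, proj (iota h * alpha m) = counit h *: m
}.

Section CrossedProduct.
Variables (K : numClosedFieldType) (O : compactQGType K) (N : braidedYDType O).
Variables (A : starAlgType K) (iota : O -> A) (alpha : N -> A) (proj : A -> N).
Hypothesis cp : crossed_product iota alpha proj.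
Implicit Types (h g : O) (m n : N) (M : lmodType K).

Let iotaL : lin iota := iota_lin cp.
Let alphaL : lin alpha := alpha_lin cp.
Let projL : lin proj := proj_lin cp.

Definition crossed_beta m : A := \tsum_(h, m0 <- theta m) (iota h * alpha m0).
Local Notation beta := crossed_beta.

Lemma lin_beta : lin beta.
Proof. by apply: (lin_tsum (t := @theta K O N)); [lin_tac | bilin_tac]. Qed.
Let betaL : lin beta := lin_beta.

Lemma crossed_ext M (f g : A -> M) : lin f -> lin g ->
  (forall h m, f (iota h * alpha m) = g (iota h * alpha m)) -> f =1 g.
Proof.
move=> fL gL fg x; have [t ->] := crossed_span cp x.
by rewrite (lin_tsumE _ _ fL) (lin_tsumE _ _ gL); apply: eq_tlift.
Qed.

Lemma beta1 : beta 1 = 1.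
Proof.
rewrite /beta theta1 tsum_tens; last by bilin_tac.
by rewrite (iota1 cp) (alpha1 cp) mul1r.
Qed.

Lemma proj_alpha m : proj (alpha m) = m.
Proof. by rewrite -[alpha m]mul1r -(iota1 cp) (proj_iota_alpha cp) counit1 scale1r. Qed.

(** [proj] plays the role of [counit ⊗ id], so the counit law of the coaction makes it a left
    inverse of [beta], as it is of [alpha]; both are thus injective. *)
Lemma proj_beta m : proj (beta m) = m.
Proof.
rewrite /beta (lin_tsumE _ _ projL) -[RHS]theta_counit.
by apply: eq_tlift => *; rewrite (proj_iota_alpha cp).
Qed.

Lemma beta_inj : injective beta.
Proof. exact: can_inj proj_beta. Qed.

Lemma alpha_inj : injective alpha.
Proof. exact: can_inj proj_alpha. Qed.

(** Inverts [alpha_iota_comm]: moving [alpha] back produces [S^-1(h3) h2] in the action, which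
    collapses. *)
Lemma iota_alpha_comm m h :
  iota h * alpha m =
  \tsum_(h1, h2 <- coprod h) (alpha (act m (antipodeV h2)) * iota h1).
Proof.
symmetry.
transitivity (\tsum_(h1, h2 <- coprod h) \tsum_(h11, h12 <- coprod h1)
   (iota h11 * alpha (act m (antipodeV h2 * h12)))).
  apply: eq_tlift => a b; rewrite (alpha_iota_comm cp).
  by apply: eq_tlift => *; rewrite actA.
rewrite (coprod_trisumA (F := fun a b c => iota a * alpha (act m (antipodeV c * b))));
  last by trilin_tac.
rewrite -[RHS](coprod_counitr (f := fun h => iota h * alpha m)); last by lin_tac.
apply: eq_tlift => a b.
rewrite -(lin_tsumE (g := fun x => iota a * alpha (act m x))); last by lin_tac.
by rewrite antipodeVl (linZ (f := fun x => iota a * alpha (act m x))) ?act1 //; lin_tac.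
Qed.

(** This is the Yetter-Drinfeld compatibility of [theta] with the action, read in [A]; the rules for
    passing [iota] through [beta] are obtained by inverting it. *)
Lemma beta_act m h :
  beta (act m h) = \tsum_(h1, h2 <- coprod h) (iota (antipodeV h2) * beta m * iota h1).
Proof.
rewrite /beta theta_act_sum; last by bilin_tac.
apply: eq_tlift => h12 h3.
rewrite -[RHS]mulrA mulr_tsuml mulr_tsumr exchange_tlift.
apply: eq_tlift => g m0; rewrite -mulrA (alpha_iota_comm cp) !mulr_tsumr.
by apply: eq_tlift => h1 h2; rewrite !(iotaM cp) !mulrA.
Qed.

Lemma beta_iota_comm m h :
  beta m * iota h = \tsum_(h1, h2 <- coprod h) (iota h2 * beta (act m h1)).
Proof.
symmetry.
transitivity (\tsum_(h1, h2 <- coprod h) \tsum_(h11, h12 <- coprod h1)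
   (iota (h2 * antipodeV h12) * (beta m * iota h11))).
  apply: eq_tlift => h1 h2; rewrite beta_act mulr_tsumr.
  by apply: eq_tlift => *; rewrite (iotaM cp) !mulrA.
rewrite (coprod_trisumA (F := fun a b c => iota (c * antipodeV b) * (beta m * iota a)));
  last by trilin_tac.
rewrite -[RHS](coprod_counitr (f := fun h => beta m * iota h)); last by lin_tac.
apply: eq_tlift => a b.
rewrite -(lin_tsumE (g := fun x => iota x * (beta m * iota a))); last by lin_tac.
by rewrite antipodeVr (linZ _ _ iotaL) (iota1 cp) -scalerAl mul1r.
Qed.

Lemma beta_act_antipode m h :
  beta (act m (antipode h)) =
  \tsum_(h1, h2 <- coprod h) (iota h1 * beta m * iota (antipode h2)).
Proof.
rewrite beta_act coprod_antipode tsum_tsum; last by bilin_tac.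
apply: eq_tlift => a b; rewrite tsum_tens; last by bilin_tac.
by rewrite antipodeK.
Qed.

Lemma iota_beta_comm m h :
  iota h * beta m =
  \tsum_(h1, h2 <- coprod h) (beta (act m (antipode h1)) * iota h2).
Proof.
symmetry.
transitivity (\tsum_(h1, h2 <- coprod h) \tsum_(h11, h12 <- coprod h1)
   (iota h11 * beta m * iota (antipode h12 * h2))).
  apply: eq_tlift => h1 h2; rewrite beta_act_antipode mulr_tsuml.
  by apply: eq_tlift => *; rewrite (iotaM cp) !mulrA.
rewrite (coprod_trisumA (F := fun a b c => iota a * beta m * iota (antipode b * c)));
  last by trilin_tac.
rewrite -[RHS](coprod_counitr (f := fun h => iota h * beta m)); last by lin_tac.
apply: eq_tlift => a b.
rewrite -(lin_tsumE (g := fun x => iota a * beta m * iota x)); last by lin_tac.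
by rewrite antipodel (linZ _ _ iotaL) (iota1 cp) -scalerAr mulr1.
Qed.

(** Pushing [alpha m] through [beta n] yields [(m <| g) n00] under [alpha], with [g] and [n00] the
    legs of [theta n0]; braided commutativity sums this to [n0 m]. *)
Lemma alpha_beta_comm m n : alpha m * beta n = beta n * alpha m.
Proof.
rewrite /beta mulr_tsumr.
transitivity (\tsum_(h, n0 <- theta n) \tsum_(h1, h2 <- coprod h)
   (iota h1 * alpha (act m h2 * n0))).
  apply: eq_tlift => h n0; rewrite mulrA (alpha_iota_comm cp) mulr_tsuml.
  by apply: eq_tlift => *; rewrite (alphaM cp) mulrA.
rewrite (theta_coact_sum (F := fun a b c => iota a * alpha (act m b * c))); last by trilin_tac.
rewrite mulr_tsuml; apply: eq_tlift => h n0.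
rewrite -mulrA -(alphaM cp) braided_comml (lin_tsumE (g := fun x => iota h * alpha x)) //.
by lin_tac.
Qed.

(** Since [theta] is multiplicative into the opposite of [O], the product becomes a sum of
    [iota g * beta m * alpha n0], and [beta m] commutes past [alpha n0]. *)
Lemma betaM m n : beta (m * n) = beta n * beta m.
Proof.
rewrite {1}/beta thetaM tsum_tsum; last by bilin_tac.
transitivity (\tsum_(g, n0 <- theta n) (iota g * beta m * alpha n0)).
  under eq_tlift => h m0 do (rewrite tsum_tsum; last by bilin_tac).
  rewrite exchange_tlift; apply: eq_tlift => g n0.
  rewrite -mulrA mulr_tsuml mulr_tsumr; apply: eq_tlift => h m0.
  rewrite tsum_tens; last by bilin_tac.
  by rewrite (iotaM cp) (alphaM cp) !mulrA.
rewrite [in RHS]/beta mulr_tsuml; apply: eq_tlift => g n0.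
by rewrite -mulrA -alpha_beta_comm mulrA.
Qed.

Lemma alpha_from_beta m :
  alpha m = \tsum_(h, m0 <- theta m) (iota (antipode h) * beta m0).
Proof.
symmetry.
under eq_tlift => h m0 do rewrite mulr_tsumr.
rewrite -(theta_coact_sum (F := fun a b c => iota (antipode a) * (iota b * alpha c)));
  last by trilin_tac.
rewrite -[in RHS](theta_counit m) (lin_tsumE _ _ alphaL); apply: eq_tlift => h m0.
under eq_tlift => a b do rewrite mulrA -(iotaM cp).
rewrite -(lin_tsumE (g := fun x => iota x * alpha m0)); last by lin_tac.
rewrite antipodel (linZ (f := fun x => iota x * alpha m0)); last by lin_tac.
by rewrite (iota1 cp) mul1r (linZ _ _ alphaL).
Qed.

(** Reordering [iota h * alpha m0] makes one coaction leg act through [S^-1], which is [gamma]. The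
    relations of [A ⊗^C A] can move factors written in this form. *)
Lemma beta_from_gamma m :
  beta m = \tsum_(h, m0 <- theta m) (alpha (gamma m0) * iota h).
Proof.
rewrite /beta.
transitivity (\tsum_(h, m0 <- theta m) \tsum_(h1, h2 <- coprod h)
  (alpha (act m0 (antipodeV h2)) * iota h1)).
  by apply: eq_tlift => h m0; rewrite iota_alpha_comm.
rewrite (theta_coact_sum (F := fun a b c => alpha (act c (antipodeV b)) * iota a));
  last by trilin_tac.
apply: eq_tlift => h m0; rewrite /gamma (lin_tsumE (g := fun x => alpha x * iota h)) //.
by lin_tac.
Qed.

Let star_beta_star m :
  star (beta (star m)) = \tsum_(h, m0 <- theta m) (alpha m0 * iota (antipode (antipode h))).
Proof.
rewrite /beta theta_star tsum_tsum; last by bilin_tac.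
rewrite raddf_tlift; last exact: starD.
apply: eq_tlift => h m0; rewrite tsum_tens; last by bilin_tac.
rewrite starM (iota_star cp) (alpha_star cp) starK.
by rewrite -2!antipodeV_star !starK.
Qed.

(** By [beta_act], the star of the right side is a sum of [iota h * X m00 * iota (S g)]. In it
    [S^2(k) S(g) = S(g S(k))], where [k] is the leg inside [X], and this collapses to leave
    [beta m]. *)
Lemma beta_star m : star (beta m) = beta (star (gamma m)).
Proof.
apply: (can_inj (@starK _ A)); rewrite starK.
have -> : star (gamma m) = \tsum_(h, m0 <- theta m) act (star m0) (star h).
  rewrite /gamma raddf_tlift; last exact: starD.
  by apply: eq_tlift => h m0; rewrite act_star antipodeVK.
rewrite (lin_tsumE _ _ betaL) raddf_tlift; last exact: starD.
(* By [star_beta_star], this is [star (beta (star n))]. *)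
pose X n := \tsum_(h, n0 <- theta n) (alpha n0 * iota (antipode (antipode h))).
have XL : lin X by apply: (lin_tsum (t := @theta K O N)); [lin_tac | bilin_tac].
transitivity (\tsum_(h, m0 <- theta m) \tsum_(h1, h2 <- coprod h)
  (iota h1 * X m0 * iota (antipode h2))); last first.
  apply: eq_tlift => h m0; rewrite beta_act coprod_star tsum_tsum; last by bilin_tac.
  rewrite raddf_tlift; last exact: starD.
  apply: eq_tlift => h1 h2; rewrite tsum_tens; last by bilin_tac.
  rewrite !starM !(iota_star cp) star_beta_star starK -antipodeV_star !starK mulrA.
  by [].
rewrite (theta_coact_sum (F := fun a b c => iota a * X c * iota (antipode b)));
  last by trilin_tac.
apply: eq_tlift => h m0.
under eq_tlift => g m00 do rewrite -mulrA mulr_tsuml.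
rewrite -mulr_tsumr; congr (_ * _).
transitivity (\tsum_(g, m00 <- theta m0) \tsum_(k, m000 <- theta m00)
   (alpha m000 * iota (antipode (g * antipode k)))); last first.
  by apply: eq_tlift => g m00; apply: eq_tlift => k n; rewrite antipodeM (iotaM cp) mulrA.
rewrite -(theta_coact_sum (F := fun a b c => alpha c * iota (antipode (a * antipode b))));
  last by trilin_tac.
rewrite -[in LHS](theta_counit m0) (lin_tsumE _ _ alphaL); apply: eq_tlift => g n.
rewrite -(lin_tsumE (g := fun x => alpha n * iota (antipode x))); last by lin_tac.
rewrite antipoder (linZ (f := fun x => alpha n * iota (antipode x))); last by lin_tac.
by rewrite antipode1 (iota1 cp) mulr1 (linZ _ _ alphaL).
Qed.

(** [beta] turns this into [star (star (beta m)) = beta m]. With [gamma_hatE] it says that [gamma]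
    and [gamma_hat] are mutually inverse. *)
Lemma gamma_star_gamma m : star (gamma (star (gamma m))) = m.
Proof. by apply: beta_inj; rewrite -beta_star -beta_star starK. Qed.

Lemma gammaK : cancel (@gamma K O N) (@gamma_hat K O N).
Proof. by move=> m; rewrite gamma_hatE gamma_star_gamma. Qed.

Lemma gamma_hatK : cancel (@gamma_hat K O N) (@gamma K O N).
Proof.
move=> m; rewrite gamma_hatE; apply: (can_inj (@starK _ N)).
exact: gamma_star_gamma.
Qed.

Lemma gammaM m n : gamma (m * n) = gamma m * gamma n.
Proof.
apply: (can_inj (@starK _ N)); apply: beta_inj.
by rewrite -beta_star betaM starM starM betaM !beta_star.
Qed.

Lemma gamma_hatM m n : gamma_hat (m * n) = gamma_hat m * gamma_hat n.
Proof. by apply: (can_inj gammaK); rewrite gammaM !gamma_hatK. Qed.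

Lemma gamma_hat1 : gamma_hat 1 = 1 :> N.
Proof.
rewrite /gamma_hat theta1 tsum_tens; last by bilin_tac.
by rewrite !antipode1 act1.
Qed.

Lemma gamma_hat_act m h : gamma_hat (act m h) = act (gamma_hat m) (antipode (antipode h)).
Proof. by apply: (can_inj gammaK); rewrite gamma_hatK gamma_act gamma_hatK !antipodeK. Qed.

End CrossedProduct.

(** * The Hopf algebroid *)

Section Representatives.
Variables (K : numClosedFieldType) (A : starAlgType K).
Local Notation AA := (A ⊗ A)%type.

Lemma tliftB (U : zmodType) (f : A -> A -> U) (x y : AA) :
  balanced f -> tlift f (x - y) = tlift f x - tlift f y.
Proof. by move=> fB; apply: (addIr (tlift f y)); rewrite -tliftD // !subrK. Qed.

(* The scalar c is there because f need not be homogeneous: DeltaC_star involves star. *)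
Definition kills (G : set AA) (U : zmodType) (f : A -> A -> U) : Prop :=
  forall c g, G g -> tlift f (c *: g) = 0.

(** Two representatives of a class differ by an element of [lspan G], where [f] vanishes. Axioms
    stated for all representatives can therefore be tested on one. *)
Lemma represents_tlift (G : set AA) (U : zmodType) (f : A -> A -> U) s (Z : AA) :
  balanced f -> kills G f -> represents s (qpi Z : quot G) ->
  \sum_(p <- s) f p.1 p.2 = tlift f Z.
Proof.
move=> fB fG /qpiP h.
have f0 v : lspan G v -> tlift f v = 0.
  by elim=> [|c g w Gg _ IH]; rewrite ?tlift0 // tliftD // IH addr0 fG.
have -> : \sum_(p <- s) f p.1 p.2 = tlift f (\sum_(p <- s) p.1 ⊗ p.2).
  rewrite (big_morph _ (tliftD fB) (tlift0 fB)).
  by apply: eq_bigr => p _; rewrite tlift_tens.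
by apply/eqP; rewrite eq_sym -subr_eq0 -tliftB // f0.
Qed.

Lemma kills_relB (B : set A) (tB : A -> A) (U : zmodType) (f : A -> A -> U) :
  balanced f -> (forall a b x, B x -> f (a * x) b = f a (b * tB x)) ->
  kills (relB B tB) f.
Proof.
move=> fB fx c _ [a [b [x [Bx ->]]]].
by rewrite scalerBr -!tensZl scalerAl tliftB // !tlift_tens // fx // subrr.
Qed.

Lemma kills_relC (C : set A) (tC : A -> A) (U : zmodType) (f : A -> A -> U) :
  balanced f -> (forall a b y, C y -> f (tC y * a) b = f a (y * b)) ->
  kills (relC C tC) f.
Proof.
move=> fB fx c _ [a [b [y [Cy ->]]]].
by rewrite scalerBr -!tensZl scalerAr tliftB // !tlift_tens // fx // subrr.
Qed.

Lemma represents_exists (G : set AA) (u : quot G) : exists s, represents s u.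
Proof.
exists (repr (repr u)); rewrite /represents -[LHS]reprK -/(qpi _).
by congr qpi; rewrite [LHS]tensorE.
Qed.

Lemma qpi_relB (B : set A) (tB : A -> A) a b x : B x ->
  qpi ((a * x) ⊗ b) = qpi (a ⊗ (b * tB x)) :> quot (relB B tB).
Proof. by move=> Bx; apply/qpiP; apply: mem_lspan; exists a, b, x. Qed.

Lemma qpi_relC (C : set A) (tC : A -> A) a b y : C y ->
  qpi ((tC y * a) ⊗ b) = qpi (a ⊗ (y * b)) :> quot (relC C tC).
Proof. by move=> Cy; apply/qpiP; apply: mem_lspan; exists a, b, y. Qed.

Definition pairwise_mul (s s' : seq (A * A)) : seq (A * A) :=
  [seq (p.1 * p'.1, p.2 * p'.2) | p <- s, p' <- s'].

Lemma represents_pairwise_mul (G : set AA) s s' :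
  represents (G := G) (pairwise_mul s s')
    (qpi (\sum_(p <- s) \sum_(p' <- s') (p.1 * p'.1) ⊗ (p.2 * p'.2))).
Proof. by rewrite /represents /pairwise_mul big_allpairs_dep. Qed.

Lemma lin_bigsum (V M : lmodType K) (I : Type) (r : seq I) (F : V -> I -> M) :
  (forall i, lin (fun x => F x i)) -> lin (fun x => \sum_(i <- r) F x i).
Proof.
move=> FL c x y; rewrite scaler_sumr -big_split; apply: eq_bigr => i _; exact: FL.
Qed.

(** Rebracketing [(p ⊗ q) ⊗ c] as [p ⊗ (q ⊗ c)] makes the relations [G'] available between the last
    two legs. *)
Lemma represents_tensl (G G' : set AA) s (u : quot G) c : represents s u ->
  tensl G' u c = \sum_(p <- s) tensr G p.1 (qpi (p.2 ⊗ c) : quot G').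
Proof.
move=> ->; rewrite tenslE (lin_sum (f := fun X => qpi (X ⊗ c))); last by lin_tac.
apply: eq_bigr => p _; rewrite tensrE tlift_tens //; exact: tensr_balanced.
Qed.

Lemma represents_tensr (G G' : set AA) s a (u : quot G') : represents s u ->
  tensr G a u = \sum_(p <- s) tensl G' (qpi (a ⊗ p.1) : quot G) p.2.
Proof.
move=> ->; rewrite tensrE.
rewrite (lin_sum (f := fun X => qpi (\tsum_(b, c <- X) (a ⊗ b ⊗ c)))); last by lin_tac.
apply: eq_bigr => p _; rewrite tenslE tlift_tens //; exact: tensr_balanced.
Qed.

Lemma quot_qpi (G : set AA) (u : quot G) : exists Z, u = qpi Z.
Proof. by exists (repr u); rewrite /qpi reprK. Qed.

Lemma lin_tensl_class (G G' : set AA) c : lin (fun u : quot G => tensl G' u c).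
Proof.
move=> k u v; have [X ->] := quot_qpi u; have [Y ->] := quot_qpi v.
by rewrite -lin_qpi !tenslE;
  have /(_ k X Y) : lin (fun Z : AA => qpi (Z ⊗ c) : quot (rel3 G G')) by lin_tac.
Qed.

Lemma lin_tensl_right (G G' : set AA) (u : quot G) : lin (tensl G' u).
Proof.
have [X ->] := quot_qpi u => k x y.
by rewrite !tenslE;
  have /(_ k x y) : lin (fun c => qpi (X ⊗ c) : quot (rel3 G G')) by lin_tac.
Qed.

Lemma lin_tensr_class (G G' : set AA) a : lin (tensr G a : quot G' -> _).
Proof.
move=> k u v; have [X ->] := quot_qpi u; have [Y ->] := quot_qpi v.
by rewrite -lin_qpi !tensrE;
  have /(_ k X Y) : lin (fun Z : AA => qpi (\tsum_(b, c <- Z) (a ⊗ b ⊗ c)) :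
    quot (rel3 G G')) by lin_tac.
Qed.

Lemma lin_tensr_left (G G' : set AA) (u : quot G') : lin (fun a => tensr G a u).
Proof.
have [X ->] := quot_qpi u => k x y.
by rewrite !tensrE;
  have /(_ k x y) : lin (fun a => qpi (\tsum_(b, c <- X) (a ⊗ b ⊗ c)) :
    quot (rel3 G G')) by lin_tac.
Qed.

End Representatives.

#[global] Hint Extern 0 (lin _) => first
  [ eapply lin_tensl_class | eapply lin_tensl_right | eapply lin_tensr_class
  | eapply lin_tensr_left ] : lin_db.

Record crossed_algebroid_spec (K : numClosedFieldType) (O : compactQGType K)
    (N : braidedYDType O) (A : starAlgType K) (iota : O -> A) (alpha : N -> A)
    (beta : N -> A) (D : algebroid_data A) (S epsB epsC : A -> A) : Prop := {
  spec_algB : algB D = range alpha;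
  spec_algC : algC D = range beta;
  spec_tB : forall m, tB D (alpha m) = beta m;
  spec_tC : forall m, tC D (beta m) = alpha (gamma m);
  spec_DeltaB_lin : lin (DeltaB D);
  spec_DeltaB : forall h m, DeltaB D (iota h * alpha m) =
    qpi (\tsum_(h1, h2 <- coprod h) (iota h1 ⊗ (iota h2 * alpha m)));
  spec_DeltaC_lin : lin (DeltaC D);
  spec_DeltaC : forall h m, DeltaC D (iota h * alpha m) =
    qpi (\tsum_(h1, h2 <- coprod h) (iota h1 ⊗ (iota h2 * alpha m)));
  spec_S_lin : lin S;
  spec_S : forall h m, S (iota h * alpha m) = beta (gamma_hat m) * iota (antipode h);
  spec_epsB_lin : lin epsB;
  spec_epsB : forall h m, epsB (alpha m * iota h) = alpha (act m h);
  spec_epsC_lin : lin epsC;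
  spec_epsC : forall h m, epsC (iota h * beta m) = beta (act m (antipode h));
  spec_muB : forall m, muB D (alpha m) = yd_int m;
  spec_muC : forall m, muC D (beta m) = yd_int m;
  spec_psiB_lin : lin (psiB D);
  spec_psiB : forall h m, psiB D (alpha m * iota h) = haar h *: alpha m;
  spec_phiC_lin : lin (phiC D);
  spec_phiC : forall h m, phiC D (iota h * beta m) = haar h *: beta m
}.

Section Algebroid.
Variables (K : numClosedFieldType) (O : compactQGType K) (N : braidedYDType O).
Variables (A : starAlgType K) (iota : O -> A) (alpha : N -> A) (proj : A -> N).
Hypothesis cp : crossed_product iota alpha proj.
Local Notation beta := (crossed_beta iota alpha).
Variables (D : algebroid_data A) (S epsB epsC : A -> A).
Hypothesis spec : crossed_algebroid_spec iota alpha beta D S epsB epsC.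
Implicit Types (h g : O) (m n : N) (M : lmodType K).
Local Notation AA := (A ⊗ A)%type.
Local Notation B := (algB D).
Local Notation C := (algC D).
Local Notation qB := (@qpi _ _ (relB B (tB D))).
Local Notation qC := (@qpi _ _ (relC C (tC D))).

Let iotaL : lin iota := iota_lin cp.
Let alphaL : lin alpha := alpha_lin cp.
Let projL : lin proj := proj_lin cp.
Let betaL : lin beta := lin_beta cp.
Let DeltaBL := spec_DeltaB_lin spec.
Let DeltaCL := spec_DeltaC_lin spec.
Let SL := spec_S_lin spec.
Let epsBL := spec_epsB_lin spec.
Let epsCL := spec_epsC_lin spec.
Let psiBL := spec_psiB_lin spec.
Let phiCL := spec_phiC_lin spec.

Lemma algB_alpha m : B (alpha m).
Proof. by rewrite (spec_algB spec); exists m. Qed.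
Lemma algC_beta m : C (beta m).
Proof. by rewrite (spec_algC spec); exists m. Qed.
Lemma algBP x : B x -> exists m, x = alpha m.
Proof. by rewrite (spec_algB spec) => -[m _ <-]; exists m. Qed.
Lemma algCP y : C y -> exists m, y = beta m.
Proof. by rewrite (spec_algC spec) => -[m _ <-]; exists m. Qed.

(** * Consequences of the common formula for the two comultiplications, for arbitrary relations *)

Section Comultiplication.
Variables (G : set AA) (Delta : A -> quot G).
Local Notation qG := (@qpi _ _ G).
Hypothesis DeltaL : lin Delta.
Hypothesis DeltaE : forall h m, Delta (iota h * alpha m) =
  qpi (\tsum_(h1, h2 <- coprod h) (iota h1 ⊗ (iota h2 * alpha m))).

Lemma comult_sum (U : zmodType) (f : A -> A -> U) s (t : (O ⊗ N)%type) :
  balanced f -> kills G f ->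
  represents s (Delta (\tsum_(h, m <- t) (iota h * alpha m))) ->
  \sum_(p <- s) f p.1 p.2 =
  \tsum_(h, m <- t) \tsum_(h1, h2 <- coprod h) f (iota h1) (iota h2 * alpha m).
Proof.
move=> fB fG; rewrite (lin_tsumE _ _ DeltaL).
under eq_tlift => h m do rewrite DeltaE.
rewrite -(lin_tsumE _ _ (@lin_qpi _ _ G)) => /(represents_tlift fB fG) ->.
rewrite raddf_tlift; last exact: tliftD.
apply: eq_tlift => h m; rewrite raddf_tlift; last exact: tliftD.
by apply: eq_tlift => h1 h2; rewrite tlift_tens.
Qed.

Lemma comult_eval (U : zmodType) (f : A -> A -> U) (g : A -> U) :
  balanced f -> kills G f -> {morph g : x y / x + y} ->
  (forall h m, \tsum_(h1, h2 <- coprod h) f (iota h1) (iota h2 * alpha m) =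
               g (iota h * alpha m)) ->
  forall a s, represents s (Delta a) -> \sum_(p <- s) f p.1 p.2 = g a.
Proof.
move=> fB fG gD fg a s; have [t ->] := crossed_span cp a => sa.
rewrite (comult_sum fB fG sa) raddf_tlift //; exact: eq_tlift.
Qed.

Lemma comult_eq (U : zmodType) (f f' : A -> A -> U) :
  balanced f -> kills G f -> balanced f' -> kills G f' ->
  (forall h m, \tsum_(h1, h2 <- coprod h) f (iota h1) (iota h2 * alpha m) =
               \tsum_(h1, h2 <- coprod h) f' (iota h1) (iota h2 * alpha m)) ->
  forall a s, represents s (Delta a) ->
    \sum_(p <- s) f p.1 p.2 = \sum_(p <- s) f' p.1 p.2.
Proof.
move=> fB fG f'B f'G ff' a s; have [t ->] := crossed_span cp a => sa.
rewrite (comult_sum fB fG sa) (comult_sum f'B f'G sa); exact: eq_tlift.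
Qed.

Lemma comult_iota h : Delta (iota h) = qpi (\tsum_(h1, h2 <- coprod h) (iota h1 ⊗ iota h2)).
Proof.
rewrite -[iota h]mulr1 -(alpha1 cp) DeltaE; congr qpi.
by apply: eq_tlift => *; rewrite (alpha1 cp) mulr1.
Qed.

Lemma comult_alpha m : Delta (alpha m) = qpi (1 ⊗ alpha m).
Proof.
rewrite -[alpha m]mul1r -(iota1 cp) DeltaE coprod1 tsum_tens; last by bilin_tac.
by rewrite (iota1 cp).
Qed.

Lemma comult_beta m :
  Delta (beta m) = qpi (\tsum_(h, m0 <- theta m) (iota h ⊗ beta m0)).
Proof.
rewrite (lin_tsumE _ _ DeltaL).
under eq_tlift => h m0 do rewrite DeltaE.
rewrite -(lin_tsumE _ _ (@lin_qpi _ _ G)); congr qpi.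
rewrite (theta_coact_sum (F := fun a b c => iota a ⊗ (iota b * alpha c)));
  last by trilin_tac.
apply: eq_tlift => h m0; rewrite /crossed_beta (lin_tsumE (g := tens _)) //.
by lin_tac.
Qed.

Lemma comultM_canonical h m g n :
  \tsum_(g1, g2 <- coprod g) \tsum_(h1, h2 <- coprod h)
    qG ((iota h1 * iota g1) ⊗ (iota h2 * alpha m * (iota g2 * alpha n))) =
  Delta (iota h * alpha m * (iota g * alpha n)).
Proof.
rewrite -[iota h * _ * _]mulrA [alpha m * _]mulrA (alpha_iota_comm cp).
rewrite mulr_tsuml mulr_tsumr (lin_tsumE _ _ DeltaL).
transitivity (\tsum_(h1, h2 <- coprod h) \tsum_(g1, g2 <- coprod g)
  \tsum_(g11, g12 <- coprod g1)
     qG (iota (h1 * g11) ⊗ (iota (h2 * g12) * alpha (act m g2 * n)))); last first.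
  rewrite exchange_tlift; apply: eq_tlift => g1 g2.
  rewrite -mulrA -(alphaM cp) mulrA -(iotaM cp) DeltaE.
  rewrite (lin_tsumE (g := qG)); last by lin_tac.
  by rewrite coprod_sumM //; apply: bilin_balanced; bilin_tac.
rewrite [RHS]exchange_tlift.
under [RHS]eq_tlift => g1 g2 do rewrite exchange_tlift.
rewrite (coprod_trisumA (F := fun x y z => \tsum_(h1, h2 <- coprod h)
  qG (iota (h1 * x) ⊗ (iota (h2 * y) * alpha (act m z * n))))); last by trilin_tac.
apply: eq_tlift => g1 g2; rewrite [RHS]exchange_tlift; apply: eq_tlift => h1 h2.
rewrite -[iota h2 * _ * _]mulrA [alpha m * _]mulrA (alpha_iota_comm cp).
rewrite (lin_tsumE (g := fun x => qG ((iota h1 * iota g1) ⊗ (iota h2 * (x * alpha n)))));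
  last by lin_tac.
by apply: eq_tlift => *; rewrite !(iotaM cp) !(alphaM cp) !mulrA.
Qed.

End Comultiplication.

(** * Takeuchi conditions, multiplicativity and the bimodule law *)

Lemma killsB M (f : A -> A -> M) : bilin f ->
  (forall a b m, f (a * alpha m) b = f a (b * beta m)) -> kills (relB B (tB D)) f.
Proof.
move=> fB fx; apply: kills_relB; first exact: bilin_balanced.
by move=> a b _ /algBP[m ->]; rewrite fx (spec_tB spec).
Qed.

Lemma killsC M (f : A -> A -> M) : bilin f ->
  (forall a b m, f (alpha (gamma m) * a) b = f a (beta m * b)) ->
  kills (relC C (tC D)) f.
Proof.
move=> fB fx; apply: kills_relC; first exact: bilin_balanced.
by move=> a b _ /algCP[m ->]; rewrite (spec_tC spec) fx.
Qed.

Lemma qB_move a b m : qB ((a * alpha m) ⊗ b) = qB (a ⊗ (b * beta m)).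
Proof. by rewrite (qpi_relB _ _ _ (algB_alpha m)) (spec_tB spec). Qed.

Lemma qC_move a b m : qC ((alpha (gamma m) * a) ⊗ b) = qC (a ⊗ (beta m * b)).
Proof. by rewrite -(qpi_relC _ _ _ (algC_beta m)) (spec_tC spec). Qed.

Lemma DeltaB_alpha m : DeltaB D (alpha m) = qB (1 ⊗ alpha m).
Proof. exact: comult_alpha (spec_DeltaB spec) m. Qed.

Lemma DeltaC_alpha m : DeltaC D (alpha m) = qC (1 ⊗ alpha m).
Proof. exact: comult_alpha (spec_DeltaC spec) m. Qed.

(** In [iota h ⊗ beta m0] the second leg crosses to the first as [alpha m0], and [iota h * alpha m0]
    sums to [beta m]. *)
Lemma DeltaB_beta m : DeltaB D (beta m) = qB (beta m ⊗ 1).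
Proof.
rewrite (comult_beta DeltaBL (spec_DeltaB spec)) /crossed_beta.
rewrite (lin_tsumE (g := fun x => qB (x ⊗ 1))); last by lin_tac.
rewrite (lin_tsumE (g := qB)); last by lin_tac.
by apply: eq_tlift => h m0; rewrite qB_move mul1r.
Qed.

(** Here [beta m0] crosses as [alpha (gamma m0)] to the left of [iota h], and [beta_from_gamma]
    recognizes [beta m]. *)
Lemma DeltaC_beta m : DeltaC D (beta m) = qC (beta m ⊗ 1).
Proof.
rewrite (comult_beta DeltaCL (spec_DeltaC spec)) (beta_from_gamma cp).
rewrite (lin_tsumE (g := fun x => qC (x ⊗ 1))); last by lin_tac.
rewrite (lin_tsumE (g := qC)); last by lin_tac.
by apply: eq_tlift => h m0; rewrite qC_move mulr1.
Qed.

(* The Takeuchi condition, with the extra factors a and b that are needed for the     *)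
(* componentwise product to be independent of the representatives.                    *)
Lemma DeltaB_takeuchi_mul a b n c s : represents s (DeltaB D c) ->
  \sum_(p <- s) qB ((a * alpha n * p.1) ⊗ (b * p.2)) =
  \sum_(p <- s) qB ((a * p.1) ⊗ (b * beta n * p.2)).
Proof.
apply: (comult_eq DeltaBL (spec_DeltaB spec)
  (f := fun u v => qB ((a * alpha n * u) ⊗ (b * v)))
  (f' := fun u v => qB ((a * u) ⊗ (b * beta n * v)))).
- by apply: bilin_balanced; bilin_tac.
- apply: killsB; first by bilin_tac.
  by move=> u v m; rewrite mulrA qB_move mulrA.
- by apply: bilin_balanced; bilin_tac.
- apply: killsB; first by bilin_tac.
  by move=> u v m; rewrite mulrA qB_move mulrA.
move=> h m.
(* [alpha n] passes [iota h1], crosses the tensor sign as [beta (act n h12)], and recombines with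
   [iota h2] by [beta_iota_comm]. *)
transitivity (\tsum_(h1, h2 <- coprod h) \tsum_(h11, h12 <- coprod h1)
  qB ((a * iota h11) ⊗ (b * (iota h2 * beta (act n h12) * alpha m)))).
  apply: eq_tlift => h1 h2; rewrite -mulrA (alpha_iota_comm cp).
  rewrite (lin_tsumE (g := fun x => qB ((a * x) ⊗ _))); last by lin_tac.
  by apply: eq_tlift => *; rewrite mulrA qB_move -!mulrA (alpha_beta_comm cp).
rewrite (coprod_trisumA (F := fun x y z =>
  qB ((a * iota x) ⊗ (b * (iota z * beta (act n y) * alpha m))))); last by trilin_tac.
apply: eq_tlift => h1 h2.
rewrite -[b * _ * _]mulrA [beta n * _]mulrA (beta_iota_comm cp).
rewrite -(lin_tsumE (g := fun x => qB ((a * iota h1) ⊗ (b * (x * alpha m))))) //.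
by lin_tac.
Qed.

(** The free factors sit on the right because the relations of [C] multiply on the left. The two
    sides match since [gamma (n <| S(h)) = gamma n <| S^-1(h)]. *)
Lemma DeltaC_takeuchi_mul a b n c s : represents s (DeltaC D c) ->
  \sum_(p <- s) qC ((p.1 * alpha (gamma n) * a) ⊗ (p.2 * b)) =
  \sum_(p <- s) qC ((p.1 * a) ⊗ (p.2 * beta n * b)).
Proof.
apply: (comult_eq DeltaCL (spec_DeltaC spec)
  (f := fun u v => qC ((u * alpha (gamma n) * a) ⊗ (v * b)))
  (f' := fun u v => qC ((u * a) ⊗ (v * beta n * b)))).
- by apply: bilin_balanced; bilin_tac.
- apply: killsC; first by bilin_tac.
  by move=> u v m; rewrite -!mulrA qC_move.
- by apply: bilin_balanced; bilin_tac.
- apply: killsC; first by bilin_tac.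
  by move=> u v m; rewrite -!mulrA qC_move.
move=> h m.
transitivity (\tsum_(h1, h2 <- coprod h) \tsum_(h11, h12 <- coprod h1)
  qC ((alpha (act (gamma n) (antipodeV h12)) * (iota h11 * a)) ⊗ (iota h2 * alpha m * b))).
  apply: eq_tlift => h1 h2; rewrite (iota_alpha_comm cp).
  rewrite (lin_tsumE (g := fun x => qC ((x * a) ⊗ _))); last by lin_tac.
  by apply: eq_tlift => *; rewrite mulrA.
rewrite (coprod_trisumA (F := fun x y z =>
  qC ((alpha (act (gamma n) (antipodeV y)) * (iota x * a)) ⊗ (iota z * alpha m * b))));
  last by trilin_tac.
apply: eq_tlift => h1 h2.
rewrite -[X in _ ⊗ (X * b)]mulrA (alpha_beta_comm cp) [iota h2 * _]mulrA (iota_beta_comm cp).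
rewrite (lin_tsumE (g := fun x => qC ((iota h1 * a) ⊗ (x * alpha m * b)))); last by lin_tac.
by apply: eq_tlift => x y; rewrite -!mulrA -qC_move gamma_act antipodeK.
Qed.

(** Canonical representatives are substituted one factor at a time: for [c] this is licensed by the
    Takeuchi condition of [d], and then for [d] it is immediate, as the relations multiply on the
    right. *)
Lemma DeltaBM_represents c d s s' :
  represents s (DeltaB D c) -> represents s' (DeltaB D d) ->
  represents (pairwise_mul s s') (DeltaB D (c * d)).
Proof.
move=> sc sd; rewrite /represents -represents_pairwise_mul.
rewrite (lin_sum _ _ (@lin_qpi _ _ _)).
under eq_bigr => p _ do rewrite (lin_sum _ _ (@lin_qpi _ _ _)).
symmetry.
apply: (comult_eval DeltaBL (spec_DeltaB spec)
  (f := fun u v => \sum_(p' <- s') qB ((u * p'.1) ⊗ (v * p'.2)))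
  (g := fun c => DeltaB D (c * d))) sc.
- by apply: bilin_balanced; split=> ?; apply: lin_bigsum => ?; lin_tac.
- apply: killsB; first by split=> ?; apply: lin_bigsum => ?; lin_tac.
  by move=> u v m; apply: DeltaB_takeuchi_mul sd.
- by apply: linD; lin_tac.
move=> h m.
transitivity (\sum_(p' <- s') \tsum_(h1, h2 <- coprod h)
  qB ((iota h1 * p'.1) ⊗ (iota h2 * alpha m * p'.2))).
  by rewrite /tlift /formal_sum exchange_big.
apply: (comult_eval DeltaBL (spec_DeltaB spec)
  (f := fun u v => \tsum_(h1, h2 <- coprod h)
     qB ((iota h1 * u) ⊗ (iota h2 * alpha m * v)))
  (g := fun d => DeltaB D (iota h * alpha m * d))) sd.
- by apply: bilin_balanced; bilin_tac.
- apply: killsB; first by bilin_tac.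
  by move=> u v n; apply: eq_tlift => h1 h2; rewrite !mulrA qB_move.
- by apply: linD; lin_tac.
by move=> g n; apply: comultM_canonical => //; apply: spec_DeltaB spec.
Qed.

(** The relations now multiply on the left, so the order is opposite: [d] first, by the Takeuchi
    condition of [c]. *)
Lemma DeltaCM_represents c d s s' :
  represents s (DeltaC D c) -> represents s' (DeltaC D d) ->
  represents (pairwise_mul s s') (DeltaC D (c * d)).
Proof.
move=> sc sd; rewrite /represents -represents_pairwise_mul.
rewrite (lin_sum _ _ (@lin_qpi _ _ _)).
under eq_bigr => p _ do rewrite (lin_sum _ _ (@lin_qpi _ _ _)).
rewrite exchange_big; symmetry.
apply: (comult_eval DeltaCL (spec_DeltaC spec)
  (f := fun u v => \sum_(p <- s) qC ((p.1 * u) ⊗ (p.2 * v)))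
  (g := fun d => DeltaC D (c * d))) sd.
- by apply: bilin_balanced; split=> ?; apply: lin_bigsum => ?; lin_tac.
- apply: killsC; first by split=> ?; apply: lin_bigsum => ?; lin_tac.
  move=> u v n; under eq_bigr => p _ do rewrite mulrA.
  by under [RHS]eq_bigr => p _ do rewrite mulrA; apply: DeltaC_takeuchi_mul sc.
- by apply: linD; lin_tac.
move=> g n.
transitivity (\sum_(p <- s) \tsum_(g1, g2 <- coprod g)
  qC ((p.1 * iota g1) ⊗ (p.2 * (iota g2 * alpha n)))).
  by rewrite /tlift /formal_sum exchange_big.
apply: (comult_eval DeltaCL (spec_DeltaC spec)
  (f := fun u v => \tsum_(g1, g2 <- coprod g)
     qC ((u * iota g1) ⊗ (v * (iota g2 * alpha n))))
  (g := fun c => DeltaC D (c * (iota g * alpha n)))) sc.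
- by apply: bilin_balanced; bilin_tac.
- apply: killsC; first by bilin_tac.
  by move=> u v k; apply: eq_tlift => g1 g2; rewrite -!mulrA qC_move.
- by apply: linD; lin_tac.
move=> h m; rewrite exchange_tlift; apply: comultM_canonical => //.
exact: spec_DeltaC spec.
Qed.

Lemma represents_alphaB m : represents [:: (1, alpha m)] (DeltaB D (alpha m)).
Proof. by rewrite /represents big_seq1 DeltaB_alpha. Qed.
Lemma represents_alphaC m : represents [:: (1, alpha m)] (DeltaC D (alpha m)).
Proof. by rewrite /represents big_seq1 DeltaC_alpha. Qed.
Lemma represents_betaB m : represents [:: (beta m, 1)] (DeltaB D (beta m)).
Proof. by rewrite /represents big_seq1 DeltaB_beta. Qed.
Lemma represents_betaC m : represents [:: (beta m, 1)] (DeltaC D (beta m)).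
Proof. by rewrite /represents big_seq1 DeltaC_beta. Qed.

(** Multiplicativity for a product of five factors, four of which have one-term representatives. *)
Lemma bimodule_law (G : set AA) (Delta : A -> quot G) :
  (forall m, represents [:: (1, alpha m)] (Delta (alpha m))) ->
  (forall m, represents [:: (beta m, 1)] (Delta (beta m))) ->
  (forall c d s s', represents s (Delta c) -> represents s' (Delta d) ->
     represents (pairwise_mul s s') (Delta (c * d))) ->
  forall m m' n n' a s, represents s (Delta a) ->
  represents [seq (beta n * p.1 * beta n', alpha m * p.2 * alpha m') | p <- s]
    (Delta (alpha m * beta n * a * alpha m' * beta n')).
Proof.
move=> ra rb rM m m' n n' a s sa.
have := rM _ _ _ _ (rM _ _ _ _ (rM _ _ _ _ (rM _ _ _ _ (ra m) (rb n)) sa) (ra m')) (rb n').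
rewrite /represents => ->; congr qpi; rewrite !big_map.
rewrite /pairwise_mul !big_allpairs_dep /= big_cons big_nil addr0 big_seq1.
by apply: eq_bigr => p _; rewrite !big_seq1 /= mul1r !mulr1.
Qed.

Lemma DeltaB_bimodule m m' n n' a s : represents s (DeltaB D a) ->
  DeltaB D (alpha m * beta n * a * alpha m' * beta n') =
  qB (\sum_(p <- s) (beta n * p.1 * beta n') ⊗ (alpha m * p.2 * alpha m')).
Proof.
move=> sa; have := bimodule_law represents_alphaB represents_betaB DeltaBM_represents
  m m' n n' sa.
by rewrite /represents big_map.
Qed.

Lemma DeltaC_bimodule m m' n n' a s : represents s (DeltaC D a) ->
  DeltaC D (alpha m * beta n * a * alpha m' * beta n') =
  qC (\sum_(p <- s) (beta n * p.1 * beta n') ⊗ (alpha m * p.2 * alpha m')).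
Proof.
move=> sa; have := bimodule_law represents_alphaC represents_betaC DeltaCM_represents
  m m' n n' sa.
by rewrite /represents big_map.
Qed.

(** * Coassociativity, including the mixed laws *)

Section Coassociativity.
Variables (G G' : set AA) (Delta : A -> quot G) (Delta' : A -> quot G').
Hypothesis DeltaL : lin Delta.
Hypothesis DeltaE : forall h m, Delta (iota h * alpha m) =
  qpi (\tsum_(h1, h2 <- coprod h) (iota h1 ⊗ (iota h2 * alpha m))).
Hypothesis Delta'L : lin Delta'.
Hypothesis Delta'E : forall h m, Delta' (iota h * alpha m) =
  qpi (\tsum_(h1, h2 <- coprod h) (iota h1 ⊗ (iota h2 * alpha m))).
Hypothesis killsG' : kills G' (fun b c => tensl G' (Delta b) c).
Hypothesis killsG : kills G (fun b c => tensr G b (Delta' c)).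

(** Once the relations are respected, canonical representatives reduce the law to coassociativity in
    [O]. Keeping [Delta] and [Delta'] independent covers all four laws. *)
Lemma comult_coassoc : coassociative Delta Delta'.
Proof.
move=> a s s'; have [t ->] := crossed_span cp a => sa sa'.
rewrite (comult_sum Delta'L Delta'E (f := fun b c => tensl G' (Delta b) c) _ killsG' sa');
  last by apply: bilin_balanced; bilin_tac.
rewrite (comult_sum DeltaL DeltaE (f := fun b c => tensr G b (Delta' c)) _ killsG sa);
  last by apply: bilin_balanced; bilin_tac.
apply: eq_tlift => h m.
transitivity (\tsum_(h1, h2 <- coprod h) \tsum_(h11, h12 <- coprod h1)
  (qpi (iota h11 ⊗ iota h12 ⊗ (iota h2 * alpha m)) : quot (rel3 G G'))).
  apply: eq_tlift => h1 h2; rewrite (comult_iota DeltaE) tenslE.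
  by rewrite (lin_tsumE (g := fun X => qpi (X ⊗ _))) //; lin_tac.
rewrite (coprod_trisumA (F := fun x y z =>
  (qpi (iota x ⊗ iota y ⊗ (iota z * alpha m)) : quot (rel3 G G')))); last by trilin_tac.
apply: eq_tlift => h1 h2; rewrite Delta'E tensrE.
rewrite (lin_tsumE (g := fun X => qpi (\tsum_(b, c <- X) (iota h1 ⊗ b ⊗ c))));
  last by lin_tac.
by apply: eq_tlift => *; rewrite tsum_tens //; bilin_tac.
Qed.
End Coassociativity.

Section CoassociativityKills.
Variables (G : set AA) (Delta : A -> quot G).
Hypothesis DeltaL : lin Delta.
Hypothesis DeltaM : forall c d s s', represents s (Delta c) -> represents s' (Delta d) ->
  represents (pairwise_mul s s') (Delta (c * d)).
Hypothesis Delta_alpha : forall m, represents [:: (1, alpha m)] (Delta (alpha m)).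
Hypothesis Delta_beta : forall m, represents [:: (beta m, 1)] (Delta (beta m)).

(** [Delta (a * alpha m)] is [Delta a] with [alpha m] multiplied into the second leg, from where it
    crosses to the third as [beta m]. *)
Lemma killsB_tensl : kills (relB B (tB D)) (fun b c => tensl (relB B (tB D)) (Delta b) c).
Proof.
apply: killsB; first by bilin_tac.
move=> a b m; have [s sa] := represents_exists (Delta a).
rewrite (represents_tensl _ _ sa) (represents_tensl _ _ (DeltaM sa (Delta_alpha m))).
rewrite /pairwise_mul big_allpairs_dep; apply: eq_bigr => p _.
by rewrite big_seq1 /= mulr1 qB_move.
Qed.

Lemma killsC_tensl : kills (relC C (tC D)) (fun b c => tensl (relC C (tC D)) (Delta b) c).
Proof.
apply: killsC; first by bilin_tac.
move=> a b m; have [s sa] := represents_exists (Delta a).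
rewrite (represents_tensl _ _ sa) (represents_tensl _ _ (DeltaM (Delta_alpha (gamma m)) sa)).
rewrite /pairwise_mul big_allpairs_dep big_seq1; apply: eq_bigr => p _.
by rewrite /= mul1r qC_move.
Qed.

(** [Delta (b * beta m)] carries [beta m] in its first leg, which is the middle one here, so it
    crosses back to [a] as [alpha m]. *)
Lemma killsB_tensr : kills (relB B (tB D)) (fun b c => tensr (relB B (tB D)) b (Delta c)).
Proof.
apply: killsB; first by bilin_tac.
move=> a b m; have [s sb] := represents_exists (Delta b).
rewrite (represents_tensr _ _ sb) (represents_tensr _ _ (DeltaM sb (Delta_beta m))).
rewrite /pairwise_mul big_allpairs_dep; apply: eq_bigr => p _.
by rewrite big_seq1 /= mulr1 qB_move.
Qed.

Lemma killsC_tensr : kills (relC C (tC D)) (fun b c => tensr (relC C (tC D)) b (Delta c)).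
Proof.
apply: killsC; first by bilin_tac.
move=> a b m; have [s sb] := represents_exists (Delta b).
rewrite (represents_tensr _ _ sb) (represents_tensr _ _ (DeltaM (Delta_beta m) sb)).
rewrite /pairwise_mul big_allpairs_dep big_seq1; apply: eq_bigr => p _.
by rewrite /= mul1r qC_move.
Qed.
End CoassociativityKills.

(** * Involution, counits and antipode *)

Lemma alpha_gamma_star_gamma m : alpha (gamma (star (gamma m))) = star (alpha m).
Proof. by rewrite (alpha_star cp) -[in RHS](gamma_star_gamma cp m) starK. Qed.

(** Taking stars in both legs respects the relations because [beta (star (gamma m))] crosses as
    [alpha (gamma (star (gamma m)))], which is [star (alpha m)]. *)
Lemma DeltaC_star_represents a s : represents s (DeltaB D a) ->
  DeltaC D (star a) = qC (\sum_(p <- s) star p.1 ⊗ star p.2).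
Proof.
move=> sa; rewrite (lin_sum _ _ (@lin_qpi _ _ _)); symmetry.
have fB : balanced (fun u v => qC (star u ⊗ star v)).
  split=> *; rewrite ?starD ?starZ ?tensDl ?tensDr ?tensZl ?tensZr //;
    exact: linD (@lin_qpi _ _ _) _ _.
apply: (comult_eval DeltaBL (spec_DeltaB spec)
  (f := fun u v => qC (star u ⊗ star v)) (g := fun a => DeltaC D (star a))) sa => //.
- apply: kills_relB => // u v _ /algBP[m ->].
  by rewrite (spec_tB spec) !starM (beta_star cp) -qC_move alpha_gamma_star_gamma.
- by move=> x y; rewrite starD (linD DeltaCL).
(* The argument is now [alpha (star m) * iota (star h)], which the bimodule law handles. *)
move=> h m; rewrite starM (alpha_star cp) (iota_star cp).
have := @DeltaC_bimodule (star m) 1 1 1 (iota (star h)).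
have [s' sh] := represents_exists (DeltaC D (iota (star h))).
move=> /(_ _ sh); rewrite (beta1 cp) (alpha1 cp) !mulr1 => ->.
under eq_bigr => p _ do rewrite mul1r !mulr1.
rewrite (lin_sum _ _ (@lin_qpi _ _ _)).
have := sh; rewrite (comult_iota (spec_DeltaC spec)) coprod_star.
rewrite tsum_tsum; last by bilin_tac.
have gB : bilin (fun u v => qC (u ⊗ (alpha (star m) * v))) by bilin_tac.
move=> /(represents_tlift (bilin_balanced gB)) ->; last first.
  apply: killsC => // u v n.
  by rewrite qC_move !mulrA (alpha_beta_comm cp).
rewrite tsum_tsum //; apply: eq_tlift => h1 h2.
by rewrite !tsum_tens ?starM ?(alpha_star cp) ?(iota_star cp) //; bilin_tac.
Qed.

(** With [alpha] moved to the left, the action by [S^-1(h2) h1] collapses. The module laws of [epsB]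
    thereby become those of [proj]. *)
Lemma epsBE a : epsB a = alpha (proj a).
Proof.
move: a; apply: (crossed_ext cp) => [||h m]; try by lin_tac.
rewrite (iota_alpha_comm cp) (lin_tsumE _ _ epsBL).
under eq_tlift => h1 h2 do rewrite (spec_epsB spec) -actA.
rewrite -(lin_tsumE (g := fun x => alpha (act m x))); last by lin_tac.
rewrite antipodeVl -(iota_alpha_comm cp) (proj_iota_alpha cp).
by rewrite (linZ (f := fun x => act m x)) ?act1 //; lin_tac.
Qed.

(** Left invariance of [haar] absorbs the action created by reordering, so the order of the two
    factors does not affect [psiB]. *)
Lemma psiBE h m : psiB D (iota h * alpha m) = haar h *: alpha m.
Proof.
rewrite (iota_alpha_comm cp) (lin_tsumE _ _ psiBL).
pose f g := alpha (act m (antipodeV g)).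
have fL : lin f by rewrite /f; lin_tac.
under eq_tlift => h1 h2 do rewrite (spec_psiB spec) -/(f _) -(linZ _ _ fL).
by rewrite -(lin_tsumE _ _ fL) haarl (linZ _ _ fL) /f antipodeV1 act1.
Qed.

Lemma proj_iotal h a : proj (iota h * a) = counit h *: proj a.
Proof.
move: a; apply: (crossed_ext cp) => [||g m]; try by lin_tac.
by rewrite mulrA -(iotaM cp) !(proj_iota_alpha cp) counitM scalerA.
Qed.

Lemma proj_alphar m a : proj (a * alpha m) = proj a * m.
Proof.
move: a; apply: (crossed_ext cp) => [||g n]; try by lin_tac.
by rewrite -mulrA -(alphaM cp) !(proj_iota_alpha cp) scalerAl.
Qed.

Lemma proj_betar m a : proj (a * beta m) = m * proj a.
Proof.
move: a; apply: (crossed_ext cp) => [||g n]; try by lin_tac.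
rewrite -mulrA (alpha_beta_comm cp) proj_iotal proj_alphar (proj_beta cp).
by rewrite (proj_iota_alpha cp) scalerAr.
Qed.

Lemma S_iota h : S (iota h) = iota (antipode h).
Proof.
by rewrite -[iota h]mulr1 -(alpha1 cp) (spec_S spec) gamma_hat1 (beta1 cp) mul1r.
Qed.

Lemma S_alpha m : S (alpha m) = beta (gamma_hat m).
Proof.
by rewrite -[alpha m]mul1r -(iota1 cp) (spec_S spec) antipode1 (iota1 cp) mulr1.
Qed.

(** Reordering [m] past [g] before applying [S] gives [gamma_hat m <| S^2(g2)]; reordering
    afterwards gives the same, since [antipode] reverses the coproduct. *)
Lemma S_antimul a b : S (a * b) = S b * S a.
Proof.
move: a; apply: (crossed_ext cp) => [||h m]; try by lin_tac.
move: b; apply: (crossed_ext cp) => [||g n]; try by lin_tac.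
rewrite -mulrA [alpha m * _]mulrA (alpha_iota_comm cp) mulr_tsuml mulr_tsumr.
rewrite (lin_tsumE _ _ SL) !(spec_S spec).
rewrite -mulrA [iota (antipode g) * _]mulrA (iota_beta_comm cp) coprod_antipode.
rewrite tsum_tsum; last by bilin_tac.
rewrite [X in _ = _ * X]mulr_tsuml mulr_tsumr; apply: eq_tlift => g1 g2.
rewrite tsum_tens; last by bilin_tac.
rewrite -mulrA -(alphaM cp) mulrA -(iotaM cp) (spec_S spec) (gamma_hatM cp).
by rewrite (betaM cp) (gamma_hat_act cp) antipodeM (iotaM cp) !mulrA.
Qed.

(** Moving [beta] to the right of [iota] makes a coaction leg act through the antipode, and
    [gamma_hat_antipode] then undoes [gamma_hat]. *)
Lemma S_beta m : S (beta m) = alpha m.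
Proof.
rewrite (alpha_from_beta cp) /crossed_beta (lin_tsumE _ _ SL).
transitivity (\tsum_(h, m0 <- theta m) \tsum_(h1, h2 <- coprod h)
  (iota (antipode h1) * beta (act (gamma_hat m0) (antipode h2)))).
  apply: eq_tlift => h m0; rewrite (spec_S spec) (beta_iota_comm cp) coprod_antipode.
  rewrite tsum_tsum; last by bilin_tac.
  by apply: eq_tlift => *; rewrite tsum_tens //; bilin_tac.
rewrite (theta_coact_sum (F := fun a b c =>
  iota (antipode a) * beta (act (gamma_hat c) (antipode b)))); last by trilin_tac.
apply: eq_tlift => h m0; rewrite -[in RHS](gamma_hat_antipode m0).
by rewrite (lin_tsumE (g := fun x => iota (antipode h) * beta x)) //; lin_tac.
Qed.

Lemma S_starK a : S (star (S (star a))) = a.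
Proof.
have [t ->] := crossed_span cp a.
rewrite (raddf_tlift (g := fun a => S (star (S (star a))))); last first.
  by move=> x y; rewrite starD (linD SL) starD (linD SL).
apply: eq_tlift => h m; rewrite starM S_antimul starM S_antimul.
rewrite (alpha_star cp) (iota_star cp) S_alpha S_iota (beta_star cp) (iota_star cp).
by rewrite (gamma_hatK cp) starK S_beta S_iota antipode_star.
Qed.

Lemma beta_span a : exists t : (O ⊗ N)%type, a = \tsum_(h, m <- t) (iota h * beta m).
Proof.
have [t ->] := crossed_span cp a.
exists (\tsum_(h, m <- t) \tsum_(g, m0 <- theta m) ((h * antipode g) ⊗ m0)).
rewrite tsum_tsum; last by bilin_tac.
apply: eq_tlift => h m; rewrite tsum_tsum; last by bilin_tac.
rewrite (alpha_from_beta cp) mulr_tsumr; apply: eq_tlift => g m0.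
rewrite tsum_tens; last by bilin_tac.
by rewrite (iotaM cp) mulrA.
Qed.

Lemma beta_ext (U : zmodType) (f g : A -> U) :
  {morph f : x y / x + y} -> {morph g : x y / x + y} ->
  (forall h m, f (iota h * beta m) = g (iota h * beta m)) -> f =1 g.
Proof.
move=> fD gD fg a; have [t ->] := beta_span a.
by rewrite (raddf_tlift _ _ fD) (raddf_tlift _ _ gD); apply: eq_tlift.
Qed.

Lemma epsC_beta_iota m h : epsC (beta m * iota h) = counit h *: beta m.
Proof.
rewrite (beta_iota_comm cp) (lin_tsumE _ _ epsCL).
under eq_tlift => h1 h2 do rewrite (spec_epsC spec) -actA.
rewrite -(lin_tsumE (g := fun x => beta (act m x))); last by lin_tac.
by rewrite antipoder (linZ (f := fun x => beta (act m x))) ?act1 //; lin_tac.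
Qed.

Lemma epsC_S a : epsC (S a) = S (epsB a).
Proof.
move: a; apply: (crossed_ext cp) => [||h m]; try by lin_tac.
rewrite (spec_S spec) epsC_beta_iota epsBE (proj_iota_alpha cp) counit_antipode.
by rewrite (linZ _ _ alphaL) (linZ _ _ SL) S_alpha.
Qed.

Lemma S_bij : bijective S.
Proof.
exists (fun a => star (S (star a))) => a; last exact: S_starK.
by apply: (can_inj (@starK _ A)); rewrite starK -[X in S (star (S X))]starK S_starK.
Qed.

(** * Assembly of the bialgebroid axioms *)

Lemma set_bij_BC : set_bij B C (tB D).
Proof.
split=> [_ /algBP[m ->]|x y|_ /algCP[m ->]].
- by rewrite (spec_tB spec); apply: algC_beta.
- rewrite !inE => /algBP[m ->] /algBP[n ->]; rewrite !(spec_tB spec).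
  by move=> /(beta_inj cp) ->.
- by exists (alpha m); [apply: algB_alpha | rewrite (spec_tB spec)].
Qed.

Lemma set_bij_CB : set_bij C B (tC D).
Proof.
split=> [_ /algCP[m ->]|x y|_ /algBP[m ->]].
- by rewrite (spec_tC spec); apply: algB_alpha.
- rewrite !inE => /algCP[m ->] /algCP[n ->]; rewrite !(spec_tC spec).
  by move=> /(alpha_inj cp)/(can_inj (gammaK cp)) ->.
- exists (beta (gamma_hat m)); first exact: algC_beta.
  by rewrite (spec_tC spec) (gamma_hatK cp).
Qed.

Lemma algB_subalgebra : star_subalgebra B.
Proof.
split=> [|c _ _ /algBP[m ->] /algBP[n ->]|_ _ /algBP[m ->] /algBP[n ->]|_ /algBP[m ->]].
- by rewrite -(alpha1 cp); apply: algB_alpha.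
- by rewrite -alphaL; apply: algB_alpha.
- by rewrite -(alphaM cp); apply: algB_alpha.
- by rewrite (alpha_star cp); apply: algB_alpha.
Qed.

Lemma algC_subalgebra : star_subalgebra C.
Proof.
split=> [|c _ _ /algCP[m ->] /algCP[n ->]|_ _ /algCP[m ->] /algCP[n ->]|_ /algCP[m ->]].
- by rewrite -(beta1 cp); apply: algC_beta.
- by rewrite -betaL; apply: algC_beta.
- by rewrite -(betaM cp); apply: algC_beta.
- by rewrite (beta_star cp); apply: algC_beta.
Qed.

Lemma tB_anti_isomorphism : anti_isomorphism B C (tB D).
Proof.
split; [move=> c _ _ /algBP[m ->] /algBP[n ->]|exact: set_bij_BC|
  move=> _ _ /algBP[m ->] /algBP[n ->]].
- by rewrite -alphaL !(spec_tB spec) betaL.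
- by rewrite -(alphaM cp) !(spec_tB spec) (betaM cp).
Qed.

Lemma tC_anti_isomorphism : anti_isomorphism C B (tC D).
Proof.
split; [move=> c _ _ /algCP[m ->] /algCP[n ->]|exact: set_bij_CB|
  move=> _ _ /algCP[m ->] /algCP[n ->]].
- by rewrite -betaL !(spec_tC spec) lin_gamma alphaL.
- by rewrite -(betaM cp) !(spec_tC spec) (gammaM cp) (alphaM cp).
Qed.

Lemma crossed_bialgebroid : is_bialgebroid D.
Proof.
have eB := spec_DeltaB spec; have eC := spec_DeltaC spec.
split.
- exact: algB_subalgebra.
- exact: algC_subalgebra.
- by move=> _ _ /algBP[m ->] /algCP[n ->]; apply: alpha_beta_comm cp _ _.
- exact: tB_anti_isomorphism.
- exact: tC_anti_isomorphism.
- move=> _ /algCP[m ->]; rewrite (beta_star cp) (spec_tC spec) (alpha_star cp).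
  by rewrite (spec_tB spec) (gamma_star_gamma cp).
- exact: DeltaBL.
- exact: DeltaCL.
- move=> a s _ sa /algBP[m ->]; have := DeltaB_takeuchi_mul 1 1 m sa.
  rewrite !(lin_sum _ _ (@lin_qpi _ _ _)) (spec_tB spec).
  by under eq_bigr do rewrite !mul1r; under [RHS]eq_bigr do rewrite !mul1r.
- move=> a s _ sa /algCP[m ->]; have := DeltaC_takeuchi_mul 1 1 m sa.
  rewrite !(lin_sum _ _ (@lin_qpi _ _ _)) (spec_tC spec).
  by under eq_bigr do rewrite !mulr1; under [RHS]eq_bigr do rewrite !mulr1.
- by rewrite -(alpha1 cp) DeltaB_alpha (alpha1 cp).
- by rewrite -(alpha1 cp) DeltaC_alpha (alpha1 cp).
- move=> a b s s' sa sb; rewrite (DeltaBM_represents sa sb).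
  by rewrite /pairwise_mul big_allpairs_dep.
- move=> a b s s' sa sb; rewrite (DeltaCM_represents sa sb).
  by rewrite /pairwise_mul big_allpairs_dep.
- move=> _ _ _ _ a s /algBP[m ->] /algBP[m' ->] /algCP[n ->] /algCP[n' ->].
  exact: DeltaB_bimodule.
- move=> _ _ _ _ a s /algBP[m ->] /algBP[m' ->] /algCP[n ->] /algCP[n' ->].
  exact: DeltaC_bimodule.
- apply: comult_coassoc => //.
    exact: killsB_tensl DeltaBL DeltaBM_represents represents_alphaB.
  exact: killsB_tensr DeltaBL DeltaBM_represents represents_betaB.
- apply: comult_coassoc => //.
    exact: killsC_tensl DeltaCL DeltaCM_represents represents_alphaC.
  exact: killsC_tensr DeltaCL DeltaCM_represents represents_betaC.
- apply: comult_coassoc => //.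
    exact: killsB_tensl DeltaCL DeltaCM_represents represents_alphaC.
  exact: killsC_tensr DeltaBL DeltaBM_represents represents_betaB.
- apply: comult_coassoc => //.
    exact: killsC_tensl DeltaBL DeltaBM_represents represents_alphaB.
  exact: killsB_tensr DeltaCL DeltaCM_represents represents_betaC.
- exact: DeltaC_star_represents.
Qed.

(** As [S] is bijective and reverses products, [alpha] on the left is [beta] on the right before [S]
    is applied, where [epsB] is known. *)
Lemma epsC_alphal a m : epsC (alpha (gamma m) * a) = epsC a * beta m.
Proof.
have [S' SK S'K] := S_bij.
rewrite -[a]S'K -S_beta -S_antimul !epsC_S !epsBE proj_betar (alphaM cp) S_antimul.
by rewrite !S_alpha (gammaK cp).
Qed.

Lemma epsC_betal a m : epsC (beta m * a) = beta m * epsC a.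
Proof.
have [S' SK S'K] := S_bij.
rewrite -[a]S'K -{1}[m](gammaK cp) -S_alpha -S_antimul !epsC_S !epsBE proj_alphar.
by rewrite (alphaM cp) S_antimul !S_alpha (gammaK cp).
Qed.

Lemma epsC_algC a : C (epsC a).
Proof.
have [S' SK S'K] := S_bij.
by rewrite -[a]S'K epsC_S epsBE S_alpha; apply: algC_beta.
Qed.

(** A second representative, due to [beta m] comultiplying into the first leg; it suits maps
    prescribed on [iota h * beta m]. *)
Lemma DeltaC_iota_beta h m : DeltaC D (iota h * beta m) =
  qC (\tsum_(h1, h2 <- coprod h) ((iota h1 * beta m) ⊗ iota h2)).
Proof.
have [s sh] := represents_exists (DeltaC D (iota h)).
rewrite (DeltaCM_represents sh (represents_betaC m)) /pairwise_mul big_allpairs_dep.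
under eq_bigr => p _ do rewrite big_seq1 /= mulr1.
have fB : bilin (fun u v => qC ((u * beta m) ⊗ v)) by bilin_tac.
move: sh; rewrite (comult_iota (spec_DeltaC spec)).
move=> /(represents_tlift (bilin_balanced fB)) e.
rewrite (lin_sum _ _ (@lin_qpi _ _ _)) e; last first.
  by apply: killsC => // a b n; rewrite -mulrA qC_move.
rewrite tsum_tsum // (lin_tsumE (g := qC)); last by lin_tac.
by apply: eq_tlift => *; rewrite tsum_tens.
Qed.

Lemma DeltaC_eval_beta (M : lmodType K) (f : A -> A -> M) (g : A -> M) :
  bilin f -> (forall a b m, f (alpha (gamma m) * a) b = f a (beta m * b)) -> lin g ->
  (forall h m, \tsum_(h1, h2 <- coprod h) f (iota h1 * beta m) (iota h2) =
               g (iota h * beta m)) ->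
  forall a s, represents s (DeltaC D a) -> \sum_(p <- s) f p.1 p.2 = g a.
Proof.
move=> fB fC gL fg a s; have [t ->] := beta_span a.
rewrite (lin_tsumE _ _ DeltaCL).
under eq_tlift => h m do rewrite DeltaC_iota_beta.
rewrite -(lin_tsumE _ _ (@lin_qpi _ _ _)).
move=> /(represents_tlift (bilin_balanced fB) (killsC fB fC)) ->.
rewrite tsum_tsum // (lin_tsumE _ _ gL); apply: eq_tlift => h m.
by rewrite tsum_tsum // -fg; apply: eq_tlift => *; rewrite tsum_tens.
Qed.

Lemma DeltaB_eval (M : lmodType K) (f : A -> A -> M) (g : A -> M) :
  bilin f -> (forall a b m, f (a * alpha m) b = f a (b * beta m)) -> lin g ->
  (forall h m, \tsum_(h1, h2 <- coprod h) f (iota h1) (iota h2 * alpha m) =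
               g (iota h * alpha m)) ->
  forall a s, represents s (DeltaB D a) -> \sum_(p <- s) f p.1 p.2 = g a.
Proof.
move=> fB fx gL; apply: (comult_eval DeltaBL (spec_DeltaB spec)) (linD gL).
  exact: bilin_balanced.
exact: killsB.
Qed.

(** [tB] is only prescribed on [B], so linearity is available only after a map with values in
    [B]. *)
Lemma lin_tB_comp (V : lmodType K) (f : V -> A) :
  lin f -> (forall a, B (f a)) -> lin (fun a => tB D (f a)).
Proof.
by move=> fL fB c x y; rewrite fL; apply: (anti_linear tB_anti_isomorphism).
Qed.

Lemma lin_tC_comp (V : lmodType K) (f : V -> A) :
  lin f -> (forall a, C (f a)) -> lin (fun a => tC D (f a)).
Proof.
by move=> fL fC c x y; rewrite fL; apply: (anti_linear tC_anti_isomorphism).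
Qed.

Lemma epsB_algB a : B (epsB a).
Proof. by rewrite epsBE; apply: algB_alpha. Qed.

Lemma tB_epsB a : tB D (epsB a) = beta (proj a).
Proof. by rewrite epsBE (spec_tB spec). Qed.

Lemma DeltaC_eval (M : lmodType K) (f : A -> A -> M) (g : A -> M) :
  bilin f -> (forall a b m, f (alpha (gamma m) * a) b = f a (beta m * b)) -> lin g ->
  (forall h m, \tsum_(h1, h2 <- coprod h) f (iota h1) (iota h2 * alpha m) =
               g (iota h * alpha m)) ->
  forall a s, represents s (DeltaC D a) -> \sum_(p <- s) f p.1 p.2 = g a.
Proof.
move=> fB fx gL; apply: (comult_eval DeltaCL (spec_DeltaC spec)) (linD gL).
  exact: bilin_balanced.
exact: killsC.
Qed.

Lemma epsC_iota_alpha h m :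
  epsC (iota h * alpha m) = beta (act (gamma_hat m) (antipode h)).
Proof.
rewrite (alpha_from_beta cp) mulr_tsumr (lin_tsumE _ _ epsCL) /gamma_hat.
rewrite (lin_tsumE (g := fun x => beta (act x (antipode h)))); last by lin_tac.
apply: eq_tlift => g m0.
by rewrite mulrA -(iotaM cp) (spec_epsC spec) antipodeM actA.
Qed.

Lemma gamma1 : gamma 1 = 1 :> N.
Proof. by rewrite -{1}(@gamma_hat1 _ _ N) (gamma_hatK cp). Qed.

Lemma crossed_antipode_counits : is_antipode_counits D S epsB epsC.
Proof.
have projE := proj_iota_alpha cp.
split.
- split=> [c x y _ _|| x y _ _]; [exact: SL | | exact: S_antimul].
  have [S' SK S'K] := S_bij; split=> // [x y _ _ /(can_inj SK)//|a _].
  by exists (S' a).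
- exact: epsBL.
- exact: epsCL.
- exact: epsB_algB.
- exact: epsC_algC.
- by move=> a _ /algBP[m ->]; rewrite (spec_tB spec) !epsBE proj_betar (alphaM cp).
- by move=> a _ /algBP[m ->]; rewrite !epsBE proj_alphar (alphaM cp).
- by move=> a _ /algCP[m ->]; apply: epsC_betal.
- by move=> a _ /algCP[m ->]; rewrite (spec_tC spec) epsC_alphal.
- move=> _ _ _ _ a /algBP[m ->] /algBP[m' ->] /algCP[n ->] /algCP[n' ->].
  rewrite !(spec_tB spec) !(spec_tC spec) !S_antimul !S_beta !S_alpha !(gammaK cp).
  by rewrite !mulrA -(alpha_beta_comm cp) -!mulrA (alpha_beta_comm cp).
- exact: S_starK.
- have epsBm a b : tB D (epsB (a * alpha b)) = beta b * tB D (epsB a).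
    by rewrite !tB_epsB proj_alphar (betaM cp).
  apply: (DeltaB_eval (f := fun b c => c * tB D (epsB b)) (g := id)) => //.
  + split=> ?; last by lin_tac.
    exact: lin_comp (lin_mulr _) (lin_tB_comp epsBL epsB_algB).
  + by move=> a b m; rewrite epsBm mulrA.
  move=> h m; rewrite -[RHS](coprod_counitl (f := fun h => iota h * alpha m)); last by lin_tac.
  apply: eq_tlift => a b; rewrite tB_epsB -[iota a]mulr1 -(alpha1 cp) projE.
  by rewrite (linZ _ _ betaL) (beta1 cp) -scalerAr mulr1.
- apply: (DeltaB_eval (f := fun b c => b * epsB c) (g := id)) => //.
  + by bilin_tac.
  + by move=> a b m; rewrite !epsBE proj_betar (alphaM cp) mulrA.
  move=> h m; rewrite -[RHS](coprod_counitr (f := fun h => iota h * alpha m)); last by lin_tac.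
  by apply: eq_tlift => a b; rewrite epsBE projE (linZ _ _ alphaL) -scalerAr.
(* On the representative with [beta] in the first leg, this law is [iota_beta_comm]. *)
- apply: (DeltaC_eval_beta (f := fun b c => epsC b * c) (g := id)) => //.
  + by bilin_tac.
  + by move=> a b m; rewrite epsC_alphal mulrA.
  move=> h m.
  under eq_tlift => h1 h2 do rewrite (spec_epsC spec).
  by rewrite -(iota_beta_comm cp).
- apply: (DeltaC_eval_beta (f := fun b c => tC D (epsC c) * b) (g := id)) => //.
  + split=> ?; first by lin_tac.
    exact: lin_comp (lin_mull _) (lin_tC_comp epsCL epsC_algC).
  + move=> a b m; rewrite epsC_betal; have /algCP[n ->] := epsC_algC b.
    by rewrite -(betaM cp) !(spec_tC spec) (gammaM cp) (alphaM cp) mulrA.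
  move=> h m; rewrite -[RHS](coprod_counitr (f := fun h => iota h * beta m)); last by lin_tac.
  apply: eq_tlift => a b; rewrite -[iota b]mulr1 -(beta1 cp) (spec_epsC spec) act_counit.
  rewrite counit_antipode (spec_tC spec) (linZ _ _ (@lin_gamma _ _ _)) (linZ _ _ alphaL).
  by rewrite gamma1 (alpha1 cp) -scalerAl mul1r.
- apply: (DeltaC_eval (f := fun b c => S b * c)) => //.
  + by bilin_tac.
  + by move=> a b m; rewrite S_antimul S_alpha (gammaK cp) mulrA.
  (* The scalar [counit h] is expanded as the sum of [S(h1) h2]. *)
  move=> h m; rewrite epsBE projE (linZ _ _ alphaL) -mulr_algl -(iota1 cp).
  rewrite -(linZ _ _ iotaL) -antipodel (lin_tsumE _ _ iotaL) mulr_tsuml.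
  by apply: eq_tlift => a b; rewrite S_iota mulrA -(iotaM cp).
- apply: (DeltaB_eval (f := fun b c => b * S c)) => //.
  + by bilin_tac.
  + by move=> a b m; rewrite S_antimul S_beta mulrA.
  move=> h m; rewrite epsC_iota_alpha (beta_act_antipode cp).
  by apply: eq_tlift => a b; rewrite (spec_S spec) mulrA.
Qed.

(** * Partial integrals and the two total functionals *)

Lemma phiC_beta_iota m h : phiC D (beta m * iota h) = haar h *: beta m.
Proof.
pose f g := beta (act m g).
have fL : lin f by rewrite /f; lin_tac.
rewrite (beta_iota_comm cp) (lin_tsumE _ _ phiCL).
under eq_tlift => h1 h2 do rewrite (spec_phiC spec) -/(f _) -(linZ _ _ fL).
by rewrite -(lin_tsumE _ _ fL) haarr (linZ _ _ fL) /f act1.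
Qed.

Lemma alpha_iota_span a :
  exists t : (O ⊗ N)%type, a = \tsum_(h, m <- t) (alpha m * iota h).
Proof.
have [t ->] := crossed_span cp a.
exists (\tsum_(h, m <- t) \tsum_(h1, h2 <- coprod h) (h1 ⊗ act m (antipodeV h2))).
rewrite tsum_tsum; last by bilin_tac.
apply: eq_tlift => h m; rewrite tsum_tsum; last by bilin_tac.
rewrite (iota_alpha_comm cp); apply: eq_tlift => h1 h2.
by rewrite tsum_tens //; bilin_tac.
Qed.

Lemma beta_iota_span a :
  exists t : (O ⊗ N)%type, a = \tsum_(h, m <- t) (beta m * iota h).
Proof.
have [t ->] := beta_span a.
exists (\tsum_(h, m <- t) \tsum_(h1, h2 <- coprod h) (h2 ⊗ act m (antipode h1))).
rewrite tsum_tsum; last by bilin_tac.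
apply: eq_tlift => h m; rewrite tsum_tsum; last by bilin_tac.
rewrite (iota_beta_comm cp); apply: eq_tlift => h1 h2.
by rewrite tsum_tens //; bilin_tac.
Qed.

Lemma psiB_algB a : B (psiB D a).
Proof.
have [t ->] := alpha_iota_span a; rewrite (lin_tsumE _ _ psiBL).
under eq_tlift => h m do rewrite (spec_psiB spec) -(linZ _ _ alphaL).
by rewrite -(lin_tsumE _ _ alphaL); apply: algB_alpha.
Qed.

Lemma phiC_algC a : C (phiC D a).
Proof.
have [t ->] := beta_iota_span a; rewrite (lin_tsumE _ _ phiCL).
under eq_tlift => h m do rewrite phiC_beta_iota -(linZ _ _ betaL).
by rewrite -(lin_tsumE _ _ betaL); apply: algC_beta.
Qed.

Lemma psiB_alphal m a : psiB D (alpha m * a) = alpha m * psiB D a.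
Proof.
have [t ->] := alpha_iota_span a; rewrite mulr_tsumr !(lin_tsumE _ _ psiBL) mulr_tsumr.
apply: eq_tlift => h n.
by rewrite mulrA -(alphaM cp) !(spec_psiB spec) (alphaM cp) scalerAr.
Qed.

Lemma psiB_alphar m a : psiB D (a * alpha m) = psiB D a * alpha m.
Proof.
have [t ->] := crossed_span cp a; rewrite mulr_tsuml !(lin_tsumE _ _ psiBL) mulr_tsuml.
apply: eq_tlift => h n.
by rewrite -mulrA -(alphaM cp) !psiBE (alphaM cp) scalerAl.
Qed.

Lemma phiC_betal m a : phiC D (beta m * a) = beta m * phiC D a.
Proof.
have [t ->] := beta_iota_span a.
rewrite [in LHS]mulr_tsumr !(lin_tsumE _ _ phiCL) [in RHS]mulr_tsumr.
apply: eq_tlift => h n.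
by rewrite mulrA -(betaM cp) !phiC_beta_iota (betaM cp) scalerAr.
Qed.

Lemma phiC_betar m a : phiC D (a * beta m) = phiC D a * beta m.
Proof.
have [t ->] := beta_span a.
rewrite [in LHS]mulr_tsuml !(lin_tsumE _ _ phiCL) [in RHS]mulr_tsuml.
apply: eq_tlift => h n.
by rewrite -mulrA -(betaM cp) !(spec_phiC spec) (betaM cp) scalerAl.
Qed.

Lemma muBE x : B x -> muB D x = yd_int (proj x).
Proof. by move=> /algBP[m ->]; rewrite (spec_muB spec) (proj_alpha cp). Qed.

Lemma muCE y : C y -> muC D y = yd_int (proj y).
Proof. by move=> /algCP[m ->]; rewrite (spec_muC spec) (proj_beta cp). Qed.

(** The modular automorphism rewrites [yd_int (n * m)] as [yd_int (m * gamma n)], so one-sided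
    vanishing becomes two-sided. *)
Lemma yd_int_faithfull m : (forall n, yd_int (m * n) = 0) -> m = 0.
Proof.
move=> m0; apply: (@yd_int_faithful K O N) => // n _.
by rewrite (yd_int_gammar n m) !m0.
Qed.

Lemma yd_int_faithfulr m : (forall n, yd_int (n * m) = 0) -> m = 0.
Proof.
move=> m0; apply: yd_int_faithfull => n.
by rewrite -(gamma_hatK cp n) -yd_int_gammar m0.
Qed.

(** The product is [beta (star (gamma n) * m)], and the modular property returns the left factor to
    the right as [star n]. Positivity on [C] thus reduces to that of [yd_int]. *)
Lemma muC_beta_star m n : muC D (beta m * star (beta n)) = yd_int (m * star n).
Proof.
rewrite (beta_star cp) -(betaM cp) (spec_muC spec) yd_int_gammar.
by rewrite -[in RHS](gamma_star_gamma cp n) starK.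
Qed.

Lemma haar_form : positive_form (fun h g : O => haar (h * star g)).
Proof.
split=> *; rewrite ?starD ?starZ ?mulrDl ?mulrDr -?scalerAl -?scalerAr.
- exact: linD (@lin_haar _ O) _ _.
- exact: linD (@lin_haar _ O) _ _.
- exact: linZ (@lin_haar _ O).
- exact: linZ (@lin_haar _ O).
- exact: haar_ge0.
Qed.

Lemma yd_int_form : positive_form (fun m n : N => yd_int (m * star n)).
Proof.
split=> *; rewrite ?starD ?starZ ?mulrDl ?mulrDr -?scalerAl -?scalerAr.
- exact: linD (@lin_yd_int _ _ N) _ _.
- exact: linD (@lin_yd_int _ _ N) _ _.
- exact: linZ (@lin_yd_int _ _ N).
- exact: linZ (@lin_yd_int _ _ N).
- exact: yd_int_ge0.
Qed.

(** By [tensor_kernel] the first legs can be taken orthogonal to all [g], hence zero by faithfulness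
    of [haar]. *)
Lemma tensor_haar_kernel (t : (O ⊗ N)%type) :
  (forall g, \tsum_(h, m <- t) (haar (h * g) *: m) = 0) -> t = 0.
Proof.
move=> t0; pose Phi : set (O -> K^o) := [set f | exists g, f = fun h => haar (h * g)].
have [_ [g ->]|_ [g ->]|s -> s0] := @tensor_kernel _ _ _ Phi t; first by lin_tac.
  exact: t0.
rewrite big1_seq // => p /= ps; rewrite (@haar_faithfull K O p.1).
  exact: lin0 (lin_tensl _).
by move=> g; apply: (s0 (fun h => haar (h * g))) ps; exists g.
Qed.

Definition crossed_psi a : K := muB D (psiB D a).
Definition crossed_phi a : K := muC D (phiC D a).

(** [muB] is prescribed on [B] only; [yd_int] after [proj] is a linear extension to [A]. *)
Lemma crossed_psiE a : crossed_psi a = yd_int (proj (psiB D a)).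
Proof. exact/muBE/psiB_algB. Qed.

Lemma crossed_phiE a : crossed_phi a = yd_int (proj (phiC D a)).
Proof. exact/muCE/phiC_algC. Qed.

Lemma lin_crossed_psi : lin (crossed_psi : A -> K^o).
Proof.
have L : lin (fun a => yd_int (proj (psiB D a)) : K^o) by lin_tac.
by move=> c x y; rewrite !crossed_psiE; apply: L.
Qed.

Lemma lin_crossed_phi : lin (crossed_phi : A -> K^o).
Proof.
have L : lin (fun a => yd_int (proj (phiC D a)) : K^o) by lin_tac.
by move=> c x y; rewrite !crossed_phiE; apply: L.
Qed.

Lemma crossed_psi_functional : positive_faithful_functional setT crossed_psi.
Proof.
split=> [c x y _ _|a _|a _ a0]; first exact: lin_crossed_psi.
  have [t ->] := alpha_iota_span a.
  rewrite (_ : crossed_psi _ = tensor_form (fun h g => haar (h * star g))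
    (fun m n => yd_int (m * star n)) t t).
    exact: tensor_form_ge0 haar_form yd_int_form t.
  rewrite mulr_tsuml (lin_tsumE _ _ lin_crossed_psi); apply: eq_tlift => h m.
  rewrite [star _]raddf_tlift; last exact: starD.
  rewrite mulr_tsumr (lin_tsumE _ _ lin_crossed_psi); apply: eq_tlift => g n.
  rewrite starM (alpha_star cp) (iota_star cp) mulrA -[alpha m * _ * _]mulrA -(iotaM cp).
  rewrite /crossed_psi psiB_alphar (spec_psiB spec) -scalerAl -(alphaM cp) -(linZ _ _ alphaL).
  by rewrite (spec_muB spec) (linZ _ _ (@lin_yd_int _ _ N)).
have [t at_] := alpha_iota_span a.
suff t0 : t = 0 by rewrite at_ t0 tlift0 //; apply: bilin_balanced; bilin_tac.
(* Against [iota g * alpha n] the functional gives the sum of [haar (h g) yd_int (m n)];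
   faithfulness removes [n], then [g]. *)
apply: tensor_haar_kernel => g; apply: yd_int_faithfull => n.
have [+ _] := a0 (iota g * alpha n) I; rewrite at_ mulr_tsuml (lin_tsumE _ _ lin_crossed_psi) => <-.
rewrite mulr_tsuml (lin_tsumE _ _ (@lin_yd_int _ _ N)); apply: eq_tlift => h m.
rewrite mulrA -[alpha m * _ * _]mulrA -(iotaM cp) /crossed_psi psiB_alphar (spec_psiB spec).
by rewrite -!scalerAl -(alphaM cp) -(linZ _ _ alphaL) (spec_muB spec).
Qed.

Lemma crossed_phi_functional : positive_faithful_functional setT crossed_phi.
Proof.
split=> [c x y _ _|a _|a _ a0]; first exact: lin_crossed_phi.
  have [t ->] := beta_iota_span a.
  rewrite (_ : crossed_phi _ = tensor_form (fun h g => haar (h * star g))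
    (fun m n => yd_int (m * star n)) t t).
    exact: tensor_form_ge0 haar_form yd_int_form t.
  rewrite [X in crossed_phi X]mulr_tsuml (lin_tsumE _ _ lin_crossed_phi); apply: eq_tlift => h m.
  rewrite [star _]raddf_tlift; last exact: starD.
  rewrite [X in crossed_phi X]mulr_tsumr (lin_tsumE _ _ lin_crossed_phi); apply: eq_tlift => g n.
  rewrite starM (iota_star cp) mulrA -[beta m * _ * _]mulrA -(iotaM cp).
  rewrite /crossed_phi (beta_star cp) phiC_betar phiC_beta_iota -scalerAl -(betaM cp).
  rewrite -(linZ _ _ betaL) (spec_muC spec) (linZ _ _ (@lin_yd_int _ _ N)).
  by rewrite -muC_beta_star (beta_star cp) -(betaM cp) (spec_muC spec).
have [t at_] := beta_iota_span a.
suff t0 : t = 0 by rewrite at_ t0 tlift0 //; apply: bilin_balanced; bilin_tac.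
(* [beta] reverses products, so the second factor is [yd_int (n m)], whence faithfulness from the
   other side. *)
apply: tensor_haar_kernel => g; apply: yd_int_faithfulr => n.
have [+ _] := a0 (iota g * beta n) I.
rewrite at_ [X in crossed_phi X]mulr_tsuml (lin_tsumE _ _ lin_crossed_phi) => <-.
rewrite mulr_tsumr (lin_tsumE _ _ (@lin_yd_int _ _ N)); apply: eq_tlift => h m.
rewrite mulrA -[beta m * _ * _]mulrA -(iotaM cp) /crossed_phi phiC_betar phiC_beta_iota.
by rewrite -scalerAl -scalerAr -(betaM cp) -(linZ _ _ betaL) (spec_muC spec).
Qed.

Lemma crossed_measured : is_measured D epsB epsC.
Proof.
have tBM := antiM tB_anti_isomorphism; have tCM := antiM tC_anti_isomorphism.
split.
- exact: psiBL.
- exact: phiCL.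
- exact: psiB_algB.
- exact: phiC_algC.
- by move=> _ _ a /algBP[m ->] /algBP[n ->]; rewrite psiB_alphar psiB_alphal.
- by move=> _ _ a /algCP[m ->] /algCP[n ->]; rewrite phiC_betar phiC_betal.
- split=> [c _ _ /algBP[m ->] /algBP[n ->]|_ /algBP[m ->]|_ /algBP[m ->] m0].
  + by rewrite -alphaL !(spec_muB spec); apply: lin_yd_int.
  + by rewrite (alpha_star cp) -(alphaM cp) (spec_muB spec); apply: yd_int_ge0.
  + rewrite (yd_int_faithfull (m := m)) ?(lin0 alphaL) // => n.
    by have [+ _] := m0 _ (algB_alpha n); rewrite -(alphaM cp) (spec_muB spec).
- split=> [c _ _ /algCP[m ->] /algCP[n ->]|_ /algCP[m ->]|_ /algCP[m ->] m0].
  + by rewrite -betaL !(spec_muC spec); apply: lin_yd_int.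
  + by rewrite muC_beta_star; apply: yd_int_ge0.
  + rewrite (yd_int_faithfull (m := m)) ?(lin0 betaL) // => n.
    (* [beta n * beta m] is [beta (m * n)], so the second half of the hypothesis gives
       [yd_int (m * n) = 0]. *)
    by have [_ +] := m0 _ (algC_beta n); rewrite -(betaM cp) (spec_muC spec).
- have [m m0] := @yd_int_neq0 K O N; exists (alpha m); first exact: algB_alpha.
  by rewrite (spec_muB spec).
- have [m m0] := @yd_int_neq0 K O N; exists (beta m); first exact: algC_beta.
  by rewrite (spec_muC spec).
- apply: (DeltaB_eval (f := fun b c => c * tB D (psiB D b)) _ _ psiBL).
  + split=> ?; last by lin_tac.
    exact: lin_comp (lin_mulr _) (lin_tB_comp psiBL psiB_algB).
  + move=> a b m; rewrite psiB_alphar tBM ?(spec_tB spec) ?mulrA //.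
      exact: psiB_algB.
    exact: algB_alpha.
  (* [psiB (iota h1)] is the scalar [haar h1], so the law is left invariance of [haar]. *)
  move=> h m; rewrite psiBE -mulr_algl -(iota1 cp) -(linZ _ _ iotaL) -haarl.
  rewrite (lin_tsumE _ _ iotaL) mulr_tsuml; apply: eq_tlift => h1 h2.
  rewrite -[iota h1]mulr1 -(alpha1 cp) psiBE -(linZ _ _ alphaL) (spec_tB spec).
  by rewrite (linZ _ _ betaL) (beta1 cp) (linZ _ _ iotaL) -scalerAl -scalerAr mulr1.
- apply: (DeltaC_eval_beta (f := fun b c => tC D (phiC D c) * b) _ _ phiCL).
  + split=> ?; first by lin_tac.
    exact: lin_comp (lin_mull _) (lin_tC_comp phiCL phiC_algC).
  + move=> a b m; rewrite phiC_betal tCM ?(spec_tC spec) ?mulrA //.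
      exact: algC_beta.
    exact: phiC_algC.
  move=> h m; rewrite (spec_phiC spec) -mulr_algl -(iota1 cp) -(linZ _ _ iotaL) -haarr.
  rewrite (lin_tsumE _ _ iotaL) [in RHS]mulr_tsuml; apply: eq_tlift => h1 h2.
  rewrite -[iota h2]mulr1 -(beta1 cp) (spec_phiC spec) -(linZ _ _ betaL) (spec_tC spec).
  rewrite (linZ _ _ (@lin_gamma _ _ _)) gamma1 (linZ _ _ alphaL) (alpha1 cp).
  by rewrite -scalerAl mul1r (linZ _ _ iotaL) -scalerAl.
- by move=> _ /algCP[m ->]; rewrite (spec_tC spec) (spec_muB spec) (spec_muC spec) yd_int_gamma.
- by move=> _ /algBP[m ->]; rewrite (spec_tB spec) (spec_muB spec) (spec_muC spec).
- move=> a; rewrite muBE; last exact: epsB_algB.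
  rewrite muCE; last exact: epsC_algC.
  move: a; apply: beta_ext => [||h m].
  + by apply: (linD (M := K^o) (f := fun a => yd_int (proj (epsB a)) : K^o)); lin_tac.
  + by apply: (linD (M := K^o) (f := fun a => yd_int (proj (epsC a)) : K^o)); lin_tac.
  (* Both sides are [counit h * yd_int m], the second by invariance of [yd_int] under the action. *)
  rewrite epsBE (spec_epsC spec) (proj_alpha cp) proj_iotal !(proj_beta cp).
  by rewrite yd_int_act counit_antipode (linZ _ _ (@lin_yd_int _ _ N)).
- exact: crossed_psi_functional.
- exact: crossed_phi_functional.
Qed.

End Algebroid.

(** * The smash product *)

Section SmashProduct.
Variables (K : numClosedFieldType) (O : compactQGType K) (N : braidedYDType O).
Local Notation A := (smash N).
Local Notation alpha := (@smash_alpha K O N).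
Local Notation iota := (@smash_iota K O N).
Local Notation beta := (@smash_beta K O N).

Definition smash_proj (x : A) : N := \tsum_(h, m <- x) (counit h *: m).

Lemma tsum_smash (M : lmodType K) (f : O -> N -> M) h m :
  bilin f -> tlift f (h \# m) = f h m.
Proof. exact: tsum_tens. Qed.

Lemma smash_crossed_product : crossed_product iota alpha smash_proj.
Proof.
split.
- by move=> c x y; rewrite Defs.iotaD Defs.iotaZ.
- by move=> c x y; rewrite alphaD alphaZ.
- by apply: (tlift_lin (V := O) (W := N)); bilin_tac.
- by [].
- by [].
- exact: Defs.iotaM.
- exact: Defs.alphaM.
- by move=> h; rewrite [LHS]smash_starE star1; apply: mul1r.
- by move=> m; rewrite [LHS]smash_starE star1; apply: mulr1.
- by move=> m h; rewrite alpha_iota; apply: eq_tlift => *; rewrite Defs.iota_alpha.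
- move=> x; exists x; rewrite [LHS](tensorE (x : (O ⊗ N)%type)).
  by apply: eq_tlift => *; rewrite Defs.iota_alpha.
- by move=> h m; rewrite Defs.iota_alpha /smash_proj tsum_smash //; bilin_tac.
Qed.
Let cp := smash_crossed_product.
Let iotaL : lin iota := iota_lin cp.
Let alphaL : lin alpha := alpha_lin cp.
Let projL : lin smash_proj := proj_lin cp.

Lemma smash_betaE : beta = crossed_beta iota alpha.
Proof.
by apply/funext => m; apply: eq_tlift => h m0; rewrite Defs.iota_alpha.
Qed.

Lemma lin_smash_beta : lin beta.
Proof. by rewrite smash_betaE; apply: lin_beta cp. Qed.
Let betaL := lin_smash_beta.

Lemma smash_crossed_spec (D : algebroid_data A) (S epsB epsC : A -> A) :
  smash_algebroid_spec D S epsB epsC ->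
  crossed_algebroid_spec iota alpha (crossed_beta iota alpha) D S epsB epsC.
Proof.
rewrite -smash_betaE => sp; have ia := @Defs.iota_alpha K O N.
split; try by case: sp.
- move=> h m; rewrite ia (smash_DeltaB sp); congr qpi.
  by apply: eq_tlift => h1 h2; rewrite ia.
- move=> h m; rewrite ia (smash_DeltaC sp); congr qpi.
  by apply: eq_tlift => h1 h2; rewrite ia.
- by move=> h m; rewrite ia (smash_S sp).
Qed.

Lemma measured_with (D : algebroid_data A) (S epsB epsC : A -> A) :
  smash_algebroid_spec D S epsB epsC ->
  measured_hopf_star_algebroid_with D S epsB epsC.
Proof.
move=> /smash_crossed_spec sp; split.
- refine (crossed_bialgebroid cp sp).
- refine (crossed_antipode_counits cp sp).
- refine (crossed_measured cp sp).
Qed.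

(** * Structure maps on the smash product with the prescribed values *)

Let comult_smash (G : set (A ⊗ A)%type) (a : A) : quot G :=
  \tsum_(h, m <- a) qpi (\tsum_(h1, h2 <- coprod h) ((h1 \# (1 : N)) ⊗ (h2 \# m))).

Let comult_bilin (G : set (A ⊗ A)%type) : bilin (fun h m =>
  qpi (\tsum_(h1, h2 <- coprod h) ((h1 \# (1 : N)) ⊗ (h2 \# m))) : quot G).
Proof.
have smashl m : lin (fun h : O => h \# m) by move=> c x y; rewrite smashDl smashZl.
have smashr h : lin (fun m : N => h \# m) by move=> c x y; rewrite smashDr smashZr.
by bilin_tac.
Qed.

(** [smash_proj] inverts both [alpha] and [beta], so composing with it extends maps prescribed on
    [B] or [C]; one functional [mu_smash] can therefore serve as [muB] and [muC]. *)
Let tB_smash (a : A) : A := beta (smash_proj a).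
Let tC_smash (a : A) : A := alpha (gamma (smash_proj a)).
Let S_smash (a : A) : A := \tsum_(h, m <- a) (beta (gamma_hat m) * iota (antipode h)).
Let epsB_smash (a : A) : A := alpha (smash_proj a).
Let epsC_smash (a : A) : A := \tsum_(h, m <- a) beta (act (gamma_hat m) (antipode h)).
Let mu_smash (a : A) : K := yd_int (smash_proj a).
Let psiB_smash (a : A) : A := \tsum_(h, m <- a) (haar h *: alpha m).
(** By [alpha_from_beta], [h \# m] is the sum of [iota (h * antipode g) * beta m0], which forces
    this value. *)
Let phiC_smash (a : A) : A :=
  \tsum_(h, m <- a) \tsum_(g, m0 <- theta m) (haar (h * antipode g) *: beta m0).

Let D_smash : algebroid_data A :=
  AlgebroidData (algB := range alpha) (algC := range beta) (tB := tB_smash) (tC := tC_smash)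
    (@comult_smash _) (@comult_smash _) mu_smash mu_smash psiB_smash phiC_smash.

(** Several values are prescribed on products that span [A] without being pure tensors. The maps are
    defined on [h \# m], and those values are recovered by expanding the products. *)
Lemma smash_algebroid_exists : exists (D : algebroid_data A) (S epsB epsC : A -> A),
  smash_algebroid_spec D S epsB epsC.
Proof.
have proj_beta m : smash_proj (beta m) = m by rewrite smash_betaE (proj_beta cp).
have iota_beta h m : iota h * beta m = \tsum_(g, m0 <- theta m) ((h * g) \# m0).
  rewrite smash_betaE mulr_tsumr; apply: eq_tlift => g m0.
  by rewrite mulrA -Defs.iotaM Defs.iota_alpha.
have linA (M : lmodType K) (f : O -> N -> M) : bilin f -> lin (fun a : A => tlift f a).
  exact: tlift_lin.
exists D_smash, S_smash, epsB_smash, epsC_smash; split=> //=.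
- by move=> m; rewrite /tB_smash (proj_alpha cp).
- by move=> m; rewrite /tC_smash proj_beta.
- exact: linA (comult_bilin _).
- by move=> h m; rewrite /comult_smash tsum_smash //; apply: comult_bilin.
- exact: linA (comult_bilin _).
- by move=> h m; rewrite /comult_smash tsum_smash //; apply: comult_bilin.
- by apply: linA; bilin_tac.
- by move=> h m; rewrite /S_smash tsum_smash //; bilin_tac.
- by rewrite /epsB_smash => c x y; rewrite projL alphaL.
- move=> h m; rewrite /epsB_smash alpha_iota (lin_tsumE _ _ projL).
  congr alpha; rewrite -[RHS](coprod_counitl (f := fun h => act m h)); last by lin_tac.
  by apply: eq_tlift => h1 h2; rewrite /smash_proj tsum_smash //; bilin_tac.
- by apply: linA; bilin_tac.
- move=> h m; rewrite iota_beta /epsC_smash.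
  rewrite (lin_tsumE (g := fun a : A => tlift _ a)); last by apply: linA; bilin_tac.
  rewrite -[in RHS](gamma_hat_antipode m).
  rewrite (lin_tsumE (g := fun x => beta (act x (antipode h)))); last by lin_tac.
  apply: eq_tlift => g m0; rewrite tsum_smash; last by bilin_tac.
  by rewrite antipodeM actA.
- by move=> m; rewrite /mu_smash (proj_alpha cp).
- by move=> m; rewrite /mu_smash proj_beta.
- by apply: linA; bilin_tac.
- move=> h m; rewrite alpha_iota /psiB_smash.
  rewrite (lin_tsumE (g := fun a : A => tlift _ a)); last by apply: linA; bilin_tac.
  pose f g := alpha (act m g); have fL : lin f by rewrite /f; lin_tac.
  transitivity (\tsum_(h1, h2 <- coprod h) f (haar h1 *: h2)).
    by apply: eq_tlift => *; rewrite tsum_smash ?(linZ _ _ fL) //; bilin_tac.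
  by rewrite -(lin_tsumE _ _ fL) haarl (linZ _ _ fL) /f act1.
- by apply: linA; bilin_tac.
- move=> h m; rewrite iota_beta /phiC_smash.
  rewrite (lin_tsumE (g := fun a : A => tlift _ a)); last by apply: linA; bilin_tac.
  transitivity (\tsum_(g, m0 <- theta m) \tsum_(k, m00 <- theta m0)
    (haar (h * (g * antipode k)) *: beta m00)).
    apply: eq_tlift => g m0; rewrite tsum_smash; last by bilin_tac.
    by apply: eq_tlift => *; rewrite mulrA.
  (* The two coactions become one coproduct, so that [a S(b)] collapses. *)
  rewrite -(theta_coact_sum (F := fun a b c => haar (h * (a * antipode b)) *: beta c));
    last by trilin_tac.
  rewrite -[in RHS](theta_counit m) (lin_tsumE _ _ betaL) (lin_tsumE (g := *:%R _)); last by lin_tac.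
  apply: eq_tlift => g m0.
  rewrite -(lin_tsumE (g := fun x => haar (h * x) *: beta m0)); last by lin_tac.
  rewrite antipoder (linZ (f := fun x => haar (h * x) *: beta m0)); last by lin_tac.
  by rewrite mulr1 (linZ _ _ betaL) scalerA mulrC -scalerA.
Qed.

End SmashProduct.

(** Values prescribed on spanning families could conflict; the first half rules this out and so
    keeps the second from being vacuous. *)
Theorem theorem4p5 (R : realType) (O : compactQGType R[i]) (N : braidedYDType O) :
  (exists (D : algebroid_data (smash N)) (S epsB epsC : smash N -> smash N),
     smash_algebroid_spec D S epsB epsC) /\
  (forall (D : algebroid_data (smash N)) (S epsB epsC : smash N -> smash N),
     smash_algebroid_spec D S epsB epsC ->
     measured_hopf_star_algebroid D /\
     measured_hopf_star_algebroid_with D S epsB epsC).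
Proof.
split=> [|D S epsB epsC sp]; first exact: smash_algebroid_exists.
have h := measured_with sp; split=> //; by exists S, epsB, epsC.
Qed.
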